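(* Let $E$ be an elliptic curve defined over $\mathbb{Q}$ which has a rational point over $\mathbb{Q}$. Then there exist a finitely generated torsion-free nilpotent group $G$ of nilpotency class $2$ with $9$ generators, an associated Lie algebra (Lie ring) $L$ over $\mathbb{Z}$, two lines $M_1, M_2$ (in the affine plane of $E$, defined over $\mathbb{Q}$), and rational functions $P_1,\dots,P_5\in\mathbb{Q}(X,Y)$ such that for almost all primes $p$ (in particular including the primes dividing neither the discriminant nor the coefficients of the curve $E$) we have $$\zeta^{\triangleleft}_{G,p}(s)=\zeta^{\triangleleft}_{L,p}(s)=P_1(p,p^{-s})+|E(\mathbb{F}_p)|\,P_2(p,p^{-s})+|M_1\cap E(\mathbb{F}_p)|\,P_3(p,p^{-s})+|M_2\cap E(\mathbb{F}_p)|\,P_4(p,p^{-s})+|M_1\cap M_2\cap E(\mathbb{F}_p)|\,P_5(p,p^{-s}).$$ Furthermore $P_2\not\equiv 0$.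
   Context: For a finitely generated group $G$ and a prime $p$, the local normal zeta function is $\zeta^{\triangleleft}_{G,p}(s)=\sum_{H} |G:H|^{-s}$, the sum over all normal subgroups $H$ of $G$ of finite index a power of $p$. For a Lie ring $L$ over $\mathbb{Z}$ (additively a finitely generated free abelian group), $\zeta^{\triangleleft}_{L,p}(s)=\sum_{I}|L:I|^{-s}$, the sum over all ideals $I$ of $L$ of finite additive index a power of $p$. Here $|E(\mathbb{F}_p)|$, $|M_i\cap E(\mathbb{F}_p)|$, etc. denote the numbers of $\mathbb{F}_p$-points of the reductions modulo $p$ of $E$ and of its intersections with the given lines. *)

(* Defs.v *)
From HB Require Import structures.
From mathcomp Require Import all_boot all_order all_algebra.
From mathcomp Require Import finmap fraction polyXY.
From mathcomp Require Import all_classical reals.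
From mathcomp.analysis Require Import sequences exp trigo.
From mathcomp Require Import complex.

Set Implicit Arguments.
Unset Strict Implicit.
Unset Printing Implicit Defensive.
Import Order.TTheory GRing.Theory Num.Theory.
Local Open Scope classical_set_scope.
Local Open Scope ring_scope.

(** * Elliptic curves and lines *)

Record weierstrass (F : Type) :=
  Weierstrass { wa1 : F; wa2 : F; wa3 : F; wa4 : F; wa6 : F }.

Definition wcoefs F (E : weierstrass F) : seq F :=
  [:: wa1 E; wa2 E; wa3 E; wa4 E; wa6 E].

Definition wmap F F' (f : F -> F') (E : weierstrass F) : weierstrass F' :=
  Weierstrass (f (wa1 E)) (f (wa2 E)) (f (wa3 E)) (f (wa4 E)) (f (wa6 E)).

Definition discriminant (F : comNzRingType) (E : weierstrass F) : F :=
  let: Weierstrass a1 a2 a3 a4 a6 := E in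
  let b2 := a1 ^+ 2 + 4 * a2 in
  let b4 := 2 * a4 + a1 * a3 in
  let b6 := a3 ^+ 2 + 4 * a6 in
  let b8 := a1 ^+ 2 * a6 + 4 * a2 * a6 - a1 * a3 * a4 + a2 * a3 ^+ 2 - a4 ^+ 2 in
  - b2 ^+ 2 * b8 - 8 * b4 ^+ 3 - 27 * b6 ^+ 2 + 9 * b2 * b4 * b6.

(* The projective points of the curve: [None] is the point at infinity
   (0 : 1 : 0), the only point of a Weierstrass curve at infinity. *)
Definition ec_point (F : Type) : Type := option (F * F).

Definition on_curve (F : comNzRingType) (E : weierstrass F) (P : ec_point F) : bool :=
  if P is Some (x, y) then
    y ^+ 2 + wa1 E * x * y + wa3 E * y
    == x ^+ 3 + wa2 E * x ^+ 2 + wa4 E * x + wa6 E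
  else true.

(* [ratr q : 'F_p] is the image of the numerator of [q] divided by that of its
   denominator: it is the reduction of [q] modulo [p] as soon as [q] is
   [p]-integral. *)
Definition curve_points (E : weierstrass rat) (p : nat) : {set ec_point 'F_p} :=
  [set P : option ('F_p * 'F_p) | on_curve (wmap ratr E) P]%SET.

(* The affine line aX + bY + c = 0.  Every line over Q has such a primitive
   integral equation, unique up to sign; reduction modulo [p] is the reduction
   of this equation. *)
Record line := Line {
  la : int; lb : int; lc : int;
  line_nonconst : (la != 0) || (lb != 0);
  line_primitive : gcdz la (gcdz lb lc) = 1 }.

Definition on_line (F : comNzRingType) (M : line) (P : ec_point F) : bool :=
  if P is Some (x, y) then (la M)%:~R * x + (lb M)%:~R * y + (lc M)%:~R == 0
  else false.

Definition line_points (M : line) (p : nat) : {set ec_point 'F_p} :=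
  [set P : option ('F_p * 'F_p) | on_line M P]%SET.

(* [q] is neither zero nor a [p]-adic unit.  A zero coefficient is thus not
   considered to be divisible by every prime. *)
Definition prime_divides_rat (p : nat) (q : rat) : bool :=
  (q != 0) && ((p %| `|numq q|) || (p %| `|denq q|))%N.

Definition bad_prime (E : weierstrass rat) (p : nat) : bool :=
  prime p && has (prime_divides_rat p) (discriminant E :: wcoefs E).

(** * Groups *)

Section Groups.
Variable G : groupType.

Definition is_subgroup (H : set G) : Prop :=
  H 1%g /\ (forall g h, H g -> H h -> H (g * h^-1)%g).

Definition is_normal (H : set G) : Prop :=
  is_subgroup H /\ (forall g h, H h -> H (h ^ g)%g).

Definition left_cosets (H : set G) : set (set G) :=
  [set [set (g * h)%g | h in H] | g in [set: G]].

(* |G : H|, with value 0 when the index is infinite. *)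
Definition group_index (H : set G) : nat := #|` fset_set (left_cosets H)|%fset.

Definition group_center : set G := [set z | forall g, commute z g].

Definition generated_by_n (n : nat) : Prop :=
  exists x : 'I_n -> G, forall H : set G,
    is_subgroup H -> (forall i, H (x i)) -> H = [set: G].

Definition torsion_free : Prop :=
  forall (g : G) (n : nat), (0 < n)%N -> (g ^+ n)%g = 1%g -> g = 1%g.

Definition nilpotent_of_class_2 : Prop :=
  (forall g h, group_center [~ g, h]%g) /\ (exists g h : G, [~ g, h]%g <> 1%g).

End Groups.

(** * Lie rings *)

Record lieRing := LieRing {
  lie_sort :> zmodType;
  lie_br : lie_sort -> lie_sort -> lie_sort;
  lie_brDl : forall x y z, lie_br (x + y) z = lie_br x z + lie_br y z;
  lie_brDr : forall x y z, lie_br x (y + z) = lie_br x y + lie_br x z;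
  lie_brxx : forall x, lie_br x x = 0;
  lie_jacobi : forall x y z,
    lie_br x (lie_br y z) + lie_br y (lie_br z x) + lie_br z (lie_br x y) = 0 }.

Section LieRings.
Variable L : lieRing.

Definition free_of_rank (n : nat) : Prop :=
  exists f : {additive 'rV[int]_n -> lie_sort L}, bijective f.

Definition is_ideal (I : set L) : Prop :=
  [/\ I 0, (forall x y, I x -> I y -> I (x - y)) &
      forall x y, I y -> I (lie_br x y)].

Definition add_cosets (I : set L) : set (set L) :=
  [set [set x + y | y in I] | x in [set: L]].

Definition lie_index (I : set L) : nat := #|` fset_set (add_cosets I)|%fset.

End LieRings.

(* [L] is isomorphic to the Lie ring G/Z(G) (+) Z(G) attached to a group of
   class 2, the bracket of (g Z(G), z) and (h Z(G), w) being (1, [g, h]).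
   [q] is G -> G/Z(G) followed by the inclusion of the first summand, and [c],
   used only on Z(G), is the inclusion of the second one. *)
Definition associated_lie_ring (G : groupType) (L : lieRing) : Prop :=
  exists q c : G -> L,
  let Z := @group_center G in
  [/\ (forall g h, q (g * h)%g = q g + q h) /\ (forall g, q g = 0 <-> Z g),
      (forall z w, Z z -> Z w -> c (z * w)%g = c z + c w),
      (forall x : L, exists g z, Z z /\ x = q g + c z),
      (forall g z, Z z -> q g + c z = 0 -> q g = 0 /\ z = 1%g) &
      (forall g h z w, Z z -> Z w ->
         lie_br (q g + c z) (q h + c w) = c [~ g, h]%g)].

(** * Zeta functions *)

(* The family [f], restricted to [D], is summable with sum [z], for the
   unconditional (equivalently, absolute) convergence of complex series. *)
Definition has_sum (C : numFieldType) (I : choiceType) (D : set I) (f : I -> C)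
    (z : C) : Prop :=
  forall e : C, 0 < e ->
  exists2 A : {fset I}, [set` A] `<=` D &
  forall B : {fset I}, [set` A] `<=` [set` B] -> [set` B] `<=` D ->
    `| \sum_(i <- B) f i - z | < e.

(* n ^ s = exp (s log n), for n > 0. *)
Definition natcpow (R : realType) (n : nat) (s : R[i]) : R[i] :=
  let t := ln (n%:R : R) in
  (expR (complex.Re s * t) * cos (complex.Im s * t)
   +i* (expR (complex.Re s * t) * sin (complex.Im s * t)))%C.

Definition is_p_power (p n : nat) : Prop := exists k : nat, n = (p ^ k)%N.

(* [z] is the value at [s] of the (convergent) local normal zeta function. *)
Definition group_zeta_value (R : realType) (G : groupType) (p : nat)
    (s z : R[i]) : Prop :=
  has_sum [set H : set G | is_normal H /\ is_p_power p (group_index H)]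
    (fun H => natcpow (group_index H) (- s)) z.

Definition lie_zeta_value (R : realType) (L : lieRing) (p : nat)
    (s z : R[i]) : Prop :=
  has_sum [set I : set L | is_ideal I /\ is_p_power p (lie_index I)]
    (fun I => natcpow (lie_index I) (- s)) z.

(** * Rational functions in two variables over Q *)

(* The outer variable is X, the inner one is Y. *)
Definition ratfun2 : Type := {fraction {poly {poly rat}}}.

Definition poly2_eval (C : fieldType) (P : {poly {poly rat}}) (x y : C) : C :=
  (map_poly (map_poly ratr) P).[x, y].

(* [P] is defined at (x, y), with value [z]. *)
Definition ratfun2_value (C : fieldType) (P : ratfun2) (x y z : C) : Prop :=
  exists N D : {poly {poly rat}},
    [/\ P = tofrac N / tofrac D, poly2_eval D x y != 0 &
        z = poly2_eval N x y / poly2_eval D x y].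

(* Main.v *)
(* L is Z^6 + Z^3 with the bracket Z^6 x Z^6 -> Z^3 given by a 6 x 6 alternating
   matrix B of linear forms in (x, y, z) whose Pfaffian is the homogenized
   integral model of E, and G is the same set with the product twisted by a
   bilinear cocycle beta such that beta u v - beta v u = [u, v]; the Lie ring
   itself is the case beta = 0.

   A normal subgroup (or ideal) H of p-power index has a kernel
   Lam = H /\ Z^3 and an image P in Z^6; H is normal iff P lies in
   X(Lam) = {u | [u, -] in Lam}, and each such pair (Lam, P) comes from
   |Z^3 : Lam|^6 subgroups H.  With Y = p^-s the zeta function is therefore
   zeta(Z^6) times the sum over Lam of (p^6 Y)^(log |Z^3 : Lam|) Y^(log |Z^6 : X(Lam)|).

   If Z^3 / Lam has type (p^a, p^b, p^c) with c <= b <= a, and l is a primitive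
   vector mod p^a with l . Lam in p^a Z, then |Z^6 : X(Lam)| = p^(6a - 2m) for
   m = min (v_p (Pf B(l)), a - b), because B(l) has rank at least 4 mod p at
   every primitive l.  Counting pairs (Lam, l) in two ways reduces the sum to the
   number of primitive l mod p^a with p^i | Pf B(l), which by smoothness and
   Hensel lifting is a power of p times (p - 1) |E(F_p)|.  No line is needed:
   P3 = P4 = P5 = 0. *)
Require Import Defs.
From mathcomp Require Import all_boot all_order all_algebra.
From mathcomp Require Import fraction all_classical reals complex.
From HB Require Import structures.
From mathcomp Require Import finmap perm topology normedtype sequences exp trigo zify ring lra.
Import Order.TTheory GRing.Theory Num.Theory numFieldNormedType.Exports.
Set Implicit Arguments.
Unset Strict Implicit.
Unset Printing Implicit Defensive.
Local Open Scope classical_set_scope.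
Local Open Scope ring_scope.

(** * Unconditional sums *)

(** The alternating matrix is chosen so that two facts hold modulo every good [p]. First, the cubic
    contains no line, so the radicals of the forms at two independent vectors meet in 0
    ([rad_no_common]). This is what forces X(Lam) into p^b Z^6, and only the gap a - b then sees the
    Pfaffian. Second, the cubic is smooth, which makes Hensel counts exact. The cocycle is the upper
    triangular half of the bracket rather than half of the bracket, so that it is integral at 2. It
    is then symmetric only modulo Lam on P, and the subgroups over (Lam, P) have to be built from an
    explicit quadratic section. Regrouping a complex sum needs absolute convergence. Every term here
    satisfies |f_Y| = f_|Y|, so each summation result is stated for all Y with |Y| in a fixed range
    and is applied both at Y and at |Y|. The range |Y| < p^-10, that is Re s > 10, is a round bound
    under which all the geometric series converge. Types are parametrized by the gaps c, f = b - c,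
    e = a - b: the sum becomes three nested geometric series, in c, in f and in e, the last with two
    ratios. *)

Section HasSum.
Variable C : numClosedFieldType.
Implicit Types I J : choiceType.

Lemma eq_has_sum I (D D' : set I) (f f' : I -> C) z :
  (forall i, D i <-> D' i) -> (forall i, D i -> f i = f' i) ->
  has_sum D f z -> has_sum D' f' z.
Proof.
move=> DD' ff' + e e0 => /(_ e e0) [A AD HA]; exists A => [i /AD /DD' //|].
move=> B AB BD'.
suff <- : \sum_(i <- B) f i = \sum_(i <- B) f' i.
  by apply: HA => // i /BD' /DD'.
by rewrite !big_seq; apply: eq_bigr => i /BD' /DD' /ff'.
Qed.

Lemma has_sum_fin I (D : set I) (A : {fset I}) (f : I -> C) :
  (forall i, D i <-> i \in A) -> has_sum D f (\sum_(i <- A) f i).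
Proof.
move=> DA e e0; exists A => [i /DA //|B AB BD].
suff -> : B = A by rewrite subrr normr0.
by apply/fsetP => i; apply/idP/idP => [/BD /DA|/AB].
Qed.

Lemma has_sumD I (D : set I) (f g : I -> C) y z :
  has_sum D f y -> has_sum D g z -> has_sum D (fun i => f i + g i) (y + z).
Proof.
move=> hf hg e e0.
have e2 : 0 < e / 2 by rewrite divr_gt0.
have [A AD HA] := hf _ e2; have [A' AD' HA'] := hg _ e2.
exists (A `|` A')%fset.
  by move=> i /=; rewrite inE => /orP[/AD|/AD'].
move=> B AB BD; rewrite big_split /= opprD addrACA.
apply: le_lt_trans (ler_normD _ _) _; rewrite [e]splitr ltrD //.
  by apply: HA => // i iA; apply: AB; rewrite /= inE iA.
by apply: HA' => // i iA; apply: AB; rewrite /= inE iA orbT.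
Qed.

Lemma has_sumZ I (D : set I) (f : I -> C) c z :
  has_sum D f z -> has_sum D (fun i => c * f i) (c * z).
Proof.
move=> hf e e0.
(* [c] may be 0, hence the added 1. *)
have c0 : 0 < `|c| + 1 by rewrite ltr_wpDl.
have [A AD HA] := hf (e / (`|c| + 1)) (divr_gt0 e0 c0).
exists A => // B AB BD; rewrite -mulr_sumr -mulrBr normrM.
apply: le_lt_trans (_ : (`|c| + 1) * `|\sum_(i <- B) f i - z| < _).
  by rewrite ler_wpM2r // lerDl.
by rewrite mulrC -ltr_pdivlMr //; apply: HA.
Qed.

(** The order of [C] is partial, so the sum of a nonnegative family has to be known real before it
    can be compared with anything. The imaginary part of [z] is bounded by the distance from [z] to
    any real number. *)
Lemma real_approx (z : C) :
  (forall e, 0 < e -> exists2 r, r \is Num.real & `|r - z| < e) ->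
  z \is Num.real.
Proof.
move=> H; apply/Creal_ImP/eqP; case: eqVneq => // Im0.
have e0 : 0 < `|'Im z| by rewrite normr_gt0.
have [r rR] := H _ e0; rewrite distrC => lt.
suff : `|'Im z| <= `|z - r| by move/(lt_le_trans lt); rewrite ltxx.
have -> : 'Im z = 'Im (z - r).
  by rewrite raddfB /= (Creal_ImP _ rR) subr0.
rewrite -(@ler_pXn2r _ 2) ?nnegrE // [leRHS]normC2_Re_Im real_normK ?Creal_Im //.
by rewrite lerDr -realEsqr Creal_Re.
Qed.

Lemma sum_fset_sub I (A B : {fset I}) (f : I -> C) : {subset A <= B} ->
  \sum_(i <- B) f i = \sum_(i <- A) f i + \sum_(i <- (B `\` A)%fset) f i.
Proof.
move=> AB; rewrite (big_fsetID _ (fun i => i \in A)) /=; congr (_ + _).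
  apply: eq_fbigl => i; rewrite !inE /=.
  by case: (boolP (i \in A)) => [/AB ->|]; rewrite ?andbF ?andbT.
by apply: eq_fbigl => i; rewrite !inE /= andbC.
Qed.

(** If a finite sum exceeded [z], take the gap as tolerance: enlarging the approximating set by [B]
    gives a sum at least as large, hence too far from [z]. *)
Lemma has_sum_ge0_le I (D : set I) (f : I -> C) z (B : {fset I}) :
  (forall i, D i -> 0 <= f i) -> has_sum D f z -> [set` B] `<=` D ->
  \sum_(i <- B) f i <= z.
Proof.
move=> f0 hf BD.
have sum0 (A : {fset I}) : [set` A] `<=` D -> 0 <= \sum_(i <- A) f i.
  by move=> AD; rewrite big_seq; apply: sumr_ge0 => i /AD /f0.
have zR : z \is Num.real.
  apply: real_approx => e /hf [A AD HA]; exists (\sum_(i <- A) f i).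
    exact/ger0_real/sum0.
  exact: HA.
rewrite (real_leNgt (ger0_real (sum0 _ BD)) zR); apply/negP => lt.
rewrite -subr_gt0 in lt; have [A AD HA] := hf _ lt.
have := HA (A `|` B)%fset; set s := (A `|` B)%fset.
have sD : [set` s] `<=` D by move=> i /=; rewrite inE => /orP[/AD|/BD].
have As : [set` A] `<=` [set` s] by move=> i /= iA; rewrite inE iA.
move=> /(_ As sD); rewrite real_ltr_norml; last first.
  by rewrite rpredB // ger0_real // sum0.
case/andP => _; rewrite ltrD2r (@sum_fset_sub _ B s); last first.
  by move=> i iB; rewrite inE iB orbT.
rewrite gtrDl => /lt_geF; rewrite sum0 // => i /=.
by rewrite inE => /andP[_ /sD].
Qed.

Lemma sum_fibers I J (p : I -> J) (B : {fset I}) (K : {fset J}) (f : I -> C) :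
  (forall i, i \in B -> p i \in K) ->
  \sum_(i <- B) f i = \sum_(j <- K) \sum_(i <- [fset i in B | p i == j]%fset) f i.
Proof.
move=> BK; rewrite (partition_big_imfset _ p).
under eq_bigr do rewrite big_fset_condE /=.
apply: big_fset_incl.
  by apply/fsubsetP => j /imfsetP[i /= iB ->]; apply: BK.
move=> j jK jB; rewrite (_ : [fset i in B | p i == j]%fset = fset0) ?big_seq_fset0 //.
apply/fsetP => i; rewrite !inE /=; apply/negP => /andP[iB /eqP pij].
by move/negP: jB; apply; apply/imfsetP; exists i.
Qed.

Section Fib.
Variables (I J : choiceType) (D : set I) (E : set J) (p : I -> J).

Local Notation fib j := [set i | D i /\ p i = j].

(** Tonelli: a partial sum over a fibre never exceeds [g j], so what lies outside finitely many
    fibres is controlled by the tail of [g]. *)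
Lemma has_sum_fib_ge0 (f : I -> C) (g : J -> C) z :
  (forall i, D i -> E (p i)) -> (forall i, D i -> 0 <= f i) ->
  (forall j, E j -> has_sum (fib j) f (g j)) -> has_sum E g z ->
  has_sum D f z.
Proof.
move=> pD f0 hf hg e e0.
have e4 : 0 < e / 4 by rewrite divr_gt0.
have [K KE HK] := hg _ e4.
(* The tolerance is shared among the fibres over [K]; the successor keeps the quotient defined when
   [K] is empty. *)
pose d := e / 4 / (#|`K|).+1%:R.
have d0 : 0 < d by rewrite divr_gt0.
have /choice [A HA] : forall j, exists A : {fset I}, E j ->
    [set` A] `<=` fib j /\ forall B : {fset I}, [set` A] `<=` [set` B] ->
    [set` B] `<=` fib j -> `|\sum_(i <- B) f i - g j| < d.
  move=> j; case: (pselect (E j)) => [Ej|nEj]; last by exists fset0 => /nEj.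
  by have [A AD hA] := hf j Ej d d0; exists A.
exists (\bigcup_(j <- K) A j)%fset.
  move=> i /bigfcupP[j /andP[jK _] iA].
  by have [/(_ i iA)[]] := HA j (KE _ jK).
move=> B AB BD.
pose M := ((p @` B) `|` K)%fset.
have ME : [set` M] `<=` E.
  by move=> j /=; rewrite inE => /orP[/imfsetP[i /= iB ->]|/KE //]; apply/pD/BD.
pose s j := \sum_(i <- [fset i in B | p i == j]%fset) f i.
have -> : \sum_(i <- B) f i = \sum_(j <- M) s j.
  by apply: sum_fibers => i iB; rewrite inE in_imfset.
have sub j : [set` [fset i in B | p i == j]%fset] `<=` fib j.
  by move=> i /=; rewrite !inE => /andP[iB /eqP]; split=> //; apply: BD.
have -> : \sum_(j <- M) s j = \sum_(j <- M) g j - \sum_(j <- M) (g j - s j).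
  by rewrite sumrB opprB addrC subrK.
have KM : {subset K <= M} by move=> j jK; rewrite inE jK orbT.
rewrite (sum_fset_sub (fun j => g j - s j) KM).
have gs j : j \in M -> 0 <= s j <= g j.
  move=> /ME Ej; rewrite (has_sum_ge0_le _ (hf j Ej) (@sub j)) ?andbT.
    by rewrite /s big_seq; apply: sumr_ge0 => i /sub [/f0].
  by move=> i [/f0].
have b1 : `|\sum_(j <- M) g j - z| < e / 4 by apply: HK.
have b2 : `|\sum_(j <- K) (g j - s j)| <= e / 4.
  apply: le_trans (ler_norm_sum _ _ _) _.
  apply: le_trans (_ : \sum_(j <- K) d <= _).
    rewrite big_seq [leRHS]big_seq; apply: ler_sum => j jK.
    rewrite distrC; apply/ltW; have [_ ->] := HA j (KE _ jK) => // i iA.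
    have [/(_ i iA)[Di pij] _] := HA j (KE _ jK).
    rewrite /= !inE pij eqxx andbT; apply: AB.
    by apply/bigfcupP; exists j => //; rewrite jK.
  rewrite big_const_seq count_predT iter_addr_0 -[leLHS]mulr_natr /d mulrAC.
  by rewrite ler_pdivrMr // ler_wpM2l ?ler_nat // ltW.
have b3 : `|\sum_(j <- (M `\` K)%fset) (g j - s j)| < e / 4 + e / 4.
  apply: le_lt_trans (_ : `|\sum_(j <- (M `\` K)%fset) g j| < _).
    rewrite !ger0_norm.
    - rewrite big_seq [leRHS]big_seq; apply: ler_sum => j.
      by rewrite inE => /andP[_ /gs /andP[? _]]; rewrite gerBl.
    - rewrite big_seq; apply: sumr_ge0 => j.
      by rewrite inE => /andP[_ /gs /andP[/le_trans]]; apply.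
    - rewrite big_seq; apply: sumr_ge0 => j.
      by rewrite inE => /andP[_ /gs /andP[_]]; rewrite subr_ge0.
  have -> : \sum_(j <- (M `\` K)%fset) g j
     = (\sum_(j <- M) g j - z) - (\sum_(j <- K) g j - z).
    by rewrite (sum_fset_sub g KM); ring.
  by apply: le_lt_trans (ler_normB _ _) _; rewrite ltrD // HK.
rewrite addrAC; apply: le_lt_trans (ler_normB _ _) _.
have -> : e = e / 4 + (e / 4 + (e / 4 + e / 4)) by field.
rewrite ltrD //; apply: le_lt_trans (ler_normD _ _) _.
by rewrite ler_ltD.
Qed.

(** Fubini: the Tonelli case applied to the norms gives absolute summability, which bounds any
    finite sum of terms outside a large enough set. *)
Lemma has_sum_fib (f : I -> C) (g g' : J -> C) z z' :
  (forall i, D i -> E (p i)) ->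
  (forall j, E j -> has_sum (fib j) f (g j)) ->
  (forall j, E j -> has_sum (fib j) (fun i => `|f i|) (g' j)) ->
  has_sum E g z -> has_sum E g' z' -> has_sum D f z.
Proof.
move=> pD hf hf' hg hg'.
have ha : has_sum D (fun i => `|f i|) z' by apply: has_sum_fib_ge0 hf' hg'.
move=> e e0; have e4 : 0 < e / 4 by rewrite divr_gt0.
have [A AD HA] := ha _ e4; exists A => // B AB BD.
have [K KE HK] := hg _ e4.
pose M := ((p @` B) `|` K)%fset.
have ME : [set` M] `<=` E.
  by move=> j /=; rewrite inE => /orP[/imfsetP[i /= iB ->]|/KE //]; apply/pD/BD.
pose d := e / 4 / (#|`M|).+1%:R.
have d0 : 0 < d by rewrite divr_gt0.
have /choice [F HF] : forall j, exists A : {fset I}, E j ->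
    [set` A] `<=` fib j /\ forall B : {fset I}, [set` A] `<=` [set` B] ->
    [set` B] `<=` fib j -> `|\sum_(i <- B) f i - g j| < d.
  move=> j; case: (pselect (E j)) => [Ej|nEj]; last by exists fset0 => /nEj.
  by have [A0 AD0 hA] := hf j Ej d d0; exists A0.
pose N j := (F j `|` [fset i in B | p i == j])%fset.
have Nfib j : j \in M -> [set` N j] `<=` fib j.
  move=> /ME Ej i; rewrite /= inE => /orP[|].
    by have [+ _] := HF j Ej; apply.
  by rewrite !inE /= => /andP[/BD Di /eqP].
pose B' := (\bigcup_(j <- M) N j)%fset.
have BB' : {subset B <= B'}.
  move=> i iB; apply/bigfcupP; exists (p i); last by rewrite !inE iB eqxx orbT.
  by rewrite andbT inE in_imfset.
have B'D : [set` B'] `<=` D.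
  by move=> i /bigfcupP[j /andP[jM _] /(Nfib _ jM)[]].
(* [B] is enlarged to [B'], where each fibre over [M] is filled up to within [d] of its sum; the
   surplus [B'] minus [B] is small in norm by [HA]. *)
have -> : \sum_(i <- B) f i - z = (\sum_(j <- M) g j - z)
    + (\sum_(i <- B') f i - \sum_(j <- M) g j) - \sum_(i <- (B' `\` B)%fset) f i.
  rewrite (sum_fset_sub f BB'); ring.
have b1 : `|\sum_(j <- M) g j - z| < e / 4.
  by apply: HK => // j jK; rewrite /= inE jK orbT.
have b2 : `|\sum_(i <- B') f i - \sum_(j <- M) g j| <= e / 4.
  rewrite (@sum_fibers _ _ p B' M); last first.
    by move=> i /bigfcupP[j /andP[jM _] /(Nfib _ jM)[_ ->]].
  rewrite -sumrB; apply: le_trans (ler_norm_sum _ _ _) _.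
  apply: le_trans (_ : \sum_(j <- M) d <= _).
    rewrite big_seq [leRHS]big_seq; apply: ler_sum => j jM.
    rewrite (_ : [fset i in B' | p i == j]%fset = N j).
      apply/ltW; have [_ ->] := HF j (ME _ jM) => //; last exact: Nfib.
      by move=> i iA; rewrite /N /= inE; apply/orP; left.
    apply/fsetP => i; rewrite !inE /=; apply/andP/idP.
      move=> [/bigfcupP[k /andP[kM _] iN] /eqP pij].
      have [_ pik] := Nfib _ kM _ iN.
      have kj : k = j by rewrite -pik.
      by move: iN; rewrite kj !inE.
    move=> iN; have iN' : i \in N j by rewrite !inE.
    have [_ ->] := Nfib _ jM _ iN'; split=> //.
    by apply/bigfcupP; exists j => //; rewrite jM.
  rewrite big_const_seq count_predT iter_addr_0 -[leLHS]mulr_natr /d mulrAC.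
  by rewrite ler_pdivrMr // ler_wpM2l ?ler_nat // ltW.
have b3 : `|\sum_(i <- (B' `\` B)%fset) f i| < e / 4 + e / 4.
  apply: le_lt_trans (ler_norm_sum _ _ _) _.
  rewrite -[ltLHS]ger0_norm ?sumr_ge0 //.
  have -> : \sum_(i <- (B' `\` B)%fset) `|f i|
     = (\sum_(i <- B') `|f i| - z') - (\sum_(i <- B) `|f i| - z').
    by rewrite (sum_fset_sub (fun i => `|f i|) BB'); ring.
  apply: le_lt_trans (ler_normB _ _) _; rewrite ltrD // HA // => i iA.
  exact/BB'/AB.
apply: le_lt_trans (ler_normB _ _) _.
have -> : e = e / 4 + e / 4 + (e / 4 + e / 4) by field.
rewrite ltrD //; apply: le_lt_trans (ler_normD _ _) _.
by rewrite ltr_leD.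
Qed.

End Fib.

(** Splits off index 0, where the summands below follow a different formula than at successors. *)
Lemma has_sum_nat_recl (f : nat -> C) z :
  has_sum setT (fun n => f n.+1) z -> has_sum setT f (f 0%N + z).
Proof.
move=> hf e /hf [A _ HA]; exists (0%N |` [fset n.+1 | n in A])%fset => // B AB _.
have B0 : 0%N \in B by apply: AB; rewrite /= !inE.
rewrite (big_fsetD1 _ B0) /= opprD addrACA subrr add0r.
have inS : injective S by move=> x y [].
pose B' := [fset n.-1 | n in (B `\ 0%N)]%fset.
have -> : \sum_(i <- (B `\ 0%N)%fset) f i = \sum_(i <- B') f i.+1.
  rewrite /B' [RHS]big_imfset.
    rewrite [LHS]big_seq [RHS]big_seq; apply: eq_bigr => n.
    by rewrite !inE => /andP[n0 _]; rewrite prednK // lt0n.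
  by move=> [|m] [|n]; rewrite !inE // => _ _ /= ->.
apply: HA => // n nA; apply/imfsetP; exists n.+1 => //=.
by rewrite !inE; apply: AB; rewrite /= !inE; apply/orP; right; apply/imfsetP; exists n.
Qed.

End HasSum.

(** * Geometric series over the complex numbers *)

Section Geometric.
Variable R : realType.
Local Notation C := (R[i]).

Lemma sum_iota_fset (f : nat -> C) N :
  \sum_(n <- [fset val i | i in 'I_N]%fset) f n = \sum_(i < N) f i.
Proof.
rewrite big_imfset /=; last by move=> i j _ _; apply: val_inj.
by rewrite big_enum.
Qed.

Lemma sum_geom_lt (x : C) N : x != 1 ->
  \sum_(i < N) x ^+ i = (1 - x ^+ N) / (1 - x).
Proof.
move=> x1; have x1' : 1 - x != 0 by rewrite subr_eq0 eq_sym.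
apply: (mulIf x1'); rewrite mulfVK // mulrC.
by rewrite -[RHS]opprB subrX1 -mulNr opprB.
Qed.

Lemma expr_lt_eps (a e : C) : 0 <= a -> a < 1 -> 0 < e ->
  exists N, a ^+ N < e.
Proof.
(* Being comparable with 0 forces the imaginary parts to vanish, so the claim is one about real
   powers. *)
case: a => [r r']; case: e => [s s']; rewrite lecE !ltcE /=.
move=> /andP[/eqP -> r0] /andP[_ r1] /andP[/eqP -> s0].
have : `|r| < 1 by rewrite ger0_norm.
move=> /cvg_expr /cvgrPdist_lt /(_ _ s0) [N _ /(_ N (leqnn N))] /=.
rewrite sub0r normrN ger0_norm ?exprn_ge0 // => lt.
by exists N; rewrite !complexr0 -rmorphXn /= ltcR.
Qed.

Lemma has_sum_geom (x : C) : `|x| < 1 ->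
  has_sum [set: nat] (fun n => x ^+ n) (1 - x)^-1.
Proof.
set a := `|x| => a1 e e0.
have a0 : 0 <= a by rewrite normr_ge0.
have a1' : 0 < 1 - a by rewrite subr_gt0.
have neq1 (y : C) : `|y| < 1 -> y != 1.
  by move=> y1; apply: contraTneq y1 => ->; rewrite normr1 ltxx.
have d0 : 0 < e / 2 * (1 - a) by rewrite mulr_gt0 // divr_gt0.
have [N HN] := expr_lt_eps (normr_ge0 x) a1 d0.
exists [fset val i | i in 'I_N]%fset => // B AB _.
have AB' : {subset [fset val i | i in 'I_N]%fset <= B} by move=> n; apply: AB.
rewrite (sum_fset_sub _ AB') sum_iota_fset addrAC.
rewrite [e]splitr; apply: le_lt_trans (ler_normD _ _) _.
have b1 : a ^+ N / (1 - a) < e / 2 by rewrite ltr_pdivrMr.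
apply: ltr_leD.
  rewrite sum_geom_lt ?neq1 // -{2}[(1 - x)^-1]mul1r -mulrBl addrAC subrr add0r.
  rewrite mulNr normrN normrM normfV normrX.
  apply: le_lt_trans b1; rewrite ler_wpM2l ?exprn_ge0 // lef_pV2 ?posrE //.
    by rewrite -{1}(normr1 C); apply: lerB_dist.
  by rewrite normr_gt0 subr_eq0 eq_sym neq1.
apply: le_trans (ltW b1).
set D := (B `\` _)%fset.
(* The remaining indices lie in the interval [N, N + M), and the full sum of [a ^+ n] over it is at
   most a^N / (1 - a). *)
have [M HM] : exists M, forall n, n \in D -> (n < M)%N.
  exists (\max_(n <- D) n).+1 => n nD; rewrite ltnS.
  by rewrite (big_fsetD1 _ nD) leq_maxl.
apply: le_trans (ler_norm_sum _ _ _) _.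
under eq_bigr do rewrite normrX.
pose K n := [fset val i | i in 'I_n]%fset.
have inK n k : (k \in K n) = (k < n)%N.
  apply/imfsetP/idP => [[i /= _ ->] //|kn]; by exists (Ordinal kn).
have sub1 : {subset K N <= K (N + M)%N}.
  by move=> k; rewrite !inK => /leq_trans -> //; rewrite leq_addr.
have sub2 : {subset D <= K (N + M)%N `\` K N}%fset.
  move=> k kD; rewrite in_fsetD !inK (ltn_addl N (HM _ kD)) andbT.
  by move: kD; rewrite in_fsetD inK => /andP[].
apply: le_trans (_ : \sum_(n <- (K (N + M)%N `\` K N)%fset) a ^+ n <= _).
  by rewrite (sum_fset_sub _ sub2) lerDl sumr_ge0 // => n _; rewrite (exprn_ge0 _ a0).
have -> : \sum_(n <- (K (N + M)%N `\` K N)%fset) a ^+ n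
    = \sum_(n <- K (N + M)%N) a ^+ n - \sum_(n <- K N) a ^+ n.
  by rewrite (sum_fset_sub _ sub1) addrAC subrr add0r.
have na : a != 1 by rewrite neq1 // normr_id.
rewrite !sum_iota_fset !sum_geom_lt // -mulrBl ler_wpM2r ?invr_ge0 ?(ltW a1') //.
have -> : forall u v : C, 1 - u - (1 - v) = v - u by move=> u v; ring.
by rewrite gerBl exprn_ge0.
Qed.

End Geometric.

(** * Indices and lattices *)

Section Index.
Variable T : Type.
Implicit Types Rel : T -> T -> Prop.

(** A surjective class map carries finiteness and the equivalence axioms with it. The cardinals in
    [group_index] and [lie_index] are 0 for an infinite index and cannot be manipulated directly. *)
Definition has_index Rel (n : nat) : Prop :=
  exists2 c : T -> 'I_n, (forall i, exists x, c x = i) &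
    forall x y, Rel x y <-> c x = c y.

Lemma has_index_fin Rel (K : finType) (c : T -> K) :
  (forall i, exists x, c x = i) -> (forall x y, Rel x y <-> c x = c y) ->
  has_index Rel #|K|.
Proof.
move=> cs cR; exists (fun x => enum_rank (c x)).
  by move=> i; have [x cx] := cs (enum_val i); exists x; rewrite cx enum_valK.
by move=> x y; rewrite cR; split=> [-> //|/enum_rank_inj].
Qed.

Lemma has_index_le Rel m n : has_index Rel m -> has_index Rel n -> (m <= n)%N.
Proof.
move=> [c cs cR] [c' cs' cR']; have [r rK] := choice cs.
rewrite -(card_ord m) -(card_ord n); apply: (leq_card (fun i => c' (r i))).
by move=> i j /cR' /cR; rewrite !rK.
Qed.

Lemma has_index_uniq Rel m n : has_index Rel m -> has_index Rel n -> m = n.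
Proof.
by move=> hm hn; apply/eqP; rewrite eqn_leq !(has_index_le hm hn, has_index_le hn hm).
Qed.

Lemma eq_has_index Rel Rel' n : (forall x y, Rel x y <-> Rel' x y) ->
  has_index Rel n -> has_index Rel' n.
Proof. by move=> RR' [c cs cR]; exists c => // x y; rewrite -RR'. Qed.

(** [Rel] is coarser than the kernel of [c], so a class is determined by the set of colours
    occurring in it, and these sets form a finite type. *)
Lemma has_index_exists Rel n (c : T -> 'I_n) :
  (forall x, Rel x x) -> (forall x y, Rel x y -> Rel y x) ->
  (forall x y z, Rel x y -> Rel y z -> Rel x z) ->
  (forall x y, c x = c y -> Rel x y) -> exists m, has_index Rel m.
Proof.
move=> rR sR tR cR.
pose S x := [set i : 'I_n | `[< exists2 y, c y = i & Rel x y >]]%SET.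
have SR x y : Rel x y <-> S x = S y.
  split=> [xy|eS].
    apply/setP => i; rewrite !inE; apply/asboolP/asboolP => -[z cz Rz];
      exists z => //.
      exact: tR (sR _ _ xy) Rz.
    exact: tR xy Rz.
  have : c y \in S y by rewrite inE; apply/asboolP; exists y.
  by rewrite -eS inE => /asboolP[z /cR /sR yz xz]; apply: tR xz _; apply: sR.
pose K := {s : {set 'I_n} | `[< exists x, S x = s >]}.
have SK x : `[< exists y, S y = S x >] by apply/asboolP; exists x.
exists #|{: K}|; apply: (has_index_fin (c := fun x => exist _ (S x) (SK x) : K)).
  by case=> s Hs; case/asboolP: (Hs) => x Sx; exists x; apply: val_inj.
by move=> x y; rewrite SR; split=> [e|/(congr1 val)//]; apply: val_inj.
Qed.

Lemma has_index_gt0 Rel n (x : T) : has_index Rel n -> (0 < n)%N.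
Proof. by case=> c _ _; apply: leq_ltn_trans (ltn_ord (c x)). Qed.

(** [0 < n] excludes the default cardinal 0 of an infinite set of classes. *)
Lemma card_classes Rel (cl : T -> set T) n : (0 < n)%N ->
  (forall x y, cl x = cl y <-> Rel x y) ->
  (#|` fset_set [set cl x | x in [set: T]]|%fset = n <-> has_index Rel n).
Proof.
move=> n0 clR; set A := [set cl x | x in [set: T]]; split.
  move=> An; have Afin : finite_set A.
    by move: An n0; rewrite /fset_set; case: pselect => // nfin <-; rewrite cardfs0.
  have Acl x : cl x \in fset_set A by rewrite in_fset_set //; apply/mem_set; exists x.
  rewrite -An cardfE.
  apply: (has_index_fin (c := fun x => FSetSub (Acl x))).
    case=> s sA; have := sA; rewrite in_fset_set // => /set_mem [x _ xs].
    by exists x; apply: val_inj.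
  by move=> x y; rewrite -clR; split=> [e|/(congr1 val)//]; apply: val_inj.
move=> [c cs cR]; have [r rK] := choice cs.
have -> : A = [set` [fset cl (r i) | i in 'I_n]%fset].
  apply/seteqP; split=> s /=.
    move=> [x _ <-]; apply/imfsetP; exists (c x) => //=.
    by apply/clR/cR; rewrite rK.
  by move=> /imfsetP[i _ ->]; exists (r i).
rewrite set_fsetK card_imfset /=; first by rewrite size_enum_ord.
by move=> i j /clR /cR; rewrite !rK.
Qed.

End Index.

Section Residues.

(** The target is inhabited for every [d] and has exactly [d] elements once [d] is positive. *)
Definition residue (d : nat) (x : int) : 'I_d.-1.+1 := inord `|(x %% d)%Z|%N.

Lemma residue_val d x : (0 < d)%N -> (residue d x : int) = (x %% d)%Z.
Proof.
move=> d0; have dn0 : d%:Z != 0 by rewrite -lt0n.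
have ge := modz_ge0 x dn0.
rewrite /residue inordK ?gez0_abs // prednK //.
by rewrite -ltz_nat gez0_abs // ltz_pmod // ltz_nat.
Qed.

Lemma residue_eq d x y : (0 < d)%N ->
  residue d x = residue d y <-> (d%:Z %| y - x)%Z.
Proof.
move=> d0; rewrite -eqz_mod_dvd; split=> [e|/eqP e].
  by apply/eqP; rewrite -!residue_val // e.
by apply/val_inj; apply/eqP; rewrite -eqz_nat !residue_val // e.
Qed.

Lemma residue_nat d (i : 'I_d.-1.+1) : (0 < d)%N -> residue d (i : nat) = i.
Proof.
move=> d0; apply/val_inj/eqP; rewrite -eqz_nat residue_val //.
by rewrite modz_small // lez_nat ltz_nat /= -[X in (_ < X)%N](prednK d0).
Qed.

End Residues.

(** * Sublattices of Z^n and their elementary divisors *)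

Section Lattices.

Definition subgroup_of (V : zmodType) (H : set V) : Prop :=
  H 0 /\ forall x y, H x -> H y -> H (x - y).

Lemma subgroup_ofN (V : zmodType) (H : set V) x : subgroup_of H -> H x -> H (- x).
Proof. by move=> [H0 HB] Hx; rewrite -sub0r; apply: HB. Qed.

Lemma subgroup_ofD (V : zmodType) (H : set V) x y :
  subgroup_of H -> H x -> H y -> H (x + y).
Proof.
by move=> HH Hx Hy; rewrite -[y]opprK; apply: HH.2 => //; apply: subgroup_ofN.
Qed.

Lemma subgroup_of_sum (V : zmodType) (H : set V) (I : Type) (r : seq I) (P : pred I)
  (f : I -> V) : subgroup_of H -> (forall i, P i -> H (f i)) -> H (\sum_(i <- r | P i) f i).
Proof.
move=> HH Hf; apply: (big_ind H) => //; first exact: HH.1.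
by move=> x y; apply: subgroup_ofD.
Qed.

Lemma subgroup_of_mulrn (V : zmodType) (H : set V) x n :
  subgroup_of H -> H x -> H (x *+ n).
Proof.
move=> HH Hx; elim: n => [|n IH]; first by rewrite mulr0n; apply: HH.1.
by rewrite mulrS; apply: subgroup_ofD.
Qed.

Lemma subgroup_ofZ n (H : set 'rV[int]_n) (z : int) x :
  subgroup_of H -> H x -> H (z *: x).
Proof.
move=> HH Hx; rewrite -[z]intz scaler_int; case: z => k.
  exact: subgroup_of_mulrn.
by rewrite NegzE mulrNz; apply: subgroup_ofN => //; apply: subgroup_of_mulrn.
Qed.

Definition latidx (V : zmodType) (H : set V) (n : nat) : Prop :=
  has_index (fun x y => H (y - x)) n.

Lemma mxB_entry (V : zmodType) m n (A B : 'M[V]_(m, n)) i j :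
  (A - B) i j = A i j - B i j.
Proof. by rewrite !mxE. Qed.

Lemma mxN_entry (V : zmodType) m n (A : 'M[V]_(m, n)) i j : (- A) i j = - A i j.
Proof. by rewrite mxE. Qed.

Lemma mxD_entry (V : zmodType) m n (A B : 'M[V]_(m, n)) i j :
  (A + B) i j = A i j + B i j.
Proof. by rewrite mxE. Qed.

(** For invertible [U] this is the lattice spanned by the rows of [invmx U], the i-th one multiplied
    by [d i]: a sublattice in elementary divisor form. *)
Definition dlat n (U : 'M[int]_n) (d : 'I_n -> nat) : set 'rV[int]_n :=
  [set v : 'rV[int]_n | forall i, ((d i)%:Z %| ((v *m U) 0 i)%R)%Z].

Lemma dlat_subgroup n (U : 'M[int]_n) d : subgroup_of (dlat U d).
Proof.
split=> [i|x y Hx Hy i]; first by rewrite mul0mx mxE dvdz0.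
by rewrite mulmxBl mxB_entry rpredB.
Qed.

Lemma dlat_idx n (U : 'M[int]_n) d : U \in unitmx -> (forall i, (0 < d i)%N) ->
  latidx (dlat U d) (\prod_i d i).
Proof.
move=> Uu d0; pose K := {dffun forall i : 'I_n, 'I_(d i).-1.+1}.
have -> : (\prod_i d i)%N = #|{: K}|.
  rewrite card_dep_ffun foldrE big_map big_enum /=.
  by apply: eq_bigr => i _; rewrite card_ord prednK.
apply: (has_index_fin (c := fun v => finfun (fun i => residue (d i) ((v *m U) 0 i)) : K)).
  move=> f; exists ((\row_i ((f i : nat) : int)) *m invmx U).
  by apply/ffunP => i; rewrite ffunE mulmxKV // mxE residue_nat.
move=> x y; split=> [H|/ffunP H i].
  apply/ffunP => i; rewrite !ffunE; apply/residue_eq => //.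
  by have := H i; rewrite mulmxBl mxB_entry.
by have := H i; rewrite !ffunE => /(residue_eq _ _ (d0 i)); rewrite mulmxBl mxB_entry.
Qed.

(** Pigeonhole on 0, v, ..., N v: some (j - i) v with 0 < j - i <= N lies in [H]. The exponent N! is
    cruder than N but requires no quotient group. *)
Lemma latidx_exponent (V : zmodType) (H : set V) N : subgroup_of H -> latidx H N ->
  forall v, H (v *+ N`!).
Proof.
move=> HH [c _ cR] v.
have : ~~ injectiveb (fun j : 'I_N.+1 => c (v *+ j)).
  apply/negP => /injectiveP /leq_card; rewrite !card_ord ltnn //.
move=> /injectivePn[i [j nij /cR]].
wlog lt : i j nij / (i < j)%N => [IH|].
  case: (ltngtP i j) => [lt|lt|/val_inj e]; last by rewrite e eqxx in nij.
    exact: IH.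
  move=> /(subgroup_ofN HH); rewrite opprB; apply: (IH j i) => //.
  by rewrite eq_sym.
rewrite -mulrnBr; last exact: ltnW.
have /dvdnP[q ->] : ((j - i) %| N`!)%N.
  by apply: dvdn_fact; rewrite subn_gt0 lt /= (leq_trans (leq_subr _ _)) // -ltnS.
by move=> Hji; rewrite mulnC mulrnA; apply: subgroup_of_mulrn.
Qed.

(** [H] contains M Z^n, so it is generated by M Z^n together with its finitely many vectors with
    entries between 0 and M. These generators are the rows of [A], and its Smith form gives [U] and
    [d]. *)
Lemma lattice_smith n (H : set 'rV[int]_n) N : subgroup_of H -> latidx H N ->
  exists U : 'M[int]_n, exists2 d : nat -> nat, U \in unitmx &
    [/\ forall i, (i < n)%N -> (0 < d i)%N,
        forall i j, (i <= j < n)%N -> (d i %| d j)%N,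
        forall v, H v <-> dlat U d v & N = (\prod_(i < n) d i)%N].
Proof.
move=> HH HN; have N0 : (0 < N)%N by apply: has_index_gt0 HN; exact: 0.
set M := N`!; have M0 : (0 < M)%N by rewrite fact_gt0.
have HM := latidx_exponent HH HN; rewrite -/M in HM.
pose T := {ffun 'I_n -> 'I_M.+1}.
pose tv (t : T) : 'rV[int]_n := \row_i ((t i : nat) : int).
pose B : 'M[int]_(#|{: T}|, n) := \matrix_(k, j)
  (if `[< H (tv (enum_val k)) >] then tv (enum_val k) 0 j else 0).
pose A := col_mx (M%:Z%:M) B.
have HA v : H v <-> exists x, v = x *m A.
  split=> [Hv|[x ->]].
    pose q : 'rV[int]_n := \row_j ((v 0%R j) %/ M)%Z.
    pose t : T := [ffun j => inord `|((v 0%R j) %% M)%Z|%N].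
    have tE : tv t = v - q *m (M%:Z%:M).
      apply/rowP => j; rewrite mul_mx_scalar !mxE ffunE.
      have Mn0 : M%:Z != 0 by rewrite -lt0n.
      have ge := modz_ge0 (v 0 j) Mn0.
      rewrite inordK; last first.
        by rewrite ltnS -lez_nat gez0_abs // ltW // ltz_pmod // ltz_nat.
      rewrite gez0_abs //; apply/eqP; rewrite eq_sym subr_eq addrC mulrC.
      by rewrite -divz_eq.
    have HqM : H (q *m (M%:Z%:M)).
      by rewrite mul_mx_scalar -[M%:Z]intz scaler_int; apply: HM.
    have Ht : H (tv t) by rewrite tE; apply: HH.2.
    exists (row_mx q (delta_mx 0 (enum_rank t))).
    rewrite mul_row_col -rowE.
    have -> : row (enum_rank t) B = tv t.
      by apply/rowP => j; rewrite !mxE enum_rankK asboolT // mxE.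
    by rewrite tE addrC subrK.
  rewrite -[x]hsubmxK mul_row_col; apply: subgroup_ofD => //.
    by rewrite mul_mx_scalar -[M%:Z]intz scaler_int; apply: HM.
  rewrite mulmx_sum_row; apply: subgroup_of_sum => // k _.
  apply: subgroup_ofZ => //.
  case: (pselect (H (tv (enum_val k)))) => Hk.
    rewrite (_ : row k B = tv (enum_val k)) //.
    by apply/rowP => j; rewrite 2!mxE asboolT.
  rewrite (_ : row k B = 0); first exact: HH.1.
  by apply/rowP => j; rewrite 2!mxE asboolF // mxE.
have [L Lu [R Ru [d sd AE]]] := int_Smith_normal_form A.
set D := (\matrix_(_, _) _) in AE.
pose e (i : nat) : nat := absz d`_i.
have xD (x : 'rV[int]_(n + #|{: T}|)) i : (x *m D) 0 i = x 0 (lshift _ i) * d`_i.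
  rewrite mxE (bigD1 (lshift _ i)) //= mxE eqxx mulr1n big1 ?addr0 // => j ji.
  rewrite mxE; case: eqP => [ji'|]; last by rewrite mulr0n mulr0.
  by case/eqP: ji; apply: val_inj.
have HD v : H v <-> dlat (invmx R) e v.
  rewrite HA; split=> [[x ->] i|Hv].
    by rewrite AE !mulmxA mulmxK // xD /e dvdzE /= abszM dvdn_mull.
  pose x : 'rV[int]_(n + #|{: T}|) := row_mx (\row_i (((v *m invmx R) 0%R i) %/ (d`_i)%R)%Z) 0.
  exists (x *m invmx L); rewrite AE !mulmxA mulmxKV //.
  have -> : x *m D = v *m invmx R.
    apply/rowP => i; rewrite xD row_mxEl mxE divzK //.
  by rewrite mulmxKV.
(* [H] contains M times the i-th row of [R], so no elementary divisor vanishes. *)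
have e0 (i : 'I_n) : (0 < e i)%N.
  have : H (delta_mx 0 i *m R *+ M) by apply: HM.
  move=> /HD /(_ i); rewrite -scaler_nat -!scalemxAl mulmxK // !mxE !eqxx mulr1.
  rewrite lt0n; apply: contraL => /eqP e0.
  by rewrite e0 dvd0z pnatr_eq0 -lt0n.
have Ru' : invmx R \in unitmx by rewrite unitmx_inv.
exists (invmx R), e => //; split=> //.
- by move=> i lt; apply: (e0 (Ordinal lt)).
- move=> i j /andP[ij jn].
  (* Past its end the list of divisors reads 0, which [e0] forbids; so it has at least [n] entries
     and the divisibility chain applies to them. *)
  have sz k : (k < n)%N -> (k < size d)%N.
    move=> kn; rewrite ltnNge; apply/negP => le.
    by have := e0 (Ordinal kn); rewrite /e nth_default.
  have := sorted_leq_nth (@dvdz_trans) dvdzz 0 sd.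
  move=> /(_ i j); rewrite !inE !sz ?(leq_ltn_trans ij) // => /(_ isT isT ij).
  by rewrite dvdzE.
- apply: has_index_uniq HN _.
  apply: eq_has_index (dlat_idx Ru' e0) => x y; exact: iff_sym (HD _).
Qed.

End Lattices.

(** * Subgroups of a central extension *)

Section AdditiveFunction.

Lemma additive_linear m n (f : 'rV[int]_m -> 'rV[int]_n) (I : Type) (r : seq I)
    (P : pred I) (c : I -> int) (h : I -> 'rV[int]_m) :
  (forall x y, f (x + y) = f x + f y) ->
  f (\sum_(i <- r | P i) c i *: h i) = \sum_(i <- r | P i) c i *: f (h i).
Proof.
move=> fD.
have f0 : f 0 = 0 by apply: (addrI (f 0)); rewrite -fD !addr0.
have fN x : f (- x) = - f x by apply: (addrI (f x)); rewrite -fD !subrr.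
have fn x k : f (x *+ k) = f x *+ k.
  by elim: k => [|k IH]; rewrite ?mulr0n // !mulrS fD IH.
have fZ z x : f (z *: x) = z *: f x.
  rewrite -[z]intz !scaler_int; case: z => k; first exact: fn.
  by rewrite !NegzE !mulrNz fN -!pmulrn fn.
rewrite (big_morph f fD f0); by under eq_bigr do rewrite fZ.
Qed.

(** The binomial coefficient x (x - 1) / 2: an integral quadratic function whose polarization is
    exactly x y, as [binzD] says. *)
Definition binz (x : int) : int := (x * (x - 1) %/ 2)%Z.

Lemma binzE x : binz x * 2 = x * (x - 1).
Proof.
rewrite /binz divzK //; have := divz_eq x 2; set q := (x %/ 2)%Z.
have := modz_ge0 x (isT : (2 : int) != 0).
have := ltz_pmod x (isT : (0 : int) < 2); set r := (x %% 2)%Z => r2 r0 ->.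
have [->|->] : r = 0 \/ r = 1 by lia.
  by rewrite addr0 mulrAC dvdz_mull.
by rewrite addrK mulrA dvdz_mull.
Qed.

Lemma binzD x y : binz (x + y) = binz x + binz y + x * y.
Proof.
have h2 : (2 : int) != 0 by [].
apply: (mulIf h2); rewrite !mulrDl !binzE; ring.
Qed.

Lemma binz1 : binz 1 = 0. Proof. by []. Qed.
Lemma binz0 : binz 0 = 0. Proof. by []. Qed.

End AdditiveFunction.

Section Extension.
Variables (m n : nat) (beta : 'rV[int]_m -> 'rV[int]_m -> 'rV[int]_n).
Hypothesis betaDl : forall u v w, beta (u + v) w = beta u w + beta v w.
Hypothesis betaDr : forall u v w, beta u (v + w) = beta u v + beta u w.
Local Notation V := ('rV[int]_m * 'rV[int]_n)%type.
Implicit Types (H : set V) (g h : V).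

Lemma beta0l v : beta 0 v = 0.
Proof. by apply: (addrI (beta 0 v)); rewrite -betaDl !addr0. Qed.
Lemma beta0r v : beta v 0 = 0.
Proof. by apply: (addrI (beta v 0)); rewrite -betaDr !addr0. Qed.
Lemma betaNl u v : beta (- u) v = - beta u v.
Proof. by apply: (addrI (beta u v)); rewrite -betaDl !subrr beta0l. Qed.
Lemma betaNr u v : beta u (- v) = - beta u v.
Proof. by apply: (addrI (beta u v)); rewrite -betaDr !subrr beta0r. Qed.

Definition bmul g h : V := (g.1 + h.1, g.2 + h.2 + beta g.1 h.1).
Definition binv g : V := (- g.1, - g.2 + beta g.1 g.1).

Definition bsubgroup H : Prop :=
  H (0, 0) /\ forall g h, H g -> H h -> H (bmul g (binv h)).

Definition bindex H (N : nat) : Prop :=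
  has_index (fun g h => H (bmul (binv g) h)) N.

Definition kerpart H : set 'rV[int]_n := [set a | H (0, a)].
Definition impart H : set 'rV[int]_m := [set u | exists a, H (u, a)].

Let betaE := (betaDl, betaDr, betaNl, betaNr, beta0l, beta0r).

Lemma bmulA g h k : bmul g (bmul h k) = bmul (bmul g h) k.
Proof.
rewrite /bmul /= !betaE addrA; congr pair.
by apply/rowP => i; rewrite !mxE; ring.
Qed.

Lemma bmul1g g : bmul (0, 0) g = g.
Proof. by case: g => u a; rewrite /bmul /= !betaE !add0r addr0. Qed.

Lemma bmulg1 g : bmul g (0, 0) = g.
Proof. by case: g => u a; rewrite /bmul /= !betaE !addr0. Qed.

Lemma bmulVg g : bmul (binv g) g = (0, 0).
Proof.
case: g => u a; rewrite /bmul /binv /= !betaE addNr; congr pair.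
by apply/rowP => i; rewrite !mxE; ring.
Qed.

Lemma bmulgV g : bmul g (binv g) = (0, 0).
Proof.
case: g => u a; rewrite /bmul /binv /= !betaE subrr; congr pair.
by apply/rowP => i; rewrite !mxE; ring.
Qed.

Lemma bmulVgE g h : bmul (binv g) h =
  (h.1 - g.1, h.2 - g.2 + beta g.1 g.1 - beta g.1 h.1).
Proof.
rewrite /bmul /binv /= !betaE addrC; congr pair.
by apply/rowP => i; rewrite !mxE; ring.
Qed.

Lemma binvK g : binv (binv g) = g.
Proof.
case: g => u a; rewrite /binv /= !betaE !opprK opprD opprK.
by rewrite -addrA addNr addr0.
Qed.

Lemma binvM g h : binv (bmul g h) = bmul (binv h) (binv g).
Proof.
rewrite /bmul /binv /= !betaE; congr pair; first by rewrite opprD addrC.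
by apply/rowP => i; rewrite !mxE; ring.
Qed.

Lemma bsubgroupV H g : bsubgroup H -> H g -> H (binv g).
Proof. by move=> [H0 HM] /(HM _ _ H0); rewrite bmul1g. Qed.

Lemma bsubgroupM H g h : bsubgroup H -> H g -> H h -> H (bmul g h).
Proof.
by move=> HH Hg Hh; rewrite -[h]binvK; apply: HH.2 => //; apply: bsubgroupV.
Qed.

Lemma kerpartP H u a b : bsubgroup H -> H (u, a) -> (H (u, b) <-> kerpart H (b - a)).
Proof.
move=> HH Ha.
have e : bmul (0, b - a) (u, a) = (u, b).
  by rewrite /bmul /= !betaE add0r subrK addr0.
split=> [Hb|K]; last by rewrite -e; apply: bsubgroupM.
have := HH.2 _ _ Hb Ha; rewrite -e -bmulA bmulgV bmulg1; exact.
Qed.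

Lemma kerpart_subgroup H : bsubgroup H -> subgroup_of (kerpart H).
Proof.
move=> HH; split=> [|x y Hx Hy]; first exact: HH.1.
exact: (kerpartP x HH Hy).1 Hx.
Qed.

Lemma impart_subgroup H : bsubgroup H -> subgroup_of (impart H).
Proof.
move=> HH; split=> [|x y [a Hx] [b Hy]]; first by exists 0; exact: HH.1.
by eexists; apply: (HH.2 _ _ Hx Hy).
Qed.

(** Each [g] is the product of [(s, red g)], with [s] the chosen representative of its first
    coordinate modulo [impart H], and of an element of [H]. For equal [s], congruence modulo [H] is
    congruence of the [red] modulo [kerpart H]. *)
Lemma bindexM H N1 N2 : bsubgroup H -> latidx (kerpart H) N1 ->
  latidx (impart H) N2 -> bindex H (N1 * N2).
Proof.
move=> HH [c1 c1s c1R] [c2 c2s c2R].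
have [s sK] := choice c2s; have [r rK] := choice c1s.
have /choice [bb Hbb] : forall u, exists b, H (u - s (c2 u), b).
  by move=> u; apply/c2R; rewrite sK.
pose red (g : V) := g.2 - bb g.1 - beta (s (c2 g.1)) (g.1 - s (c2 g.1)).
have gE g : g = bmul (s (c2 g.1), red g) (g.1 - s (c2 g.1), bb g.1).
  case: g => u a; rewrite /bmul /red /= addrC subrK; congr pair.
  by apply/rowP => i; rewrite !mxE; ring.
have -> : (N1 * N2)%N = #|{: 'I_N1 * 'I_N2}| by rewrite card_prod !card_ord.
apply: (has_index_fin (c := fun g => (c1 (red g), c2 g.1))).
  move=> [j i]; exists (s i, r j + bb (s i)).
  by rewrite /red /= !sK addrK subrr beta0r subr0 rK.
move=> g h.
have key : c2 g.1 = c2 h.1 -> (H (bmul (binv g) h) <-> c1 (red g) = c1 (red h)).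
  move=> e; rewrite {1}[g]gE {1}[h]gE -e.
  set x := (g.1 - _, _); set y := (h.1 - _, _).
  have Hx : H x by apply: Hbb.
  have Hy : H y by rewrite /y e; apply: Hbb.
  rewrite binvM -bmulA; set k := bmul (binv (s _, _)) _.
  have -> : k = bmul (0, red h - red g) y.
    rewrite /k bmulA (bmulVgE (s (c2 g.1), red g) (s (c2 g.1), red h)) /= subrr; congr (bmul (_, _) _).
    by apply/rowP => i; rewrite !mxE; ring.
  rewrite -c1R; split=> [Hk|Hk]; last first.
    by apply: bsubgroupM => //; [apply: bsubgroupV | apply: bsubgroupM].
  have := bsubgroupM HH Hx Hk; rewrite bmulA bmulgV bmul1g => /HH.2 /(_ Hy).
  by rewrite -bmulA bmulgV bmulg1.
split=> [Hgh|[e1 e2]]; last exact/key.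
have e : c2 g.1 = c2 h.1.
  by apply/c2R; rewrite bmulVgE in Hgh; eexists; apply: Hgh.
by congr pair => //; apply/key.
Qed.

(** The class map of [H], pulled back along a -> (0, a) and u -> (u, 0), shows that both parts have
    finite index; uniqueness of the index does the rest. *)
Lemma bindex_factor H N : bsubgroup H -> bindex H N ->
  exists N1 N2, [/\ latidx (kerpart H) N1, latidx (impart H) N2 & N = (N1 * N2)%N].
Proof.
move=> HH hN; have [c cs cR] := hN.
have KK := kerpart_subgroup HH; have II := impart_subgroup HH.
have lat (W : zmodType) (L : set W) (f : W -> V) : subgroup_of L ->
    (forall x y, H (bmul (binv (f x)) (f y)) -> L (y - x)) -> exists N, latidx L N.
  move=> LL Lf; apply: (has_index_exists (c := c \o f)).
  - by move=> x; rewrite subrr; apply: LL.1.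
  - by move=> x y /(subgroup_ofN LL); rewrite opprB.
  - by move=> x y z Lxy Lyz; have := subgroup_ofD LL Lyz Lxy; rewrite addrA subrK.
  - by move=> x y /cR /Lf.
have [N1 h1] : exists N, latidx (kerpart H) N.
  apply: (lat _ _ (pair 0) KK) => x y.
  by rewrite bmulVgE /= !beta0l !subr0 addr0.
have [N2 h2] : exists N, latidx (impart H) N.
  apply: (lat _ _ (fun u => (u, 0)) II) => x y.
  by rewrite bmulVgE => Hxy; eexists; apply: Hxy.
exists N1, N2; split=> //; exact: has_index_uniq hN (bindexM HH h1 h2).
Qed.

Section Fiber.
Variables (Lam : set 'rV[int]_n) (P : set 'rV[int]_m) (A : 'M[int]_m) (N : nat).
Variable c : 'rV[int]_n -> 'I_N.
Hypothesis LamS : subgroup_of Lam.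
Hypothesis cR : forall x y, Lam (y - x) <-> c x = c y.
Hypothesis PA : forall u, P u <-> exists x, u = x *m A.
Hypothesis A_inj : forall x : 'rV_m, x *m A = 0 -> x = 0.
Hypothesis beta_sym : forall u v, P u -> P v -> Lam (beta u v - beta v u).
Variable r : 'I_N -> 'rV[int]_n.
Hypothesis rK : cancel r c.

Let b i j := beta (row i A) (row j A).

(* Modulo [Lam], a map x |-> s with s (x + y) = s x + s y + beta (x A) (y A);
   it exists since [beta] is symmetric modulo [Lam] on the free module [P], and
   the binomial coefficients replace the division by 2. *)
Definition quad (x : 'rV[int]_m) : 'rV[int]_n :=
  \sum_i binz (x 0 i) *: b i i
  + \sum_(i < m) \sum_(j < m | (i < j)%N) (x 0 i * x 0 j) *: b i j.

Let err (x y : 'rV[int]_m) :=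
  \sum_(i < m) \sum_(j < m | (i < j)%N) (x 0 j * y 0 i) *: (b i j - b j i).

(** For [i < j] the product [x 0 j * y 0 i] comes with [b i j] on the left and with [b j i] in
    [beta]; [err] is exactly this discrepancy, and it lies in [Lam]. *)
Lemma quadD x y : quad (x + y) = quad x + quad y + beta (x *m A) (y *m A) + err x y.
Proof.
have -> : beta (x *m A) (y *m A) = \sum_i (x 0 i * y 0 i) *: b i i
    + \sum_(i < m) \sum_(j < m | (i < j)%N) ((x 0 i * y 0 j) *: b i j + (x 0 j * y 0 i) *: b j i).
  rewrite (mulmx_sum_row x A).
  rewrite (additive_linear _ _ _ _ (fun u v => betaDl u v (y *m A))).
  have -> : \sum_i x 0 i *: beta (row i A) (y *m A) = \sum_i \sum_j (x 0 i * y 0 j) *: b i j.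
    apply: eq_bigr => i _; rewrite (mulmx_sum_row y A).
    rewrite (additive_linear _ _ _ _ (betaDr (row i A))) scaler_sumr.
    by apply: eq_bigr => j _; rewrite scalerA.
  have -> : \sum_(i < m) \sum_(j < m | (i < j)%N) ((x 0 i * y 0 j) *: b i j + (x 0 j * y 0 i) *: b j i)
     = \sum_(i < m) (\sum_(j < m | (i < j)%N) (x 0 i * y 0 j) *: b i j)
     + \sum_(i < m) (\sum_(j < m | (j < i)%N) (x 0 i * y 0 j) *: b i j).
    rewrite [X in _ = _ + X](exchange_big_dep predT) //= -big_split /=.
    by apply: eq_bigr => i _; rewrite big_split.
  rewrite -!big_split /=; apply: eq_bigr => i _.
  rewrite (bigD1 i) //=; congr (_ + _).
  rewrite (bigID (fun j : 'I_m => (i < j)%N)) /=; congr (_ + _); apply: eq_bigl => j.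
    by rewrite -val_eqE /=; lia.
  by rewrite -val_eqE /=; lia.
rewrite /quad /err.
have -> : \sum_i binz ((x + y) 0 i) *: b i i = \sum_i binz (x 0 i) *: b i i +
     \sum_i binz (y 0 i) *: b i i + \sum_i (x 0 i * y 0 i) *: b i i.
  rewrite -!big_split /=; apply: eq_bigr => i _.
  by rewrite mxE binzD !scalerDl.
have -> : \sum_(i < m) \sum_(j < m | (i < j)%N) ((x + y) 0 i * (x + y) 0 j) *: b i j =
   \sum_(i < m) \sum_(j < m | (i < j)%N) (x 0 i * x 0 j) *: b i j +
   \sum_(i < m) \sum_(j < m | (i < j)%N) (y 0 i * y 0 j) *: b i j +
   (\sum_(i < m) \sum_(j < m | (i < j)%N) ((x 0 i * y 0 j) *: b i j + (x 0 j * y 0 i) *: b j i)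
    + \sum_(i < m) \sum_(j < m | (i < j)%N) (x 0 j * y 0 i) *: (b i j - b j i)).
  rewrite -!big_split /=; apply: eq_bigr => i _; rewrite -!big_split /=; apply: eq_bigr => j _.
  rewrite !mxE scalerBr; apply/rowP => k; rewrite !mxE; ring.
by apply/rowP => k; rewrite !mxD_entry; ring.
Qed.

Lemma errP x y : Lam (err x y).
Proof.
apply: subgroup_of_sum => // i _; apply: subgroup_of_sum => // j _.
apply: subgroup_ofZ => //; apply: beta_sym; apply/PA.
  by exists (delta_mx 0 i); rewrite -rowE.
by exists (delta_mx 0 j); rewrite -rowE.
Qed.

(** The section whose value at the i-th basis row of [P] is the representative of the class [z i].
    These [m] free choices modulo [Lam] are what counts the subgroups above (Lam, P). *)
Definition sect (z : {ffun 'I_m -> 'I_N}) (x : 'rV[int]_m) : 'rV[int]_n :=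
  \sum_i x 0 i *: r (z i) + quad x.

Lemma sectD z x y : sect z (x + y) = sect z x + sect z y + beta (x *m A) (y *m A) + err x y.
Proof.
rewrite /sect quadD.
have -> : \sum_i (x + y) 0 i *: r (z i) = \sum_i x 0 i *: r (z i) + \sum_i y 0 i *: r (z i).
  by rewrite -big_split /=; apply: eq_bigr => i _; rewrite mxE scalerDl.
by apply/rowP => k; rewrite !mxD_entry; ring.
Qed.

Lemma sect_delta z i : sect z (delta_mx 0 i) = r (z i).
Proof.
have d j : (delta_mx 0 i : 'rV[int]_m) 0 j = (j == i)%:R by rewrite mxE.
rewrite /sect /quad (bigD1 i) //= d eqxx scale1r big1 ?addr0; last first.
  by move=> j /negbTE ji; rewrite d ji scale0r.
rewrite big1 ?add0r; last first.
  by move=> j _; rewrite d; case: eqP => _; rewrite ?binz1 ?binz0 scale0r.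
rewrite big1 ?addr0 // => j _; rewrite big1 // => k jk.
rewrite !d; case: eqP => [e|_]; last by rewrite mul0r scale0r.
case: eqP => [e'|_]; last by rewrite mulr0 scale0r.
by rewrite e e' ltnn in jk.
Qed.

Definition fiber_set z : set V :=
  [set g | exists2 x, g.1 = x *m A & Lam (g.2 - sect z x)].

Lemma sect0 z : sect z 0 = 0.
Proof.
rewrite /sect /quad big1 ?add0r; last by move=> i _; rewrite mxE scale0r.
rewrite big1 ?add0r; last by move=> i _; rewrite mxE binz0 scale0r.
by rewrite big1 // => i _; rewrite big1 // => j _; rewrite mxE mul0r scale0r.
Qed.

Lemma fiber_set_bsubgroup z : bsubgroup (fiber_set z).
Proof.
split; first by exists 0; rewrite ?mul0mx //= sect0 subr0; apply: LamS.1.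
move=> [u a] [v d] [x /= -> Hx] [y /= -> Hy]; exists (x - y); rewrite /= ?mulmxBl //.
(* The value of the section at a difference is read off from the sum (x - y) + y. *)
have := sectD z (x - y) y; rewrite subrK mulmxBl betaDl betaNl => e.
have -> : a + (- d + beta (y *m A) (y *m A)) + beta (x *m A) (- (y *m A))
    - sect z (x - y) = (a - sect z x) - (d - sect z y) + err (x - y) y.
  rewrite e betaNr; apply/rowP => k; rewrite !(mxD_entry, mxN_entry); ring.
by apply: subgroup_ofD => //; [apply: LamS.2 | apply: errP].
Qed.

Lemma fiber_set_kerpart z : kerpart (fiber_set z) = Lam.
Proof.
apply/seteqP; split=> a; first by move=> [x /= /esym /A_inj ->]; rewrite sect0 subr0.
by move=> La; exists 0; rewrite ?mul0mx //= sect0 subr0.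
Qed.

Lemma fiber_set_impart z : impart (fiber_set z) = P.
Proof.
apply/seteqP; split=> u; first by move=> [a [x /= ? _]]; apply/PA; exists x.
by move=> /PA[x ->]; exists (sect z x), x => //=; rewrite subrr; apply: LamS.1.
Qed.

Lemma fiber_set_row z i a : fiber_set z (row i A, a) <-> c a = z i.
Proof.
split=> [[x /= e La]|ca].
  have xe : x = delta_mx 0 i.
    by apply/subr0_eq/A_inj; rewrite mulmxBl -e -rowE subrr.
  by move: La; rewrite xe sect_delta => /cR <-; rewrite rK.
exists (delta_mx 0 i); first by rewrite /= -rowE.
by rewrite sect_delta /=; apply/cR; rewrite rK.
Qed.

Lemma fiber_set_inj : injective fiber_set.
Proof.
move=> z z' e; apply/ffunP => i.
have : fiber_set z (row i A, r (z i)) by apply/fiber_set_row; rewrite rK.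
by rewrite e => /fiber_set_row; rewrite rK.
Qed.

(** The vectors of Z^m over which the two subgroups share an element form a subgroup; containing the
    basis rows, it contains [P]. Equal kernels then propagate one shared element to the whole
    coset. *)
Lemma fiber_unique H H' : bsubgroup H -> bsubgroup H' ->
  kerpart H = Lam -> kerpart H' = Lam -> impart H = P ->
  (forall i, exists a, H (row i A, a) /\ H' (row i A, a)) -> H `<=` H'.
Proof.
move=> HH HH' K K' Im Hrow [u a] Hua.
pose W := [set u | exists a, H (u, a) /\ H' (u, a)].
have WS : subgroup_of W.
  split; first by exists 0; split; [apply: HH.1 | apply: HH'.1].
  move=> x y [d [Hd Hd']] [e [He He']]; eexists; split.
    exact: (HH.2 _ _ Hd He).
  exact: (HH'.2 _ _ Hd' He').
have : P u by rewrite -Im; exists a.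
move=> /PA[x ux]; have : W u.
  rewrite ux mulmx_sum_row; apply: subgroup_of_sum => // i _.
  by apply: subgroup_ofZ => //; apply: Hrow.
move=> [d [Hd Hd']]; apply/(kerpartP a HH' Hd').
by rewrite K' -K; apply/(kerpartP a HH Hd).
Qed.

Lemma fiber_setP H : [/\ bsubgroup H, kerpart H = Lam & impart H = P] <->
  exists z, H = fiber_set z.
Proof.
split=> [[HH K Im]|[z ->]]; last first.
  split; [exact: fiber_set_bsubgroup | exact: fiber_set_kerpart | exact: fiber_set_impart].
have /choice [d Hd] : forall i, exists a, H (row i A, a).
  move=> i; suff : impart H (row i A) by [].
  by rewrite Im; apply/PA; exists (delta_mx 0 i); rewrite -rowE.
pose z := [ffun i => c (d i)].
have Hz i : fiber_set z (row i A, d i) by apply/fiber_set_row; rewrite ffunE.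
have FS := fiber_set_bsubgroup z.
exists z; apply/seteqP; split; apply: fiber_unique => //;
  rewrite ?fiber_set_kerpart ?fiber_set_impart // => i; by exists (d i).
Qed.

End Fiber.

End Extension.

Section LatticeBasis.

Lemma lattice_basis n (H : set 'rV[int]_n) N : subgroup_of H -> latidx H N ->
  exists A : 'M[int]_n, (forall u, H u <-> exists x, u = x *m A) /\
    (forall x : 'rV_n, x *m A = 0 -> x = 0).
Proof.
move=> HH HN; have [U [d Uu [d0 _ Hd _]]] := lattice_smith HH HN.
have dn0 (i : 'I_n) : (d i)%:Z != 0 by rewrite -lt0n; apply: d0.
pose D : 'M[int]_n := diag_mx (\row_i (d i)%:Z).
have xD (x : 'rV[int]_n) i : (x *m D) 0 i = x 0 i * (d i)%:Z.
  by rewrite mul_mx_diag !mxE.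
exists (D *m invmx U); split=> [u|x].
  rewrite Hd; split=> [Hu|[x ->] i]; last first.
    by rewrite mulmxA mulmxKV // xD dvdz_mull.
  exists (\row_i (((u *m U) 0%R i) %/ (d i))%Z); rewrite mulmxA.
  apply: (canRL (mulmxK Uu)); apply/rowP => i.
  by rewrite xD mxE divzK.
rewrite mulmxA => /(canRL (mulmxKV Uu)); rewrite mul0mx => x0.
apply/rowP => i; have := congr1 (fun y : 'rV[int]_n => y 0 i) x0.
by rewrite xD !mxE => /eqP; rewrite mulf_eq0 (negbTE (dn0 i)) orbF => /eqP.
Qed.

End LatticeBasis.

(** * Sums over lattices of p-power index *)

Section PrimePower.
Variable p : nat.
Hypothesis p_pr : prime p.

(* 0 when the index is not a power of [p]. *)
Definition plog T (Rel : T -> T -> Prop) : nat :=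
  xget 0%N [set k | has_index Rel (p ^ k)].

Lemma plogE T (Rel : T -> T -> Prop) k : has_index Rel (p ^ k) -> plog Rel = k.
Proof.
move=> hk; rewrite /plog; case: xgetP => [l _ hl|/(_ k) //].
by apply/eqP; rewrite -(eqn_exp2l _ _ (prime_gt1 p_pr)); apply/eqP/(has_index_uniq hl hk).
Qed.

Definition latlog (V : zmodType) (H : set V) : nat := plog (fun x y => H (y - x)).

Definition plattices n : set (set 'rV[int]_n) :=
  [set H | subgroup_of H /\ exists k, latidx H (p ^ k)].

Arguments plattices : clear implicits.

Lemma plattices_latidx n (H : set 'rV[int]_n) : plattices n H -> latidx H (p ^ latlog H).
Proof. by move=> [_ [k hk]]; rewrite /latlog (plogE hk). Qed.

(** x -> x A identifies Z^n with [X] and [Q] with a sublattice of [X], and the index is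
    multiplicative through [X]. *)
Lemma latidx_image n (X Q : set 'rV[int]_n) (A : 'M[int]_n) N1 N2 :
  subgroup_of X -> subgroup_of Q ->
  (forall u, X u <-> exists x, u = x *m A) -> (forall x : 'rV_n, x *m A = 0 -> x = 0) ->
  latidx X N2 -> latidx Q N1 ->
  latidx [set u | exists2 x, Q x & u = x *m A] (N1 * N2).
Proof.
move=> XX QQ XA A_inj [c2 c2s c2R] [c1 c1s c1R].
have [s sK] := choice c2s; have [r rK] := choice c1s.
have /choice [t Ht] : forall u, exists x, u - s (c2 u) = x *m A.
  by move=> u; apply/XA/c2R; rewrite sK.
have -> : (N1 * N2)%N = #|{: 'I_N1 * 'I_N2}| by rewrite card_prod !card_ord.
apply: (has_index_fin (c := fun g => (c1 (t g), c2 g))).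
  move=> [j i]; exists (s i + r j *m A).
  have e : c2 (s i + r j *m A) = i.
    rewrite -[RHS]sK; apply/esym/c2R; rewrite addrAC subrr add0r; apply/XA.
    by exists (r j).
  congr pair => //; rewrite -[RHS]rK; congr c1.
  apply/subr0_eq/A_inj; rewrite mulmxBl -Ht e (addrAC (s i)) subrr add0r subrr //.
move=> x y.
have key : c2 x = c2 y -> y - x = (t y - t x) *m A.
  by move=> e; rewrite mulmxBl -!Ht e opprB addrA subrK.
split=> [[z Qz e]|[e1 e2]].
  have e2 : c2 x = c2 y by apply/c2R/XA; exists z.
  congr pair => //; apply/c1R; suff -> : t y - t x = z by [].
  by apply/subr0_eq/A_inj; rewrite mulmxBl -e -key // subrr.
by exists (t y - t x); [apply/c1R | apply: key].
Qed.

Lemma pfactor_mul a b k : (a * b = p ^ k)%N -> exists i j, a = (p ^ i)%N /\ b = (p ^ j)%N.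
Proof.
move=> e.
have /(dvdn_pfactor _ _ p_pr)[i _ ai] : (a %| p ^ k)%N by rewrite -e dvdn_mulr.
have /(dvdn_pfactor _ _ p_pr)[j _ bj] : (b %| p ^ k)%N by rewrite -e dvdn_mull.
by exists i, j.
Qed.

Variable C : numClosedFieldType.
Implicit Types Y : C.

Lemma has_sum_set1 (I : choiceType) (D : set I) (i0 : I) (f : I -> C) :
  (forall i, D i <-> i = i0) -> has_sum D f (f i0).
Proof.
move=> Di; rewrite -(big_seq_fset1 +%R i0 f); apply: has_sum_fin => i.
by rewrite Di inE; split=> [->|/eqP].
Qed.

(** A basis [A] of [X] puts the sublattices of [X] in bijection with those of Z^n, shifting the
    logarithmic index by that of [X]. [Q] restricts the norm of [Y], so that the hypothesis is
    available at [|Y|] too. *)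
Lemma has_sum_sublattices n (X : set 'rV[int]_n) (Q : C -> Prop) (z : C -> C) :
  (forall Y, Q `|Y| -> has_sum (plattices n) (fun H => Y ^+ latlog H) (z Y)) ->
  plattices n X -> forall Y, Q `|Y| ->
  has_sum [set P | plattices n P /\ P `<=` X] (fun H => Y ^+ latlog H) (Y ^+ latlog X * z Y).
Proof.
move=> hz XL; have [XX [l hX]] := XL.
have [A [XA A_inj]] := lattice_basis XX hX.
pose pi P : set 'rV[int]_n := [set x | P (x *m A)].
pose th K : set 'rV[int]_n := [set u | exists2 x, K x & u = x *m A].
have thpi P : P `<=` X -> th (pi P) = P.
  move=> PX; apply/seteqP; split=> [u [x Px ->] //|u Pu].
  by have /XA[x ux] := PX _ Pu; exists x => //; rewrite /pi /= -ux.
have pith K : pi (th K) = K.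
  apply/seteqP; split=> [x [y Ky e]|x Kx]; last by exists x.
  suff -> : x = y by [].
  by apply/subr0_eq/A_inj; rewrite mulmxBl e subrr.
have thL K : plattices n K -> plattices n (th K) /\ latlog (th K) = (latlog X + latlog K)%N.
  move=> [KK [k hK]].
  have hth := latidx_image XX KK XA A_inj hX hK; rewrite -expnD in hth.
  rewrite /latlog (plogE hX) (plogE hK) addnC (plogE hth); split=> //; split; last first.
    by exists (k + l)%N.
  split; first by exists 0; [exact: KK.1 | rewrite mul0mx].
  move=> _ _ [x Kx ->] [y Ky ->]; exists (x - y); rewrite ?mulmxBl //.
  exact: KK.2.
have piL P : plattices n P -> P `<=` X -> plattices n (pi P).
  move=> [PP [k hP]] PX.
  have piP : subgroup_of (pi P).
    split=> [|x y Px Py]; first by rewrite /pi /= mul0mx; apply: PP.1.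
    by rewrite /pi /= mulmxBl; apply: PP.2.
  have [c cs cR] := hP.
  have [N hN] : exists N, latidx (pi P) N.
    apply: (has_index_exists (c := fun x : 'rV[int]_n => c (x *m A))).
    - by move=> x; rewrite subrr; apply: piP.1.
    - by move=> x y /(subgroup_ofN piP); rewrite opprB.
    - by move=> x y w L1 L2; have := subgroup_ofD piP L2 L1; rewrite addrA subrK.
    - by move=> x y /cR; rewrite /pi /= mulmxBl.
  split=> //; have hP' : latidx (th (pi P)) (N * p ^ l) := latidx_image XX piP XA A_inj hX hN.
  rewrite thpi // in hP'.
  (* The index of [pi P] divides that of [P], hence is itself a power of [p]. *)
  have [i [j [Ni _]]] := pfactor_mul (has_index_uniq hP' hP).
  by exists i; rewrite -Ni.
move=> Y Yrho.
have fibs (y : C) : (forall K, plattices n K -> has_sum [set P | [set P | plattices n P /\ P `<=` X] P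
    /\ pi P = K] (fun H => y ^+ latlog H) (y ^+ latlog X * y ^+ latlog K)).
  move=> K KL; rewrite -exprD; have [thKL <-] := thL _ KL.
  apply: (has_sum_set1 (i0 := th K) (fun H : set 'rV[int]_n => y ^+ latlog H)) => P.
  split=> [[[PL PX] <-]|->]; first by rewrite thpi.
  split=> //; split=> // u [x _ ->]; apply/XA; by exists x.
apply: (has_sum_fib (p := pi) (E := plattices n)).
- by move=> P [PL PX]; apply: piL.
- exact: fibs.
- move=> K KL; apply: eq_has_sum (fibs `|Y| K KL) => // P _.
  by rewrite normrX.
- by apply: has_sumZ; apply: hz.
- by apply: has_sumZ; apply: hz; rewrite normr_id.
Qed.

Section ExtensionSum.
Variables (m n : nat) (beta : 'rV[int]_m -> 'rV[int]_m -> 'rV[int]_n).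
Hypothesis betaDl : forall u v w, beta (u + v) w = beta u w + beta v w.
Hypothesis betaDr : forall u v w, beta u (v + w) = beta u v + beta u w.
Variable X : set 'rV[int]_n -> set 'rV[int]_m.
Hypothesis X_lattice : forall Lam, plattices n Lam -> plattices m (X Lam).
Hypothesis X_sym : forall Lam, plattices n Lam -> forall u v, X Lam u -> X Lam v ->
  Lam (beta u v - beta v u).

Definition blog (H : set ('rV[int]_m * 'rV[int]_n)) : nat :=
  plog (fun g h => H (bmul beta (binv beta g) h)).

(** [X] is kept abstract: the annihilator of Lam gives normal subgroups and ideals, and the constant
    full set, with zero cocycle, gives all subgroups of Z^(m + n). *)
Definition bideals : set (set ('rV[int]_m * 'rV[int]_n)) :=
  [set H | [/\ bsubgroup beta H, exists k, bindex beta H (p ^ k) &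
     impart H `<=` X (kerpart H)]].

Lemma bideals_parts H : bideals H ->
  [/\ plattices n (kerpart H), plattices m (impart H) &
      blog H = (latlog (kerpart H) + latlog (impart H))%N].
Proof.
move=> [HH [k hk] _].
have [N1 [N2 [h1 h2 e]]] := bindex_factor betaDl betaDr HH hk.
have [i [j [Ni Nj]]] := pfactor_mul (esym e).
rewrite Ni in h1; rewrite Nj in h2.
split.
- by split; [exact: kerpart_subgroup HH | exists i].
- by split; [exact: impart_subgroup HH | exists j].
rewrite /latlog (plogE h1) (plogE h2) /blog (plogE hk).
by move: e; rewrite Ni Nj -expnD => /eqP; rewrite eqn_exp2l ?prime_gt1 // => /eqP.
Qed.

(** The fibre is finite with equal terms: its members are the [fiber_set], one for each choice of
    [m] classes modulo [Lam]. *)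
Lemma has_sum_bideals_fiber Lam P Y : plattices n Lam -> plattices m P -> P `<=` X Lam ->
  has_sum [set H | ([set H | bideals H /\ kerpart H = Lam] H) /\ impart H = P]
    (fun H => Y ^+ blog H) ((p ^ m)%:R ^+ latlog Lam * Y ^+ (latlog Lam + latlog P)).
Proof.
move=> LL PL PX; have [LamS _] := LL; have [PS [l hP]] := PL.
have hLam := plattices_latidx LL; set N := (p ^ _)%N in hLam.
have [c cs cR] := hLam; have [r rK] := choice cs.
have [A [PA A_inj]] := lattice_basis PS hP.
have bsym u v : P u -> P v -> Lam (beta u v - beta v u).
  by move=> /PX Xu /PX Xv; apply: X_sym.
pose F := fiber_set beta Lam A r.
have FP H : [/\ bsubgroup beta H, kerpart H = Lam & impart H = P] <-> exists z, H = F z.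
  exact: fiber_setP.
have F_inj : injective F by apply: fiber_set_inj.
have DF H : ([set H | bideals H /\ kerpart H = Lam] H) /\ impart H = P <->
    H \in [fset F z | z in {ffun 'I_m -> 'I_N}]%fset.
  split=> [[[[HH _ _] K] Im]|/imfsetP[z _ Hz]].
    have /FP[z ->] : [/\ bsubgroup beta H, kerpart H = Lam & impart H = P] by [].
    by apply/imfsetP; exists z.
  have [HH K Im] : [/\ bsubgroup beta H, kerpart H = Lam & impart H = P].
    by apply/FP; exists z.
  split=> //; split=> //; split=> //; last by rewrite K Im.
  have h1 : latidx (kerpart H) (p ^ latlog Lam) by rewrite K.
  have h2 : latidx (impart H) (p ^ latlog P) by rewrite Im; apply: plattices_latidx.
  exists (latlog Lam + latlog P)%N; rewrite expnD; exact: bindexM.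
have -> : (p ^ m)%:R ^+ latlog Lam * Y ^+ (latlog Lam + latlog P)
    = \sum_(H <- [fset F z | z in {ffun 'I_m -> 'I_N}]%fset) Y ^+ blog H.
  rewrite (eq_big_seq (fun=> Y ^+ (latlog Lam + latlog P))); last first.
    move=> H /DF[[HD K] Im]; have [_ _ ->] := bideals_parts HD.
    by rewrite K Im.
  rewrite big_const_seq count_predT iter_addr_0 -[RHS]mulr_natl; congr (_ * _).
  rewrite card_imfset //= -natrX; congr _%:R.
  by rewrite -cardE card_ffun !card_ord /N -!expnM mulnC.
exact: has_sum_fin.
Qed.

(** Two successive fibrations, over the kernel part and then over the image part. The image part
    ranges over all sublattices of [X Lam], which contributes the zeta function of Z^m as a common
    factor. *)
Lemma has_sum_bideals (Q : C -> Prop) (zm S : C -> C) :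
  (forall Y, Q `|Y| -> has_sum (plattices m) (fun H => Y ^+ latlog H) (zm Y)) ->
  (forall Y, Q `|Y| -> has_sum (plattices n)
     (fun Lam => ((p ^ m)%:R * Y) ^+ latlog Lam * Y ^+ latlog (X Lam)) (S Y)) ->
  forall Y, Q `|Y| -> has_sum bideals (fun H => Y ^+ blog H) (zm Y * S Y).
Proof.
move=> hz hS Y Yrho.
have fib1 (y : C) Lam : Q `|y| -> plattices n Lam ->
  has_sum [set H | bideals H /\ kerpart H = Lam] (fun H => y ^+ blog H)
    (zm y * (((p ^ m)%:R * y) ^+ latlog Lam * y ^+ latlog (X Lam))).
  move=> yrho LL.
  have fib2 (w : C) P : plattices m P /\ P `<=` X Lam ->
    has_sum [set H | ([set H | bideals H /\ kerpart H = Lam] H) /\ impart H = P]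
    (fun H => w ^+ blog H) (((p ^ m)%:R * w) ^+ latlog Lam * w ^+ latlog P).
    move=> [PL PX]; rewrite exprMn -mulrA -exprD; exact: has_sum_bideals_fiber.
  have base (w : C) : Q `|w| -> has_sum [set P | plattices m P /\ P `<=` X Lam]
     (fun P => ((p ^ m)%:R * w) ^+ latlog Lam * w ^+ latlog P)
     (zm w * (((p ^ m)%:R * w) ^+ latlog Lam * w ^+ latlog (X Lam))).
    move=> wrho; rewrite [zm w * _]mulrC -mulrA; apply: has_sumZ.
    by apply: has_sum_sublattices wrho => //; apply: X_lattice.
  apply: (has_sum_fib (p := @impart m n) (E := [set P | plattices m P /\ P `<=` X Lam])).
  - move=> H [HD HL]; have [_ PL _] := bideals_parts HD; split=> //.
    by rewrite -HL; have [_ _] := HD.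
  - exact: fib2.
  - by move=> P PL; apply: eq_has_sum (fib2 `|y| P PL) => // H _; rewrite normrX.
  - exact: base.
  - by apply: base; rewrite normr_id.
apply: (has_sum_fib (p := @kerpart m n) (E := plattices n)).
- by move=> H /bideals_parts[].
- by move=> Lam; apply: fib1.
- move=> Lam LL; have := fib1 `|Y| Lam; rewrite normr_id => /(_ Yrho LL).
  by apply: eq_has_sum => // H _; rewrite normrX.
- by apply: has_sumZ; apply: hS.
- by apply: has_sumZ; apply: hS; rewrite normr_id.
Qed.

End ExtensionSum.

End PrimePower.

Arguments plattices : clear implicits.

(** * The zeta function of Z^n *)

Section ZetaFree.
Variable R : realType.
Local Notation C := (R[i]).
Variable p : nat.
Hypothesis p_pr : prime p.

Definition zetaZ n (Y : C) : C := \prod_(i < n) (1 - (p ^ i)%:R * Y)^-1.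

Lemma zetaZS n Y : zetaZ n.+1 Y = (1 - Y)^-1 * zetaZ n (p%:R * Y).
Proof.
rewrite /zetaZ big_ord_recl expn0 mul1r; congr (_ * _); apply: eq_bigr => i _.
by rewrite lift0 expnSr natrM mulrA.
Qed.

Lemma plattices_setT n : plattices p n setT /\ latlog p [set: 'rV[int]_n] = 0%N.
Proof.
have h : latidx [set: 'rV[int]_n] (p ^ 0).
  rewrite expn0; exists (fun=> ord0) => // i; exists 0.
  by rewrite (ord1 i).
by rewrite /latlog (plogE p_pr h); split=> //; split=> //; exists 0%N.
Qed.

Lemma zeta_Z1 (Y : C) : `|Y| < 1 ->
  has_sum (plattices p 1) (fun H => Y ^+ latlog p H) (1 - Y)^-1.
Proof.
move=> Y1.
pose L k : set 'rV[int]_1 := dlat 1%:M (fun=> (p ^ k)%N).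
have hL k : plattices p 1 (L k) /\ latlog p (L k) = k.
  have h : latidx (L k) (p ^ k).
    have := dlat_idx (d := fun=> (p ^ k)%N) (unitmx1 _ 1).
    by rewrite big_ord1; apply => i; rewrite expn_gt0 prime_gt0.
  by rewrite /latlog (plogE p_pr h); split=> //; split; [exact: dlat_subgroup | exists k].
have fib (y : C) k : has_sum [set H | plattices p 1 H /\ latlog p H = k]
    (fun H => y ^+ latlog p H) (y ^+ k).
  rewrite -{2}(hL k).2.
  apply: (has_sum_set1 (i0 := L k) (fun H : set 'rV[int]_1 => y ^+ latlog p H)) => H.
  split=> [[HL e]|->]; last exact: hL.
  have := plattices_latidx p_pr HL; rewrite e => hH.
  have [U [d Uu [_ _ Hd]]] := lattice_smith HL.1 hH.
  rewrite big_ord1 => dk; apply/seteqP; split=> v.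
    move=> /Hd Hv i; rewrite (ord1 i) mulmx1 dk.
    have -> : v 0 0 = (v *m U) 0 0 * (invmx U) 0 0.
      by rewrite -{1}(mulmxK Uu v) mxE big_ord1.
    by rewrite dvdz_mulr //; apply: Hv.
  move=> /(_ 0); rewrite mulmx1 dk => Hv; apply/Hd => i; rewrite (ord1 i).
  by rewrite mxE big_ord1 dvdz_mulr.
apply: (has_sum_fib (p := fun H : set 'rV[int]_1 => latlog p H) (E := [set: nat])
  (g := fun k => Y ^+ k) (g' := fun k => `|Y| ^+ k)) => //.
- by move=> k _; apply: eq_has_sum (fib `|Y| k) => // H _; rewrite normrX.
- exact: has_sum_geom.
- by apply: has_sum_geom; rewrite normr_id.
Qed.

(** Z^(1 + n) is the extension of Z by Z^n with zero cocycle and no normality condition, so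
    [has_sum_bideals] with [m = 1] yields the recursion [zetaZS]. *)
Lemma zeta_Zn n (Y : C) : `|Y| < (p ^ n)%:R^-1 ->
  has_sum (plattices p n) (fun H => Y ^+ latlog p H) (zetaZ n Y).
Proof.
elim: n Y => [|n IH] Y Yn.
  rewrite /zetaZ big_ord0; have [TL T0] := plattices_setT 0.
  have -> : (1 : C) = Y ^+ latlog p [set: 'rV[int]_0] by rewrite T0.
  apply: (has_sum_set1 (i0 := setT) (fun H : set 'rV[int]_0 => Y ^+ latlog p H)) => H.
  split=> [[[H0 _] _]|-> //]; apply/seteqP; split=> // v _.
  by rewrite (_ : v = 0) //; apply/rowP; case.
pose b (u v : 'rV[int]_1) : 'rV[int]_n := 0.
have pp : (0 < p)%N := prime_gt0 p_pr.
have sum1 (y : C) : `|y| < (p ^ n.+1)%:R^-1 -> has_sum (plattices p 1) (fun H => y ^+ latlog p H) (1 - y)^-1.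
  move=> /lt_le_trans yp; apply: zeta_Z1; apply: yp.
  by rewrite invf_le1 ?ltr0n ?ler1n expn_gt0 pp.
have sum2 (y : C) : `|y| < (p ^ n.+1)%:R^-1 -> has_sum (plattices p n)
    (fun Lam => ((p ^ 1)%:R * y) ^+ latlog p Lam * y ^+ latlog p [set: 'rV[int]_1])
    (zetaZ n (p%:R * y)).
  move=> yp; rewrite expn1; apply: eq_has_sum (IH (p%:R * y) _) => //.
    by move=> H _; rewrite (plattices_setT 1).2 expr0 mulr1.
  rewrite normrM normr_nat mulrC -ltr_pdivlMr ?ltr0n //.
  by rewrite -invfM -natrM -expnSr.
have bDl u v w : b (u + v) w = b u w + b v w by rewrite /b addr0.
have bDr u v w : b u (v + w) = b u v + b u w by rewrite /b addr0.
have bsym (Lam : set 'rV[int]_n) : plattices p n Lam -> forall u v : 'rV[int]_1,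
    setT u -> setT v -> Lam (b u v - b v u).
  by move=> [[L0 _] _] u v _ _; rewrite /b subr0.
have hs := has_sum_bideals p_pr bDl bDr (fun _ _ => (plattices_setT 1).1) bsym
  (Q := fun r => r < (p ^ n.+1)%:R^-1) sum1 sum2.
have {}hs (y : C) : `|y| < (p ^ n.+1)%:R^-1 ->
  has_sum (bideals p b (fun=> setT)) (fun H => y ^+ blog p b H) (zetaZ n.+1 y).
  by move=> yp; rewrite zetaZS; apply: hs.
pose J (H : set 'rV[int]_(1 + n)) : set ('rV[int]_1 * 'rV[int]_n) :=
  [set g | H (row_mx g.1 g.2)].
pose K (G : set ('rV[int]_1 * 'rV[int]_n)) : set 'rV[int]_(1 + n) :=
  [set v | G (lsubmx v, rsubmx v)].
have JK G : J (K G) = G.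
  by apply/seteqP; split=> -[u a]; rewrite /J /K /= row_mxKl row_mxKr.
have KJ H : K (J H) = H.
  by apply/seteqP; split=> v; rewrite /J /K /= hsubmxK.
have rowB (u v : 'rV[int]_1) (x y : 'rV[int]_n) : row_mx (u - v) (x - y) = row_mx u x - row_mx v y.
  by rewrite opp_row_mx add_row_mx.
have bE g h : bmul b (binv b g) h = (h.1 - g.1, h.2 - g.2).
  by rewrite (bmulVgE bDl) /b addr0 subr0.
have bE' g h : bmul b g (binv b h) = (g.1 - h.1, g.2 - h.2).
  by rewrite /bmul /binv /b /= !addr0.
have idxJ H k : latidx H k -> bindex b (J H) k.
  move=> [c cs cR]; exists (fun g => c (row_mx g.1 g.2)).
    by move=> i; have [v cv] := cs i; exists (lsubmx v, rsubmx v); rewrite /= hsubmxK.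
  by move=> g h; rewrite bE /J /= rowB cR.
have idxK G k : bindex b G k -> latidx (K G) k.
  move=> [c cs cR]; exists (fun v => c (lsubmx v, rsubmx v)).
    move=> i; have [[u a] cv] := cs i; exists (row_mx u a).
    by rewrite row_mxKl row_mxKr.
  by move=> v w; rewrite -cR bE /K /= !linearB.
have hJ H : plattices p (1 + n) H -> bideals p b (fun=> setT) (J H).
  move=> [[H0 HB] [k hk]]; split=> //; last by exists k; apply: idxJ.
  split; first by rewrite /J /= row_mx0.
  by move=> g h Hg Hh; rewrite bE' /J /= rowB; apply: HB.
have hK G : bideals p b (fun=> setT) G ->
    plattices p (1 + n) (K G) /\ latlog p (K G) = blog p b G.
  move=> [[G0 GB] [k hk] _]; have hk' := idxK _ _ hk.
  rewrite /latlog /blog (plogE p_pr hk) (plogE p_pr hk'); split=> //; split; last by exists k.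
  split; first by rewrite /K /= !linear0.
  by move=> x y Hx Hy; have := GB _ _ Hx Hy; rewrite bE' /K /= !linearB.
have fib (y : C) G : bideals p b (fun=> setT) G ->
    has_sum [set H | plattices p (1 + n) H /\ J H = G]
      (fun H => y ^+ latlog p H) (y ^+ blog p b G).
  move=> GI; have [KL <-] := hK G GI.
  apply: (has_sum_set1 (i0 := K G) (fun H : set 'rV[int]_(1 + n) => y ^+ latlog p H)) => H.
  by split=> [[_ <-]|->].
apply: (has_sum_fib (p := J) (E := bideals p b (fun=> setT))) => //.
- by move=> G; apply: fib.
- by move=> G GI; apply: eq_has_sum (fib `|Y| G GI) => // H _; rewrite normrX.
- exact: hs.
- by apply: hs; rewrite normr_id.
Qed.

End ZetaFree.

(** * The alternating matrix and its Pfaffian *)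

Section Radical.
Variable F : comNzRingType.
Variables A1 A2 A3 A4 A6 : F.

(* The entries of u B, where B is the alternating matrix of linear forms in
   (x, y, z) whose Pfaffian is [cubic]. *)
Definition rad (x y z u0 u1 u2 u3 u4 u5 : F) : seq F :=
  let w := A1 * y - A2 * x - A4 * z in
  [:: - x * u1 - z * u4 + (y + A3 * z) * u5;
      x * u0 - y * u4 + A6 * z * u5;
      z * u3 + x * u5;
      - z * u2 - x * u4;
      z * u0 + y * u1 + x * u3 + w * u5;
      - (y + A3 * z) * u0 - A6 * z * u1 - x * u2 - w * u4].

Definition cubic (x y z : F) : F :=
  y ^+ 2 * z + A1 * x * y * z + A3 * y * z ^+ 2
  - (x ^+ 3 + A2 * x ^+ 2 * z + A4 * x * z ^+ 2 + A6 * z ^+ 3).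

End Radical.

Section RadicalField.
Variable F : fieldType.
Variables A1 A2 A3 A4 A6 : F.
Local Notation radF := (rad A1 A2 A3 A4 A6).

Lemma all6P (a b c d e f : F) : all (pred1 0) [:: a; b; c; d; e; f] ->
  [/\ a = 0, b = 0, c = 0 & [/\ d = 0, e = 0 & f = 0]].
Proof. by move=> /= /and5P[/eqP-> /eqP-> /eqP-> /eqP-> /and3P[/eqP-> /eqP-> _]]. Qed.

(** On z = 0 the Pfaffian is - x^3, so the form is nondegenerate there; its equations are
    triangular. *)
Lemma rad_x_unit x y u0 u1 u2 u3 u4 u5 : x != 0 ->
  all (pred1 0) (radF x y 0 u0 u1 u2 u3 u4 u5) ->
  all (pred1 0) [:: u0; u1; u2; u3; u4; u5].
Proof.
move=> x0 /all6P[h0 h1 h2 [h3 h4 h5]].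
have e5 : u5 = 0 by apply: (mulfI x0); rewrite mulr0 -[RHS]h2; ring.
have e4 : u4 = 0 by apply: (mulfI x0); rewrite mulr0 -[RHS]oppr0 -h3; ring.
subst u4 u5.
have e1 : u1 = 0 by apply: (mulfI x0); rewrite mulr0 -[RHS]oppr0 -h0; ring.
have e0 : u0 = 0 by apply: (mulfI x0); rewrite mulr0 -[RHS]h1; ring.
subst u0 u1.
have e3 : u3 = 0 by apply: (mulfI x0); rewrite mulr0 -[RHS]h4; ring.
have e2 : u2 = 0 by apply: (mulfI x0); rewrite mulr0 -[RHS]oppr0 -h5; ring.
by rewrite e2 e3 /= !eqxx.
Qed.

(* The span of the two points contains a point with z = 0; a nondegenerate form
   there forces u = 0, and otherwise that point is (0 : 1 : 0).  This is the
   fact that a Weierstrass cubic contains no line. *)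
Lemma rad_no_common x y z x' y' z' u0 u1 u2 u3 u4 u5 :
  [|| x * y' - y * x' != 0, x * z' - z * x' != 0 | y * z' - z * y' != 0] ->
  all (pred1 0) (radF x y z u0 u1 u2 u3 u4 u5) ->
  all (pred1 0) (radF x' y' z' u0 u1 u2 u3 u4 u5) ->
  all (pred1 0) [:: u0; u1; u2; u3; u4; u5].
Proof.
move=> indep R R'; have [h0 h1 h2 [h3 h4 h5]] := all6P R.
have [k0 k1 k2 [k3 k4 k5]] := all6P R'.
have RR : all (pred1 0) (radF (x * z' - z * x') (y * z' - z * y') 0 u0 u1 u2 u3 u4 u5).
  have comb a b : a = 0 -> b = 0 -> z' * a - z * b = 0.
    by move=> -> ->; rewrite !mulr0 subr0.
  rewrite /= !andbT; do ![apply/andP; split]; apply/eqP.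
  - by rewrite -[RHS](comb _ _ h0 k0); ring.
  - by rewrite -[RHS](comb _ _ h1 k1); ring.
  - by rewrite -[RHS](comb _ _ h2 k2); ring.
  - by rewrite -[RHS](comb _ _ h3 k3); ring.
  - by rewrite -[RHS](comb _ _ h4 k4); ring.
  - by rewrite -[RHS](comb _ _ h5 k5); ring.
have [M13|nM13] := eqVneq (x * z' - z * x') 0; last exact: rad_x_unit nM13 RR.
have [M23|nM23] := eqVneq (y * z' - z * y') 0.
  (* Both points lie on z = 0, and being independent they do not both have x = 0. *)
  move: indep; rewrite M13 M23 eqxx /= orbF => M12.
  have z0 : z = 0.
    apply: (mulfI M12); rewrite mulr0.
    have -> : (x * y' - y * x') * z = y * (x * z' - z * x') - x * (y * z' - z * y') by ring.
    by rewrite M13 M23 !mulr0 subr0.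
  have z'0 : z' = 0.
    apply: (mulfI M12); rewrite mulr0.
    have -> : (x * y' - y * x') * z' = y' * (x * z' - z * x') - x' * (y * z' - z * y') by ring.
    by rewrite M13 M23 !mulr0 subr0.
  subst z z'; have [x0|nx] := eqVneq x 0; last exact: rad_x_unit nx R.
  apply: rad_x_unit R'; apply: contraNneq M12 => ->.
  by rewrite x0 mul0r mulr0 subr0.
(* At (0 : 1 : 0) the equations kill u0, u1, u4, u5. The radical there is spanned by coordinates 2
   and 3, which the equations at the two original points eliminate. *)
move: RR; rewrite M13 => /all6P[l0 l1 _ [_ l4 l5]].
have e5 : u5 = 0 by apply: (mulfI nM23); rewrite mulr0 -[RHS]l0; ring.
have e4 : u4 = 0 by apply: (mulfI nM23); rewrite mulr0 -[RHS]oppr0 -l1; ring.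
subst u4 u5.
have e1 : u1 = 0 by apply: (mulfI nM23); rewrite mulr0 -[RHS]l4; ring.
have e0 : u0 = 0 by apply: (mulfI nM23); rewrite mulr0 -[RHS]oppr0 -l5; ring.
have e2 : u2 = 0.
  apply: (mulfI nM23); rewrite mulr0.
  have -> : (y * z' - z * y') * u2 = - (y * (- z' * u2 - x' * 0)) + y' * (- z * u2 - x * 0) by ring.
  by rewrite h3 k3 !mulr0 oppr0 addr0.
have e3 : u3 = 0.
  apply: (mulfI nM23); rewrite mulr0.
  have -> : (y * z' - z * y') * u3 = y * (z' * u3 + x' * 0) - y' * (z * u3 + x * 0) by ring.
  by rewrite h2 k2 !mulr0 subr0.
by rewrite e0 e1 e2 e3 /= !eqxx.
Qed.

End RadicalField.

(** * The integral bracket and its cocycle *)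

Section Bracket.
Variables A1 A2 A3 A4 A6 : int.

Definition cz (u : 'rV[int]_6) (k : nat) : int := u 0 (inord k).

Definition row3 (a b c : int) : 'rV[int]_3 := \row_(k < 3) nth 0 [:: a; b; c] k.
Definition row6 (s : seq int) : 'rV[int]_6 := \row_(k < 6) nth 0 s k.

Lemma cz_row6 s k : (k < 6)%N -> cz (row6 s) k = nth 0 s k.
Proof. by move=> k6; rewrite /cz mxE inordK. Qed.

Lemma czD u v k : cz (u + v) k = cz u k + cz v k.
Proof. by rewrite /cz mxE. Qed.

Lemma czB u v k : cz (u - v) k = cz u k - cz v k.
Proof. by rewrite /cz !mxE. Qed.

Lemma czZ a u k : cz (a *: u) k = a * cz u k.
Proof. by rewrite /cz mxE. Qed.

Lemma cz0 k : cz 0 k = 0.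
Proof. by rewrite /cz mxE. Qed.

Lemma row6P (u v : 'rV[int]_6) : (forall k, (k < 6)%N -> cz u k = cz v k) -> u = v.
Proof.
move=> H; apply/rowP => i; have := H i (ltn_ord i).
by rewrite /cz inord_val.
Qed.

Lemma row3P (u v : 'rV[int]_3) : u 0 0 = v 0 0 -> u 0 1 = v 0 1 ->
  u 0 (inord 2) = v 0 (inord 2) -> u = v.
Proof.
move=> h0 h1 h2; apply/rowP => -[[|[|[|k]]] lt] //.
- by have -> : Ordinal lt = 0 by apply: val_inj.
- by have -> : Ordinal lt = 1 by apply: val_inj.
- by have -> : Ordinal lt = inord 2 by apply: val_inj; rewrite /= inordK.
Qed.

Lemma row3E a b c : (row3 a b c 0 0 = a) * (row3 a b c 0 1 = b) * (row3 a b c 0 (inord 2) = c).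
Proof. by rewrite /row3 !mxE inordK. Qed.

(** Only entries [m i j] with i < j occur. Fed with [u i * v j] it is the upper triangular half of
    the bracket, an integral cocycle whose antisymmetrization is the bracket. *)
Definition structure_form (m : nat -> nat -> int) : 'rV[int]_3 :=
  row3 (m 0%N 1%N - m 2%N 5%N + m 3%N 4%N + A2 * m 4%N 5%N)
       (- m 0%N 5%N + m 1%N 4%N - A1 * m 4%N 5%N)
       (m 0%N 4%N - A3 * m 0%N 5%N - A6 * m 1%N 5%N - m 2%N 3%N + A4 * m 4%N 5%N).

Definition beta6 u v := structure_form (fun i j => cz u i * cz v j).
Definition brack u v := structure_form (fun i j => cz u i * cz v j - cz u j * cz v i).

Lemma brackE u v : brack u v = beta6 u v - beta6 v u.
Proof. by apply: row3P; rewrite mxB_entry /brack /beta6 /structure_form !row3E; ring. Qed.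

Lemma beta6Dl u v w : beta6 (u + v) w = beta6 u w + beta6 v w.
Proof. by apply: row3P; rewrite mxD_entry /beta6 /structure_form !row3E !czD; ring. Qed.

Lemma beta6Dr u v w : beta6 u (v + w) = beta6 u v + beta6 u w.
Proof. by apply: row3P; rewrite mxD_entry /beta6 /structure_form !row3E !czD; ring. Qed.

Definition radz x y z u :=
  rad A1 A2 A3 A4 A6 x y z (cz u 0) (cz u 1) (cz u 2) (cz u 3) (cz u 4) (cz u 5).

Definition pair3 x y z (w : 'rV[int]_3) : int := x * w 0 0 + y * w 0 1 + z * w 0 (inord 2).

Lemma pair_brack x y z u v : pair3 x y z (brack u v) = \sum_(j < 6) nth 0 (radz x y z u) j * cz v j.
Proof.
rewrite !big_ord_recl big_ord0 /pair3 /brack /structure_form !row3E /= /bump /=; ring.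
Qed.

Lemma pair_brackP d x y z u :
  (forall v, (d %| pair3 x y z (brack u v))%Z) <-> all (fun c => (d %| c)%Z) (radz x y z u).
Proof.
split=> [H|/(all_nthP 0) H v]; last first.
  by rewrite pair_brack; apply: rpred_sum => j _; rewrite dvdz_mulr //; apply: H.
apply/(all_nthP 0) => j /= j6.
have := H (delta_mx 0 (inord j)); rewrite pair_brack.
rewrite (bigD1 (inord j)) //= big1 ?addr0.
  by rewrite /cz inord_val mxE !eqxx mulr1 inordK.
by move=> k kj; rewrite /cz inord_val mxE eqxx (negbTE kj) mulr0.
Qed.

Lemma radzZ x y z a u : radz x y z (a *: u) = [seq a * c | c <- radz x y z u].
Proof.
rewrite /radz !czZ /rad /=.
do ![congr (_ :: _)]; ring.
Qed.

End Bracket.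

(** The forms only have to take arbitrary values modulo the [d k] simultaneously. They need not be a
    basis over Z, so inverses modulo p^e suffice to apply this. *)
Lemma latidx_forms n m (H : set 'rV[int]_n) (f : 'I_m -> 'rV[int]_n -> int) (d : 'I_m -> nat) :
  (forall k u v, f k (u - v) = f k u - f k v) -> (forall k, (0 < d k)%N) ->
  (forall t : 'I_m -> int, exists u, forall k, (d k %| f k u - t k)%Z) ->
  (forall u, H u <-> forall k, (d k %| f k u)%Z) -> latidx H (\prod_k d k).
Proof.
move=> fB d0 fs Hf; pose K := {dffun forall k : 'I_m, 'I_(d k).-1.+1}.
have -> : (\prod_k d k)%N = #|{: K}|.
  rewrite card_dep_ffun foldrE big_map big_enum /=.
  by apply: eq_bigr => i _; rewrite card_ord prednK.
apply: (has_index_fin (c := fun v => finfun (fun k => residue (d k) (f k v)) : K)).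
  move=> t; have [u Hu] := fs (fun k => (t k : nat) : int); exists u.
  apply/ffunP => k; rewrite ffunE -[RHS]residue_nat //.
  by apply/residue_eq => //; rewrite -opprB rpredN.
move=> x y; rewrite Hf; split=> [H'|/ffunP H' k].
  by apply/ffunP => k; rewrite !ffunE; apply/residue_eq => //; rewrite -fB.
by have := H' k; rewrite !ffunE => /(residue_eq _ _ (d0 k)); rewrite fB.
Qed.

(** * Index of the radical modulo a prime power *)

Section PAdic.
Variable p : nat.
Hypothesis p_pr : prime p.

(* The minimum of [e] and the [p]-adic valuation of [x]. *)
Definition mval e (x : int) : nat := logn p (gcdn `|x| (p ^ e)).

Lemma gcd_mval e x : gcdn `|x| (p ^ e) = (p ^ mval e x)%N.
Proof.
rewrite /mval; have /(dvdn_pfactor _ _ p_pr)[i _ ->] := dvdn_gcdr `|x| (p ^ e).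
by rewrite pfactorK.
Qed.

Lemma mval_dvd e x i : (i <= e)%N -> ((p ^ i)%N %| x)%Z = (i <= mval e x)%N.
Proof.
move=> ie; rewrite dvdzE /= -(dvdn_Pexp2l _ _ (prime_gt1 p_pr)) -gcd_mval dvdn_gcd.
by rewrite [X in _ = _ && X]dvdn_exp2l // andbT.
Qed.

Lemma mval_le e x : (mval e x <= e)%N.
Proof.
by rewrite -(dvdn_Pexp2l _ _ (prime_gt1 p_pr)) -gcd_mval dvdn_gcdr.
Qed.

(** Turns an equation P u_k = 0 modulo p^e into a congruence on u_k alone, which provides the two
    exceptional elementary divisors below. *)
Lemma mval_mulP e x u :
  ((p ^ e)%N %| x * u)%Z = ((p ^ (e - mval e x))%N %| u)%Z.
Proof.
rewrite !dvdzE abszM /=; set X := `|x|%N; set m := mval e x.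
have pm0 : (0 < p ^ m)%N by rewrite expn_gt0 prime_gt0.
have gE := gcd_mval e x; rewrite -/X -/m in gE.
have /dvdnP[X' XE] : (p ^ m %| X)%N by rewrite -gE dvdn_gcdl.
have pe : (p ^ e = p ^ (e - m) * p ^ m)%N by rewrite -expnD subnK // mval_le.
have cop : coprime (p ^ (e - m)) X'.
  move: gE; rewrite XE pe -muln_gcdl => /eqP; rewrite -{2}[(p ^ m)%N]mul1n.
  by rewrite eqn_pmul2r // gcdnC.
by rewrite XE pe mulnAC dvdn_pmul2r // Gauss_dvdr.
Qed.

Lemma unit_mod_pe e z : ~~ (p %| z)%Z -> exists z' : int, ((p ^ e)%N %| z * z' - 1)%Z.
Proof.
move=> pz; have cop : coprimez z (p ^ e)%N.
  rewrite coprimezE /= coprime_sym coprimeXl // prime_coprime //.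
have [u [v]] := Bezoutz z (p ^ e)%N.
rewrite (eqP cop) => <-; exists u.
by rewrite mulrC opprD addrA subrr add0r rpredN dvdz_mull.
Qed.

Lemma dvdz_unitl e a x : ~~ (p %| a)%Z -> ((p ^ e)%N %| a * x)%Z = ((p ^ e)%N %| x)%Z.
Proof.
move=> pa; rewrite mval_mulP; congr (_ %| _)%Z; congr ((p ^ _)%N).
suff -> : mval e a = 0%N by rewrite subn0.
apply/eqP; rewrite -leqn0 leqNgt; apply/negP => lt.
case: e lt => [|e]; first by have := mval_le 0 a; rewrite leqn0 => /eqP ->.
by rewrite -mval_dvd // expn1 (negbTE pa).
Qed.

Lemma pdvdz_unitl a x : ~~ (p %| a)%Z -> (p %| a * x)%Z = (p %| x)%Z.
Proof. by move=> pa; have := dvdz_unitl 1 x pa; rewrite expn1. Qed.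

Variables A1 A2 A3 A4 A6 : int.
Local Notation rd := (radz A1 A2 A3 A4 A6).
Local Notation P := (cubic A1 A2 A3 A4 A6).
Local Notation dvall d := (all (fun c : int => (d%N %| c)%Z)).

Definition Rad (Q : nat) x y z : set 'rV[int]_6 := [set u | dvall Q (rd x y z u)].

Lemma dvall6P d (a b c e f g : int) : dvall d [:: a; b; c; e; f; g] <->
  [/\ d %| a, d %| b, d %| c & [/\ d %| e, d %| f & d %| g]]%Z.
Proof.
split=> [/= /and5P[ha hb hc he /and3P[hf hg _]] //|].
by move=> [ha hb hc [he hf hg]]; rewrite /= ha hb hc he hf hg.
Qed.

Lemma prod_d6 e k : (\prod_(i < 6) nth 1%N [:: p ^ e; p ^ e; p ^ e; p ^ e; p ^ k; p ^ k] i
  = p ^ (4 * e + 2 * k))%N.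
Proof.
rewrite !big_ord_recl big_ord0 /= /bump /= muln1 -!expnD; congr (_ ^ _)%N; lia.
Qed.

Lemma d6_gt0 e k (i : 'I_6) : (0 < nth 1 [:: p ^ e; p ^ e; p ^ e; p ^ e; p ^ k; p ^ k] i)%N.
Proof. by case: i => [[|[|[|[|[|[|i]]]]]] lt] //=; rewrite expn_gt0 prime_gt0. Qed.

Lemma forall_ord6 (d : seq nat) (s : seq int) :
  (forall i : 'I_6, (nth 1%N d i %| nth 0 s i)%Z) <->
  [/\ nth 1%N d 0 %| s`_0, nth 1%N d 1 %| s`_1, nth 1%N d 2 %| s`_2 &
   [/\ nth 1%N d 3 %| s`_3, nth 1%N d 4 %| s`_4 & nth 1%N d 5 %| s`_5]]%Z.
Proof.
split=> [H|[? ? ? [? ? ?]] [[|[|[|[|[|[|i]]]]]] lt] //].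
have HQ k (lt : (k < 6)%N) : (nth 1%N d k %| nth 0 s k)%Z := H (Ordinal lt).
by split; [| | | split]; apply: HQ.
Qed.

Local Ltac dvds := repeat
  (first [assumption | apply: rpredD | rewrite rpredN | apply: dvdz_mull]).

(** With z invertible, entries 4, 3, 2, 0 of u B can be prescribed through u0, u2, u3, u4. Modulo
    these four, entries 1 and 5 times z^2 reduce to - P u5 and P u1. *)
Lemma Rad_idx_z e x y z : ~~ (p %| z)%Z ->
  latidx (Rad (p ^ e) x y z) (p ^ (4 * e + 2 * (e - mval e (P x y z)))).
Proof.
move=> pz; have [z' zz'] := unit_mod_pe e pz; rewrite -prod_d6.
set q := (e - _)%N.
pose f (k : 'I_6) u := nth 0 [:: nth 0 (rd x y z u) 4; nth 0 (rd x y z u) 3;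
  nth 0 (rd x y z u) 2; nth 0 (rd x y z u) 0; cz u 1; cz u 5] k.
apply: (latidx_forms (f := f)); rewrite {}/f.
- case=> [[|[|[|[|[|[|k]]]]]] lt] //= u v; rewrite !czB; ring.
- exact: d6_gt0.
- move=> t; pose t' k := t (inord k); pose w := A1 * y - A2 * x - A4 * z.
  have tE i : t i = t' i by rewrite /t' inord_val.
  pose u1 := t' 4%N; pose u5 := t' 5%N.
  pose u4 := z' * (- t' 3%N - x * u1 + (y + A3 * z) * u5).
  pose u3 := z' * (t' 2%N - x * u5).
  pose u2 := z' * (- t' 1%N - x * u4).
  pose u0 := z' * (t' 0%N - y * u1 - x * u3 - w * u5).
  have dv c a : a = (z * z' - 1) * c -> ((p ^ e)%N %| a)%Z by move=> ->; rewrite dvdz_mulr.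
  exists (row6 [:: u0; u1; u2; u3; u4; u5]) => k; rewrite tE /radz !cz_row6 //.
  case: k => [[|[|[|[|[|[|k]]]]]] lt] //=.
  + by apply: (dv (t' 0%N - y * u1 - x * u3 - w * u5)); rewrite /u0 /w; ring.
  + by apply: (dv (t' 1%N + x * u4)); rewrite /u2; ring.
  + by apply: (dv (t' 2%N - x * u5)); rewrite /u3; ring.
  + by apply: (dv (t' 3%N + x * u1 - (y + A3 * z) * u5)); rewrite /u4; ring.
  + by rewrite subrr dvdz0.
  + by rewrite subrr dvdz0.
move=> u; rewrite /Rad /mkset /radz; move: (cz u 0) (cz u 1) (cz u 2) (cz u 3) (cz u 4) (cz u 5).
move=> u0 u1 u2 u3 u4 u5.
set c := rad A1 A2 A3 A4 A6 x y z u0 u1 u2 u3 u4 u5.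
have cE : c = [:: c`_0; c`_1; c`_2; c`_3; c`_4; c`_5] by [].
have e1 : z * (z * c`_1) = (z * x * c`_4 + z * y * c`_0 - x ^+ 2 * c`_2) - P x y z * u5.
  by rewrite /c /= /cubic; ring.
have e5 : z * (z * c`_5) = (- (y + A3 * z) * z * c`_4 + x * z * c`_3 + (A1 * y - A2 * x - A4 * z) * z * c`_0
   + (y + A3 * z) * x * c`_2 - x ^+ 2 * c`_0) + P x y z * u1.
  by rewrite /c /= /cubic; ring.
rewrite cE dvall6P; split.
  move=> [h0 h1 h2 [h3 h4 h5]]; apply/forall_ord6 => /=; split=> //; split=> //.
    rewrite /q -mval_mulP; have := dvdz_mull z (dvdz_mull z h5); rewrite e5.
    by rewrite rpredDl //; dvds.
  rewrite /q -mval_mulP; have := dvdz_mull z (dvdz_mull z h1); rewrite e1.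
  by rewrite rpredBl //; dvds.
move=> /forall_ord6 /= [h4 h3 h2 [h0]]; rewrite -!mval_mulP => hu1 hu5.
split=> //; last split=> //.
  by rewrite -(dvdz_unitl _ _ pz) -(dvdz_unitl _ _ pz) e1; dvds.
by rewrite -(dvdz_unitl _ _ pz) -(dvdz_unitl _ _ pz) e5; dvds.
Qed.

(** The block of B on coordinates 0, 1, 4, 5 has Pfaffian [dl], which is - y^2 modulo p. The
    combinations [ch0], [ch1], [ch4], [ch5] invert this block: each is [dl] times its coordinate
    plus terms in u2, u3. Entries 2 and 3 times [dl] then reduce to - P u3 and P u2. *)
Lemma Rad_idx_y e x y z : ~~ (p %| y)%Z -> (p %| x)%Z -> (p %| z)%Z ->
  latidx (Rad (p ^ e) x y z) (p ^ (4 * e + 2 * (e - mval e (P x y z)))).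
Proof.
move=> py px pz; pose w := A1 * y - A2 * x - A4 * z; pose Y := y + A3 * z.
pose dl := - x * w + A6 * z ^+ 2 - y * Y.
have pdl : ~~ (p %| dl)%Z.
  have -> : dl = x * (- w) + z * (A6 * z - A3 * y) - y * y by rewrite /dl /Y; ring.
  rewrite rpredBl; last by rewrite rpredD // dvdz_mulr.
  by rewrite pdvdz_unitl.
have [d' dd'] := unit_mod_pe e pdl; rewrite -prod_d6.
set q := (e - _)%N.
pose ch0 c := - w * nth 0 c 1 + A6 * z * nth 0 c 4 + y * nth 0 c 5.
pose ch1 c := w * nth 0 c 0 - Y * nth 0 c 4 - z * nth 0 c 5.
pose ch4 c := - A6 * z * nth 0 c 0 + Y * nth 0 c 1 + x * nth 0 c 5.
pose ch5 c := - y * nth 0 c 0 + z * nth 0 c 1 - x * nth 0 c 4.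
pose f (k : 'I_6) u := let c := rd x y z u in
  nth 0 [:: ch0 c; ch1 c; ch4 c; ch5 c; cz u 2; cz u 3] k.
apply: (latidx_forms (f := f)); rewrite {}/f.
- case=> [[|[|[|[|[|[|k]]]]]] lt] //= u v; rewrite /ch0 /ch1 /ch4 /ch5 /= !czB; ring.
- exact: d6_gt0.
- move=> t; pose t' k := t (inord k).
  have tE i : t i = t' i by rewrite /t' inord_val.
  pose u2 := t' 4%N; pose u3 := t' 5%N.
  pose u0 := d' * (t' 0%N - A6 * z * x * u3 + y * x * u2).
  pose u1 := d' * (t' 1%N + Y * x * u3 - z * x * u2).
  pose u4 := d' * (t' 2%N + x ^+ 2 * u2).
  pose u5 := d' * (t' 3%N + x ^+ 2 * u3).
  have dv c a : a = (dl * d' - 1) * c -> ((p ^ e)%N %| a)%Z by move=> ->; rewrite dvdz_mulr.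
  exists (row6 [:: u0; u1; u2; u3; u4; u5]) => k; rewrite tE /radz !cz_row6 //.
  case: k => [[|[|[|[|[|[|k]]]]]] lt] //=.
  + apply: (dv (t' 0%N - A6 * z * x * u3 + y * x * u2)).
    by rewrite /ch0 /= /u0 /dl /w /Y; ring.
  + apply: (dv (t' 1%N + Y * x * u3 - z * x * u2)).
    by rewrite /ch1 /= /u1 /dl /w /Y; ring.
  + by apply: (dv (t' 2%N + x ^+ 2 * u2)); rewrite /ch4 /= /u4 /dl /w /Y; ring.
  + by apply: (dv (t' 3%N + x ^+ 2 * u3)); rewrite /ch5 /= /u5 /dl /w /Y; ring.
  + by rewrite subrr dvdz0.
  + by rewrite subrr dvdz0.
move=> u; rewrite /Rad /mkset /radz; move: (cz u 0) (cz u 1) (cz u 2) (cz u 3) (cz u 4) (cz u 5).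
move=> u0 u1 u2 u3 u4 u5.
set c := rad A1 A2 A3 A4 A6 x y z u0 u1 u2 u3 u4 u5.
have cE : c = [:: c`_0; c`_1; c`_2; c`_3; c`_4; c`_5] by [].
have e0 : dl * c`_0 = - x * ch1 c - z * ch4 c + Y * ch5 c.
  by rewrite /ch1 /ch4 /ch5 /dl /c /= /w /Y; ring.
have e1 : dl * c`_1 = x * ch0 c - y * ch4 c + A6 * z * ch5 c.
  by rewrite /ch0 /ch4 /ch5 /dl /c /= /w /Y; ring.
have e4 : dl * c`_4 = z * ch0 c + y * ch1 c + w * ch5 c.
  by rewrite /ch0 /ch1 /ch5 /dl /c /= /w /Y; ring.
have e5 : dl * c`_5 = - Y * ch0 c - A6 * z * ch1 c - w * ch4 c.
  by rewrite /ch0 /ch1 /ch4 /dl /c /= /w /Y; ring.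
have e2 : dl * c`_2 = x * ch5 c - P x y z * u3.
  by rewrite /ch5 /dl /c /= /cubic /w /Y; ring.
have e3 : dl * c`_3 = - x * ch4 c + P x y z * u2.
  by rewrite /ch4 /dl /c /= /cubic /w /Y; ring.
rewrite cE dvall6P -cE; split.
  move=> [h0 h1 h2 [h3 h4 h5]].
  have H0 : ((p ^ e)%N %| ch0 c)%Z by rewrite /ch0; dvds.
  have H1 : ((p ^ e)%N %| ch1 c)%Z by rewrite /ch1; dvds.
  have H4 : ((p ^ e)%N %| ch4 c)%Z by rewrite /ch4; dvds.
  have H5 : ((p ^ e)%N %| ch5 c)%Z by rewrite /ch5; dvds.
  apply/forall_ord6; split=> //; split=> //=.
    rewrite /q -mval_mulP; have := dvdz_mull dl h3; rewrite e3.
    by rewrite rpredDl //; dvds.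
  rewrite /q -mval_mulP; have := dvdz_mull dl h2; rewrite e2.
  by rewrite rpredBl //; dvds.
move=> /forall_ord6 /= [H0 H1 H4 [H5]]; rewrite -!mval_mulP => hu2 hu3.
split; last split.
- by rewrite -(dvdz_unitl _ _ pdl) e0; dvds.
- by rewrite -(dvdz_unitl _ _ pdl) e1; dvds.
- by rewrite -(dvdz_unitl _ _ pdl) e2; dvds.
- by rewrite -(dvdz_unitl _ _ pdl) e3; dvds.
- by rewrite -(dvdz_unitl _ _ pdl) e4; dvds.
- by rewrite -(dvdz_unitl _ _ pdl) e5; dvds.
Qed.

Lemma scalez_inj n (a : int) : a != 0 -> injective (fun u : 'rV[int]_n => a *: u).
Proof.
move=> a0 u v /rowP e; apply/rowP => i; have := e i; rewrite !mxE.
exact: mulfI.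
Qed.

Lemma dvd_rowP n (d : nat) (u : 'rV[int]_n) :
  (forall i, (d %| (u 0 i)%R)%Z) <-> exists v, u = d%:Z *: v.
Proof.
split=> [H|[v ->] i]; last by rewrite mxE dvdz_mulr.
exists (\row_i (u 0%R i %/ d)%Z); apply/rowP => i.
by rewrite !mxE mulrC divzK.
Qed.

(** Divisibility by p^e is gained one factor p at a time, so that each step is linear algebra over
    F_p. *)
Lemma peel e (S : set 'rV[int]_6) :
  (forall j v, (j < e)%N -> S ((p ^ j)%:Z *: v) -> exists w, v = p%:Z *: w) ->
  forall u, S u -> exists v, u = (p ^ e)%:Z *: v.
Proof.
move=> H u Su; suff : forall j, (j <= e)%N -> exists v, u = (p ^ j)%:Z *: v by apply.
elim=> [|j IH] je; first by exists u; rewrite expn0 scale1r.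
have [v uv] := IH (ltnW je); move: Su; rewrite uv => /(H _ _ je)[w ->].
by exists w; rewrite scalerA -PoszM -expnSr.
Qed.

Lemma rad_Fp x y z u : dvall p (rd x y z u) ->
  all (pred1 0) (rad (A1%:~R : 'F_p) A2%:~R A3%:~R A4%:~R A6%:~R x%:~R y%:~R z%:~R
    (cz u 0)%:~R (cz u 1)%:~R (cz u 2)%:~R (cz u 3)%:~R (cz u 4)%:~R (cz u 5)%:~R).
Proof.
move=> H; have -> : rad (A1%:~R : 'F_p) A2%:~R A3%:~R A4%:~R A6%:~R x%:~R y%:~R z%:~R
    (cz u 0)%:~R (cz u 1)%:~R (cz u 2)%:~R (cz u 3)%:~R (cz u 4)%:~R (cz u 5)%:~R
    = [seq c%:~R | c <- rd x y z u].
  by rewrite /radz /rad /=; do ![congr (_ :: _)]; ring.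
rewrite all_map; apply: sub_all H => c /=.
by rewrite (dvdz_pcharf (pchar_Fp p_pr)).
Qed.

Lemma cz_Fp_dvd u : all (pred1 (0 : 'F_p)) [:: (cz u 0)%:~R; (cz u 1)%:~R; (cz u 2)%:~R;
   (cz u 3)%:~R; (cz u 4)%:~R; (cz u 5)%:~R] -> exists v, u = p%:Z *: v.
Proof.
move=> /all6P[h0 h1 h2 [h3 h4 h5]]; apply/dvd_rowP => i.
have uE : u 0 i = cz u i by rewrite /cz inord_val.
rewrite uE (dvdz_pcharf (pchar_Fp p_pr)); apply/eqP.
by case: i uE => [[|[|[|[|[|[|i]]]]]] lt].
Qed.

Lemma Rad_scale Q a x y z u : (0 < a)%N ->
  dvall (a * Q)%N (rd x y z (a%:Z *: u)) = dvall Q (rd x y z u).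
Proof.
move=> a0; rewrite radzZ all_map; apply: eq_all => c /=.
by rewrite PoszM dvdz_mul2l // -lt0n.
Qed.

Lemma dvall_dvd d d' s : (d %| d')%N -> dvall d' s -> dvall d s.
Proof. by move=> dd; apply: sub_all => c; apply: dvdz_trans; rewrite dvdzE. Qed.

(** Here P is - x^3 modulo p, a unit: the form is nondegenerate and the radical is p^e Z^6. *)
Lemma Rad_idx_x e x y z : ~~ (p %| x)%Z -> (p %| z)%Z ->
  latidx (Rad (p ^ e) x y z) (p ^ (4 * e + 2 * (e - mval e (P x y z)))).
Proof.
move=> px pz.
have pP : ~~ (p %| P x y z)%Z.
  have -> : P x y z = z * (y ^+ 2 + A1 * x * y + A3 * y * z - A2 * x ^+ 2 - A4 * x * z - A6 * z ^+ 2)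
     - x * (x * x) by rewrite /cubic; ring.
  rewrite rpredBl; last by rewrite dvdz_mulr.
  by rewrite !pdvdz_unitl.
have -> : mval e (P x y z) = 0%N.
  apply/eqP; rewrite -leqn0 leqNgt; apply/negP => lt.
  have e0 : (0 < e)%N := leq_trans lt (mval_le _ _).
  by move: lt; rewrite -mval_dvd // expn1 (negbTE pP).
have -> : (p ^ (4 * e + 2 * (e - 0)) = \prod_(i < 6) p ^ e)%N.
  by rewrite prod_nat_const card_ord -expnM; congr (_ ^ _)%N; lia.
have pe0 : (0 < p ^ e)%N by rewrite expn_gt0 prime_gt0.
apply: eq_has_index (dlat_idx (unitmx1 _ 6) (fun=> pe0)) => u v.
set k := v - u; rewrite /dlat /mkset mulmx1 dvd_rowP; split.
  move=> [t ->]; have := Rad_scale 1 x y z t pe0; rewrite muln1 /Rad /mkset => ->.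
  by apply/allP => c _; rewrite dvd1z.
apply: peel => j t je; rewrite /Rad /mkset.
rewrite -{1}(subnKC (ltnW je)) expnD Rad_scale ?expn_gt0 ?prime_gt0 // => Ht.
have {}Ht : dvall p (rd x y z t).
  by apply: dvall_dvd Ht; rewrite dvdn_exp // subn_gt0.
have /eqP z0 : z%:~R == 0 :> 'F_p by rewrite -(dvdz_pcharf (pchar_Fp p_pr)).
apply: cz_Fp_dvd; have := rad_Fp Ht; rewrite z0; apply: rad_x_unit.
by rewrite -(dvdz_pcharf (pchar_Fp p_pr)).
Qed.

Lemma RadP (Q : nat) x y z u : Rad Q x y z u <->
  forall v, (Q %| pair3 x y z (brack A1 A2 A3 A4 A6 u v))%Z.
Proof. exact: iff_sym (pair_brackP _ _ _ _ _ _ _ _ _ _). Qed.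

Lemma Rad_subgroup Q x y z : subgroup_of (Rad Q x y z).
Proof.
split=> [|u v].
  apply/RadP => v; rewrite brackE /pair3 /beta6 !mxB_entry /structure_form !row3E !cz0.
  by rewrite !(mul0r, mulr0, subr0, oppr0, addr0) dvdz0.
move=> /RadP hu /RadP hv; apply/RadP => w.
have -> : pair3 x y z (brack A1 A2 A3 A4 A6 (u - v) w)
   = pair3 x y z (brack A1 A2 A3 A4 A6 u w) - pair3 x y z (brack A1 A2 A3 A4 A6 v w).
  by rewrite /pair3 /brack /structure_form !row3E !czB; ring.
by rewrite rpredB.
Qed.

Lemma Rad_idx e x y z : ~~ [&& p %| x, p %| y & p %| z]%Z ->
  latidx (Rad (p ^ e) x y z) (p ^ (4 * e + 2 * (e - mval e (P x y z)))).
Proof.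
move=> prim; have [pz|pz] := boolP (p %| z)%Z; last exact: Rad_idx_z.
have [px|px] := boolP (p %| x)%Z; last exact: Rad_idx_x.
by apply: Rad_idx_y => //; move: prim; rewrite px pz andbT.
Qed.

Definition annih (Lam : set 'rV[int]_3) : set 'rV[int]_6 :=
  [set u | forall v, Lam (brack A1 A2 A3 A4 A6 u v)].

Lemma mulmx3E (w : 'rV[int]_3) (U : 'M[int]_3) i :
  (w *m U) 0 i = pair3 (U 0 i) (U 1 i) (U (inord 2) i) w.
Proof.
rewrite mxE !big_ord_recl big_ord0 addr0 addrA /pair3.
have -> : lift ord0 ord0 = 1 :> 'I_3 by apply: val_inj.
have -> : lift ord0 (lift ord0 ord0) = inord 2 :> 'I_3 by apply: val_inj; rewrite /= inordK.
by rewrite !(mulrC (w _ _)).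
Qed.

Lemma annih_dlat U d u : annih (dlat U d) u <->
  forall i, dvall (d i) (rd (U 0 i) (U 1 i) (U (inord 2) i) u).
Proof.
split=> [H i|H v i]; first by apply/RadP => v; rewrite -mulmx3E; apply: H.
rewrite mulmx3E; exact: (RadP _ _ _ _ _).1 (H i) v.
Qed.

Lemma unitmx_primitive (U : 'M[int]_3) i : U \in unitmx ->
  ~~ [&& p %| (U 0 i)%R, p %| (U 1 i)%R & p %| U (inord 2) i]%Z.
Proof.
move=> Uu; apply/negP => /and3P[h0 h1 h2].
have : (invmx U *m U) i i = 1 by rewrite mulVmx // mxE eqxx.
have -> : (invmx U *m U) i i = pair3 (U 0 i) (U 1 i) (U (inord 2) i) (row i (invmx U)).
  by rewrite -mulmx3E -row_mul [RHS]mxE.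
move=> e; have : (p %| 1%R)%Z.
  by rewrite -e /pair3; apply: rpredD; first apply: rpredD; apply: dvdz_mulr.
by rewrite dvdzE /= dvdn1 => /eqP p1; move: p_pr; rewrite p1.
Qed.

(** If all 2 x 2 minors of columns i and j of [U] vanished modulo p, so would a principal 2 x 2
    minor of the identity matrix [invmx U *m U]. *)
Lemma unitmx_independent (U : 'M[int]_3) i j : U \in unitmx -> i != j ->
  [|| (U 0 i)%:~R * (U 1 j)%:~R - (U 1 i)%:~R * (U 0 j)%:~R != 0 :> 'F_p,
      (U 0 i)%:~R * (U (inord 2) j)%:~R - (U (inord 2) i)%:~R * (U 0 j)%:~R != 0 :> 'F_p
    | (U 1 i)%:~R * (U (inord 2) j)%:~R - (U (inord 2) i)%:~R * (U 1 j)%:~R != 0 :> 'F_p].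
Proof.
move=> Uu ij; pose f k l : 'F_p := (U k l)%:~R; apply/negPn/negP; rewrite !negb_or !negbK => /and3P[/eqP h0 /eqP h1 /eqP h2].
pose V := invmx U; pose g k l : 'F_p := (V k l)%:~R.
have VU k l : g k 0 * f 0 l + g k 1 * f 1 l + g k (inord 2) * f (inord 2) l = (k == l)%:R.
  have : (V *m U) k l = (k == l)%:R by rewrite mulVmx // mxE.
  have -> : (V *m U) k l = pair3 (U 0 l) (U 1 l) (U (inord 2) l) (row k V).
    by rewrite -mulmx3E -row_mul [RHS]mxE.
  move=> /(congr1 (intr : int -> 'F_p)); rewrite /pair3 !mxE !rmorphD !rmorphM /=.
  by rewrite /g /f !(mulrC (V k _)%:~R) => ->; case: eqP.
have : (g i 0 * f 0 i + g i 1 * f 1 i + g i (inord 2) * f (inord 2) i) *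
       (g j 0 * f 0 j + g j 1 * f 1 j + g j (inord 2) * f (inord 2) j) -
       (g i 0 * f 0 j + g i 1 * f 1 j + g i (inord 2) * f (inord 2) j) *
       (g j 0 * f 0 i + g j 1 * f 1 i + g j (inord 2) * f (inord 2) i) = 1.
  by rewrite !VU !eqxx (negbTE ij) mul1r mul0r subr0.
(* The Cauchy-Binet identity for a 2 x 3 matrix times a 3 x 2 matrix. *)
have -> : forall a b c a' b' c' x y z x' y' z' : 'F_p,
   (a * x + b * y + c * z) * (a' * x' + b' * y' + c' * z')
   - (a * x' + b * y' + c * z') * (a' * x + b' * y + c' * z)
   = (a * b' - b * a') * (x * y' - y * x') + (a * c' - c * a') * (x * z' - z * x')
   + (b * c' - c * b') * (y * z' - z * y') by move=> *; ring.
rewrite /f h0 h1 h2 !mulr0 !addr0 => /eqP.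
by rewrite eq_sym oner_eq0.
Qed.

(** Columns 0 and 1 both impose conditions modulo p^b, and their forms have no common radical modulo
    p, so u = p^b v. Then columns 1 and 2 hold automatically, and column 0 says that v lies in the
    radical modulo p^(a - b). *)
Lemma annih_idx (U : 'M[int]_3) a b c : U \in unitmx -> (c <= b <= a)%N ->
  let l : 'I_3 := 0 in
  latidx (annih (dlat U (fun i => p ^ nth 0 [:: a; b; c] i)%N))
   (p ^ (6 * b + (4 * (a - b) + 2 * (a - b - mval (a - b) (P (U 0 l) (U 1 l) (U (inord 2) l)))))).
Proof.
move=> Uu /andP[cb ba] l; set x := U 0 l; set y := U 1 l; set z := U (inord 2) l.
set e := (a - b)%N; have pg k : (0 < p ^ k)%N by rewrite expn_gt0 prime_gt0.
have hR := Rad_idx e (unitmx_primitive l Uu).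
have hb : latidx [set u : 'rV[int]_6 | exists v, u = (p ^ b)%:Z *: v] (p ^ (6 * b)).
  have -> : (p ^ (6 * b) = \prod_(i < 6) p ^ b)%N.
    by rewrite prod_nat_const card_ord -expnM mulnC.
  apply: eq_has_index (dlat_idx (unitmx1 _ 6) (fun=> pg b)) => u v.
  by rewrite /dlat /mkset mulmx1 dvd_rowP.
have hbS : subgroup_of [set u : 'rV[int]_6 | exists v, u = (p ^ b)%:Z *: v].
  split=> [|_ _ [v ->] [w ->]]; first by exists 0; rewrite scaler0.
  by exists (v - w); rewrite scalerBr.
have A_inj (u : 'rV[int]_6) : u *m (p ^ b)%:Z%:M = 0 -> u = 0.
  rewrite mul_mx_scalar -{1}(scaler0 _ (p ^ b)%:Z) => /scalez_inj; apply.
  by rewrite -lt0n.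
have hbA (u : 'rV[int]_6) : (exists v, u = (p ^ b)%:Z *: v) <-> exists v, u = v *m (p ^ b)%:Z%:M.
  by split=> -[v ->]; exists v; rewrite mul_mx_scalar.
have := latidx_image hbS (Rad_subgroup _ _ _ _) hbA A_inj hb hR.
rewrite mulnC -expnD; apply: eq_has_index => u v; move: (v - u) => {u v} u.
have nl : nth 0%N [:: a; b; c] l = a by [].
split=> [[v Rv ->]|].
  rewrite mul_mx_scalar; apply/annih_dlat => i.
  have rvQ k : (k <= b)%N -> dvall (p ^ k)%N (rd (U 0 i) (U 1 i) (U (inord 2) i) ((p ^ b)%:Z *: v)).
    move=> kb; apply: (@dvall_dvd _ (p ^ b)); first by rewrite dvdn_exp2l.
    have := Rad_scale 1 (U 0 i) (U 1 i) (U (inord 2) i) v (pg b); rewrite muln1 => ->.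
    by apply/allP => c' _; rewrite dvd1z.
  have [->|i0] := eqVneq i l; last first.
    by apply: rvQ; case: i i0 => [[|[|[|k]]] lt'].
  by rewrite nl -{1}(subnKC ba) expnD Rad_scale.
move=> /annih_dlat H.
have [v uv] : exists v, u = (p ^ b)%:Z *: v.
  apply: (peel (S := annih (dlat U (fun i => p ^ nth 0 [:: a; b; c] i)%N))); last exact/annih_dlat.
  move=> j v jb /annih_dlat Hv; apply: cz_Fp_dvd.
  have red (i : 'I_3) k : (j < k)%N -> nth 0%N [:: a; b; c] i = k ->
      dvall p (rd (U 0 i) (U 1 i) (U (inord 2) i) v).
    move=> jk ik; have := Hv i; rewrite ik -{1}(subnKC (ltnW jk)) expnD Rad_scale //.
    by apply: dvall_dvd; rewrite dvdn_exp // subn_gt0.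
  have l1 : l != 1 by [].
  exact: rad_no_common (unitmx_independent Uu l1) (rad_Fp (red l a (leq_trans jb ba) nl))
    (rad_Fp (red 1 b jb erefl)).
exists v; last by rewrite mul_mx_scalar.
by have := H l; rewrite nl uv -{1}(subnKC ba) expnD Rad_scale.
Qed.

End PAdic.

(** * Lattices of a given type *)

Section LatticeTypes.
Variable p : nat.
Hypothesis p_pr : prime p.

Let pg k : (0 < p ^ k)%N. Proof. by rewrite expn_gt0 prime_gt0. Qed.

Definition tdlat n (U : 'M[int]_n) (s : seq nat) : set 'rV[int]_n :=
  dlat U (fun i => p ^ nth 0 s i)%N.

(* The lattices whose quotient has elementary divisors [p ^ s`_i]. *)
Definition tlat n (s : seq nat) : set (set 'rV[int]_n) :=
  [set H | exists2 U : 'M[int]_n, U \in unitmx & H = tdlat U s].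
Arguments tlat : clear implicits.

Lemma tdlat_latidx n (U : 'M[int]_n) s : U \in unitmx -> size s = n ->
  latidx (tdlat U s) (p ^ sumn s).
Proof.
move=> Uu sn; have := dlat_idx Uu (fun i : 'I_n => pg (nth 0%N s i)).
rewrite -expn_sum; suff -> : (\sum_(i < n) nth 0 s i)%N = sumn s by [].
by rewrite sumnE (big_nth 0%N) sn big_mkord.
Qed.

Lemma tlat_plattices n s H : size s = n -> tlat n s H ->
  plattices p n H /\ latlog p H = sumn s.
Proof.
move=> sn [U Uu ->]; have h := tdlat_latidx Uu sn.
rewrite /latlog (plogE p_pr h); split=> //; split; first exact: dlat_subgroup.
by exists (sumn s).
Qed.

Lemma tlat_exponent n s H j : size s = n -> tlat n s H ->
  (forall v, H ((p ^ j)%:Z *: v)) <-> all (fun k => (k <= j)%N) s.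
Proof.
move=> sn [U Uu ->]; split=> [Hj|/(all_nthP 0%N) Hj v i]; last first.
  rewrite -scalemxAl mxE dvdz_mulr // dvdzE /= dvdn_exp2l // Hj //.
  by rewrite sn.
apply/(all_nthP 0%N) => i; rewrite sn => lt.
have := Hj (row (Ordinal lt) (invmx U)) (Ordinal lt).
rewrite -scalemxAl -row_mul mulVmx // !mxE eqxx mulr1 dvdzE /=.
by rewrite dvdn_Pexp2l // prime_gt1.
Qed.

(** Exponent and content are the largest and smallest entries of the type; together with the index
    they determine a type of length three. *)
Lemma tlat_content n s H j : size s = n -> tlat n s H ->
  (forall v, H v -> exists w, v = (p ^ j)%:Z *: w) <-> all (fun k => (j <= k)%N) s.
Proof.
move=> sn [U Uu ->]; split=> [Hj|/(all_nthP 0%N) Hj v Hv].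
  apply/(all_nthP 0%N) => i; rewrite sn => lt; pose o := Ordinal lt.
  pose v := (p ^ nth 0 s i)%:Z *: row o (invmx U).
  have vU : v *m U = (p ^ nth 0 s i)%:Z *: delta_mx 0 o.
    by rewrite -scalemxAl -row_mul mulVmx // rowE mulmx1.
  have /Hj[w vw] : tdlat U s v.
    move=> k; rewrite vU !mxE eqxx /=; case: eqP => [->|_]; last by rewrite mulr0 dvdz0.
    by rewrite mulr1.
  have : (v *m U) 0 o = (p ^ j)%:Z * (w *m U) 0 o by rewrite vw -scalemxAl mxE.
  rewrite vU !mxE !eqxx mulr1 => e.
  rewrite -(dvdn_Pexp2l _ _ (prime_gt1 p_pr)).
  by rewrite -[X in (_ %| X)%N]/`|(p ^ nth 0 s i)%:Z|%N e abszM dvdn_mulr.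
have /dvd_rowP[w vUw] : forall i, ((p ^ j)%N %| ((v *m U) 0 i)%R)%Z.
  move=> i; apply: dvdz_trans (Hv i); rewrite dvdzE /= dvdn_exp2l // Hj //.
  by rewrite sn.
by exists (w *m invmx U); rewrite scalemxAl -vUw mulmxK.
Qed.

Lemma tlat_exists n H a : subgroup_of H -> (exists N, latidx H N) ->
  (forall v : 'rV_n, H ((p ^ a)%:Z *: v)) ->
  exists s, [/\ size s = n, sorted leq s, all (fun k => (k <= a)%N) s & tlat n s H].
Proof.
move=> HH [N hN] Ha; have [U [d Uu [d0 dd Hd _]]] := lattice_smith HH hN.
pose s := mkseq (fun i => logn p (d i)) n.
have dE i : (i < n)%N -> d i = (p ^ logn p (d i))%N.
  move=> lt; have := Ha (row (Ordinal lt) (invmx U)); rewrite Hd => /(_ (Ordinal lt)).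
  rewrite -scalemxAl -row_mul mulVmx // !mxE eqxx mulr1 dvdzE /=.
  by move=> /(dvdn_pfactor _ _ p_pr)[m _ ->]; rewrite pfactorK.
have sn : size s = n by rewrite size_mkseq.
have sE i : (i < n)%N -> nth 0%N s i = logn p (d i) by move=> ?; rewrite nth_mkseq.
have HT : tlat n s H.
  exists U => //; apply/seteqP; split=> v.
    by move=> /Hd Hv i; rewrite sE // -dE //; apply: Hv.
  by move=> Hv; apply/Hd => i; have := Hv i; rewrite sE // -dE.
exists s; split=> //; last by apply/(tlat_exponent _ sn HT).
apply/(sortedP 0%N) => i; rewrite sn => lt.
rewrite !sE ?(ltnW lt) // -(dvdn_Pexp2l _ _ (prime_gt1 p_pr)) -!dE ?(ltnW lt) //.
by apply: dd; rewrite leqnSn.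
Qed.

(** Such a lattice is p^k Z^n, which no change of basis moves. *)
Lemma tlat_nseq n k H : tlat n (nseq n k) H <-> H = tdlat 1%:M (nseq n k).
Proof.
have key (U : 'M[int]_n) v : U \in unitmx -> tdlat 1%:M (nseq n k) v -> tdlat U (nseq n k) v.
  move=> Uu Hv i; rewrite nth_nseq ltn_ord mxE.
  apply: rpred_sum => j _; rewrite dvdz_mulr //.
  by have := Hv j; rewrite mulmx1 nth_nseq ltn_ord.
split=> [[U Uu ->]|->]; last by exists 1%:M; rewrite ?unitmx1.
apply/seteqP; split=> v; last exact: key.
move=> Hv i; rewrite mulmx1 nth_nseq ltn_ord -(mulmxK Uu v) mxE.
apply: rpred_sum => j _; rewrite dvdz_mulr //.
by have := Hv j; rewrite nth_nseq ltn_ord.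
Qed.

End LatticeTypes.
Arguments tlat : clear implicits.

(** * Counting dual vectors modulo p^a *)

Section Counting.
Variable p : nat.
Hypothesis p_pr : prime p.
Let pg k : (0 < p ^ k)%N. Proof. by rewrite expn_gt0 prime_gt0. Qed.

Definition box a n : finType := {ffun 'I_n -> 'I_(p ^ a).-1.+1}.
Definition bvec a n (l : box a n) : 'rV[int]_n := \row_i ((l i : nat) : int).
Definition bred a n (v : 'rV[int]_n) : box a n := [ffun i => residue (p ^ a) (v 0 i)].

Lemma bredK a n (l : box a n) : bred a (bvec l) = l.
Proof. by apply/ffunP => i; rewrite ffunE mxE residue_nat. Qed.

Lemma bred_eq a n (u v : 'rV[int]_n) :
  bred a u = bred a v <-> exists w, v - u = (p ^ a)%:Z *: w.
Proof.
rewrite -dvd_rowP; split=> [/ffunP e i|e].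
  by have := e i; rewrite !ffunE mxB_entry => /(residue_eq _ _ (pg a)).
by apply/ffunP => i; rewrite !ffunE; apply/residue_eq => //; rewrite -mxB_entry.
Qed.

Lemma bvec_bred a n (v : 'rV[int]_n) : exists w, bvec (bred a v) = v + (p ^ a)%:Z *: w.
Proof.
have /bred_eq[w e] : bred a v = bred a (bvec (bred a v)) by rewrite bredK.
by exists w; rewrite -e addrC subrK.
Qed.

Lemma dvd_bvec_bred a n r (v : 'rV[int]_n) i : (r <= a)%N ->
  ((p ^ r)%N %| ((bvec (bred a v)) 0 i)%R)%Z = ((p ^ r)%N %| (v 0 i)%R)%Z.
Proof.
move=> ra; have [w ->] := bvec_bred a v; rewrite mxD_entry rpredDr // mxE dvdz_mulr //.
by rewrite dvdzE /= dvdn_exp2l.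
Qed.

Lemma card_dvd_ord a r : (r <= a)%N ->
  #|[set x : 'I_(p ^ a).-1.+1 | (p ^ r %| x)%N]%SET| = (p ^ (a - r))%N.
Proof.
move=> ra; have lt (y : 'I_(p ^ (a - r)).-1.+1) : (p ^ r * y < (p ^ a).-1.+1)%N.
  have e : (p ^ a = p ^ r * p ^ (a - r))%N by rewrite -expnD subnKC.
  rewrite [X in (_ < X)%N]prednK // e ltn_pmul2l //.
  by have := ltn_ord y; rewrite [X in (_ < X)%N]prednK.
pose f y := Ordinal (lt y).
have -> : [set x : 'I_(p ^ a).-1.+1 | (p ^ r %| x)%N]%SET = (f @: [set: 'I_(p ^ (a - r)).-1.+1])%SET.
  apply/setP => x; rewrite inE; apply/idP/imsetP => [/dvdnP[k xk]|[y _ ->]]; last first.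
    by rewrite /= dvdn_mulr.
  have kl : (k < (p ^ (a - r)).-1.+1)%N.
    rewrite prednK // -(ltn_pmul2r (pg r)) -expnD subnK // -xk.
    by have := ltn_ord x; rewrite [X in (_ < X)%N]prednK.
  exists (Ordinal kl); first by rewrite inE.
  by apply: ord_inj; rewrite /= xk mulnC.
rewrite card_imset ?cardsT ?card_ord ?prednK // => y z /(congr1 val) /= /eqP.
by rewrite eqn_pmul2l // => /eqP /val_inj.
Qed.

(** l -> l M + t is a permutation of Z^n modulo p^a, so only the coordinatewise count remains. *)
Lemma card_box_dvd a n (M : 'M[int]_n) (t : 'rV[int]_n) (r : 'I_n -> nat) : M \in unitmx ->
  (forall i, (r i <= a)%N) ->
  #|[set l : box a n | [forall i, ((p ^ r i)%N %| ((bvec l *m M + t) 0%R i)%R)%Z]]%SET| = (\prod_i p ^ (a - r i))%N.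
Proof.
move=> Mu ra.
pose f (l : box a n) : box a n := bred a (bvec l *m M + t).
pose g (l : box a n) : box a n := bred a ((bvec l - t) *m invmx M).
have congM u v (N : 'M[int]_n) : bred a u = bred a v -> bred a (u *m N) = bred a (v *m N).
  move=> /bred_eq[w e]; apply/bred_eq; exists (w *m N).
  by rewrite -mulmxBl e scalemxAl.
have congD (u v x : 'rV[int]_n) : bred a u = bred a v -> bred a (u + x) = bred a (v + x).
  by move=> /bred_eq[w e]; apply/bred_eq; exists w; rewrite opprD addrACA subrr addr0.
have fK : cancel f g.
  move=> l; rewrite /f /g (congM _ (bvec l *m M)); first by rewrite mulmxK // bredK.
  by rewrite -[bvec l *m M in RHS](addrK t); apply: congD; rewrite bredK.
have gK : cancel g f.
  move=> l; rewrite /f /g (congD _ (bvec l - t)) ?subrK ?bredK //.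
  by rewrite -[in RHS](mulmxKV Mu (bvec l - t)); apply: congM; rewrite bredK.
pose F i : {pred 'I_(p ^ a).-1.+1} := [set x : 'I_(p ^ a).-1.+1 | (p ^ r i %| x)%N]%SET.
have -> : [set l : box a n | [forall i, ((p ^ r i)%N %| ((bvec l *m M + t) 0%R i)%R)%Z]]%SET
     = (g @: [set l in family F])%SET.
  apply/setP => l; rewrite inE; apply/forallP/imsetP => [H|[l' ]]; last first.
    rewrite inE => /familyP H -> i.
    rewrite -(dvd_bvec_bred _ _ (ra i)) -/(f (g l')) gK mxE dvdzE /=.
    by have := H i; rewrite inE.
  exists (f l); last by rewrite fK.
  rewrite inE; apply/familyP => i; rewrite inE.
  by have := H i; rewrite -(dvd_bvec_bred _ _ (ra i)) -/(f l) mxE dvdzE.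
rewrite card_imset; last exact: can_inj gK.
rewrite cardsE card_family foldrE big_map big_enum /=; apply: eq_bigr => i _.
by rewrite card_dvd_ord.
Qed.

Definition dotr n (u v : 'rV[int]_n) : int := (u *m v^T) 0 0.

Definition bprim a n (l : box a n) : bool := ~~ [forall i, (p %| ((bvec l) 0%R i)%R)%Z].

Definition dualto a n (H : set 'rV[int]_n) (l : box a n) : Prop :=
  forall w, H w -> ((p ^ a)%N %| dotr w (bvec l))%Z.

(** In the dual basis the pairing is a sum of products of coordinates; since the i-th coordinates on
    [H] generate p^(s_i) Z, duality amounts to divisibility by p^(a - s_i). *)
Lemma dualto_tdlat a n (U : 'M[int]_n) s (l : box a n) : U \in unitmx ->
  all (fun k => (k <= a)%N) s ->
  dualto (tdlat p U s) l <->
  forall i : 'I_n, ((p ^ (a - nth 0%N s i))%N %| ((bvec l *m (invmx U)^T) 0%R i)%R)%Z.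
Proof.
move=> Uu sa; have sle i : (nth 0%N s i <= a)%N.
  have [lt|ge] := ltnP i (size s); last by rewrite nth_default.
  by move/(all_nthP 0%N): sa; apply.
have pE i : (p ^ a = p ^ nth 0%N s i * p ^ (a - nth 0%N s i))%N by rewrite -expnD subnKC.
have dotE w : dotr w (bvec l) = \sum_i (w *m U) 0 i * (bvec l *m (invmx U)^T) 0 i.
  rewrite /dotr -{1}(mulmxK Uu w) -(mulmxA (w *m U)) mxE; apply: eq_bigr => i _; congr (_ * _).
  have -> : bvec l *m (invmx U)^T = (invmx U *m (bvec l)^T)^T by rewrite trmx_mul trmxK.
  by rewrite [RHS]mxE.
split=> [H i|H w Hw].
  have /H : tdlat p U s ((p ^ nth 0%N s i)%:Z *: row i (invmx U)).
    move=> j; rewrite -scalemxAl -row_mul mulVmx // !mxE; case: eqP => [->|_].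
      by rewrite mulr1.
    by rewrite mulr0 dvdz0.
  rewrite dotE (bigD1 i) //= big1 ?addr0 => [|j ji].
    rewrite -scalemxAl -row_mul mulVmx // mxE [row _ _ _ _]mxE [1%:M _ _]mxE eqxx mulr1.
    by rewrite (pE i) PoszM dvdz_mul2l // -lt0n.

  by rewrite -scalemxAl -row_mul mulVmx // mxE [row _ _ _ _]mxE [1%:M _ _]mxE eq_sym (negbTE ji) mulr0 mul0r.
rewrite dotE; apply: rpred_sum => i _.
rewrite (pE i) PoszM; apply: dvdz_mul; first exact: Hw.
exact: H.
Qed.

Definition Rset a n (H : set 'rV[int]_n) : {set box a n} :=
  [set l | bprim l && `[< dualto H l >]]%SET.

(** The dual vectors have i-th dual coordinate divisible by p^(a - s_i), and the nonprimitive ones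
    by p^max(a - s_i, 1). Counting both gives p^(s_i) and p^min(s_i, a - 1) per coordinate. *)
Lemma card_Rset a n H s : (0 < a)%N -> size s = n -> all (fun k => (k <= a)%N) s ->
  tlat p n s H ->
  (#|Rset a H| + \prod_(i < n) p ^ minn (nth 0%N s i) a.-1 = \prod_(i < n) p ^ nth 0%N s i)%N.
Proof.
move=> a0 sn sa [U Uu ->]; set M := (invmx U)^T.
have Mu : M \in unitmx by rewrite unitmx_tr unitmx_inv.
have sle i : (nth 0%N s i <= a)%N.
  have [lt|ge] := ltnP i (size s); last by rewrite nth_default.
  by move/(all_nthP 0%N): sa; apply.
pose D (r : nat -> nat) : {set box a n} :=
  [set l : box a n | [forall i : 'I_n, ((p ^ r i)%N %| ((bvec l *m M) 0%R i)%R)%Z]]%SET.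
have primE (l : box a n) : [forall i, (p %| ((bvec l) 0%R i)%R)%Z] =
    [forall i, (p %| ((bvec l *m M) 0%R i)%R)%Z].
  have key (N : 'M[int]_n) (v : 'rV[int]_n) : (forall i, (p %| (v 0%R i)%R)%Z) ->
      forall i, (p %| ((v *m N) 0%R i)%R)%Z.
    by move=> Hv i; rewrite mxE; apply: rpred_sum => j _; apply: dvdz_mulr.
  apply/forallP/forallP => [/key|/(key (invmx M))]; last by rewrite mulmxK.
  exact.
have -> : Rset a (tdlat p U s) =
    (D (fun i => a - nth 0%N s i)%N :\: D (fun i => maxn (a - nth 0%N s i) 1))%SET.
  apply/setP => l; rewrite !inE /bprim primE.
  have -> : `[< dualto (tdlat p U s) l >] =
      [forall i : 'I_n, ((p ^ (a - nth 0%N s i))%N %| ((bvec l *m M) 0%R i)%R)%Z].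
    by apply/asboolP/forallP => /(dualto_tdlat l Uu sa).
  have [/forallP Hl|] := boolP [forall i : 'I_n, ((p ^ (a - nth 0%N s i))%N %| ((bvec l *m M) 0%R i)%R)%Z];
    rewrite ?andbF ?andbT //.
  congr (~~ _); apply: eq_forallb => i; case: (posnP (a - nth 0%N s i)) => [->|r0].
    by rewrite max0n expn1.
  rewrite (maxn_idPl r0) Hl; apply: (dvdz_trans _ (Hl i)).
  by rewrite dvdzE /= dvdn_exp.
rewrite cardsD (finset.setIidPr _); last first.
  apply/fintype.subsetP => l; rewrite !inE => /forallP Hl; apply/forallP => i.
  by apply: (dvdz_trans _ (Hl i)); rewrite dvdzE /= dvdn_exp2l // leq_maxl.
have cD r : (forall i, (r i <= a)%N) -> #|D r| = (\prod_(i < n) p ^ (a - r i))%N.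
  move=> ra; rewrite -(card_box_dvd 0 Mu ra).
  by apply: eq_card => l; rewrite !inE addr0.
have DD : (#|D (fun i => maxn (a - nth 0%N s i) 1)| <= #|D (fun i => a - nth 0%N s i)%N|)%N.
  apply/subset_leq_card/fintype.subsetP => l; rewrite !inE => /forallP Hl; apply/forallP => i.
  by apply: (dvdz_trans _ (Hl i)); rewrite dvdzE /= dvdn_exp2l // leq_maxl.
have e1 : #|D (fun i => maxn (a - nth 0%N s i) 1)| = (\prod_(i < n) p ^ minn (nth 0%N s i) a.-1)%N.
  rewrite cD => [|i]; last by rewrite geq_max leq_subr.
  by apply: eq_bigr => i _; congr (_ ^ _)%N; have := sle i; clear -a0; lia.
have e2 : #|D (fun i => a - nth 0%N s i)%N| = (\prod_(i < n) p ^ nth 0%N s i)%N.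
  rewrite cD => [|i]; last exact: leq_subr.
  by apply: eq_bigr => i _; rewrite subKn.
by rewrite -e1 -e2 subnK.
Qed.

(** The case of the lattice p^a Z^n, to which every vector is dual. *)
Lemma card_bprim a n : (0 < a)%N ->
  (#|[set l : box a n | bprim l]%SET| + p ^ (n * a.-1) = p ^ (n * a))%N.
Proof.
move=> a0; pose H := tdlat p (1%:M : 'M[int]_n) (nseq n a).
have HT : tlat p n (nseq n a) H by exists 1%:M; rewrite ?unitmx1.
have := card_Rset a0 (size_nseq n a) _ HT; rewrite all_nseq leqnn orbT => /(_ isT).
have -> : Rset a H = [set l : box a n | bprim l]%SET.
  apply/setP => l; rewrite !inE; case: (bprim l) => //=; apply/asboolP.
  apply/(dualto_tdlat l (unitmx1 _ n)); first by rewrite all_nseq leqnn orbT.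
  by move=> i; rewrite nth_nseq ltn_ord subnn expn0 dvd1z.
have pr k : (\prod_(i < n) p ^ k = p ^ (n * k))%N.
  by rewrite prod_nat_const card_ord -expnM mulnC.
rewrite -!pr; under [X in (_ + X)%N = _ -> _]eq_bigr => i _ do
  rewrite nth_nseq ltn_ord (minn_idPr (leq_pred a)).
by under [X in _ = X -> _]eq_bigr => i _ do rewrite nth_nseq ltn_ord.
Qed.

Lemma tlat_rev n s : size s = n -> tlat p n s = tlat p n (rev s).
Proof.
have sub t : size t = n -> tlat p n t `<=` tlat p n (rev t).
  move=> tn H [U Uu ->]; pose r := perm (@rev_ord_inj n).
  exists (col_perm r U); first by rewrite col_permE unitmx_mul Uu unitmx_perm.
  apply/seteqP; split=> v Hv i.
    rewrite col_permE mulmxA -col_permE mxE permE nth_rev ?tn //.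
  have := Hv (rev_ord i); rewrite col_permE mulmxA -col_permE mxE permE rev_ordK.
  rewrite nth_rev tn; last exact: ltn_ord.
  by have -> : (n - (rev_ord i).+1 = i)%N by have := ltn_ord i; rewrite /=; lia.
move=> sn; apply/seteqP; split; first exact: sub.
by rewrite -{2}(revK s); apply: sub; rewrite size_rev.
Qed.

End Counting.

(** * Pairs of a lattice and a primitive dual vector *)

Section DoubleCounting.
Variable p : nat.
Hypothesis p_pr : prime p.
Let pg k : (0 < p ^ k)%N. Proof. by rewrite expn_gt0 prime_gt0. Qed.

(** A lattice of type [s] contains p^a Z^n with a = [sumn s], so it is determined by its reduction
    modulo p^a. *)
Lemma tlat_finite n s : size s = n -> finite_set (tlat p n s).
Proof.
move=> sn; pose a := sumn s.
have sa : all (fun k => (k <= a)%N) s.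
  rewrite /a; elim: s {sn a} => //= x s IH; rewrite leq_addr.
  by apply: sub_all IH => k ks; rewrite (leq_trans ks) // leq_addl.
pose g (S : {set box p a n}) : set 'rV[int]_n := [set v | bred p a v \in S].
apply: (@sub_finite_set _ _ (g @` setT)); last exact: finite_image.
move=> H HT; have [[HH _] _] := tlat_plattices p_pr sn HT.
have Ha := (tlat_exponent p_pr a sn HT).2 sa.
exists [set l | `[< H (bvec l) >]]%SET => //; rewrite /g.
apply/seteqP; split=> v /=; have [w e] := bvec_bred p_pr a v; rewrite inE e.
  move=> /asboolP Hv; rewrite -[v](addrK ((p ^ a)%:Z *: w)).
  by apply: HH.2 => //; apply: Ha.
by move=> Hv; apply/asboolP; apply: subgroup_ofD => //; apply: Ha.
Qed.

Variables (n a : nat).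

(** The Smith form of the one-row matrix [bvec l] writes it as g times the first row of a unimodular
    [Q]; primitivity makes g prime to p. *)
Lemma prim_column (l : box p a (1 + n)) : bprim l ->
  exists W : 'M[int]_(1 + n), exists2 g : int, W \in unitmx /\ ~~ (p %| g)%Z &
   forall w, dotr w (bvec l) = g * (w *m W) 0 0.
Proof.
move=> prim; have [L Lu [Q Qu [d _ lE]]] := int_Smith_normal_form (bvec l).
set D := (\matrix_(_, _) _) in lE.
pose g := L 0 0 * d`_0.
have lQ : bvec l = g *: row 0 Q.
  rewrite lE; apply/rowP => j; rewrite mxE (bigD1 (0 : 'I_(1 + n))) //= big1 ?addr0.
    rewrite !mxE big_ord1 !mxE eqxx mulr1n //.
  move=> k k0; rewrite mxE big_ord1 [D _ _]mxE.
  rewrite (_ : (_ == _) = false) ?mulr0n ?mulr0 ?mul0r //.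
  by apply: contraNF k0 => /eqP k0; apply/eqP/val_inj.
exists Q^T, g.
  rewrite unitmx_tr; split=> //; apply: contra prim => pgg; apply/forallP => i.
  by rewrite lQ mxE dvdz_mulr.
move=> w; rewrite /dotr lQ linearZ /= -scalemxAr mxE; congr (_ * _).
by rewrite [LHS]mxE [RHS]mxE; apply: eq_bigr => j _; rewrite !mxE.
Qed.

(** The direct sum of p^a Z and [L] in the coordinates given by [W]. *)
Definition ext_lat (W : 'M[int]_(1 + n)) (L : set 'rV[int]_n) : set 'rV[int]_(1 + n) :=
  [set w : 'rV_(1 + n) | ((p ^ a)%N %| ((w *m W) 0 0)%R)%Z /\ L (rsubmx (w *m W))].

Lemma lsubmx00 (v : 'rV[int]_(1 + n)) : lsubmx v 0 0 = v 0 0.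
Proof. by rewrite mxE; congr (v _ _); apply: val_inj. Qed.

Lemma row_mx00 (x : 'rV[int]_1) (y : 'rV[int]_n) : row_mx x y 0 0 = x 0 0.
Proof. by rewrite -lsubmx00 row_mxKl. Qed.

Lemma ext_lat_dlat (W : 'M[int]_(1 + n)) (U : 'M[int]_n) s :
  ext_lat W (tdlat p U s) = tdlat p (W *m block_mx (1%:M : 'M_1) 0 0 U) (a :: s).
Proof.
have E (v : 'rV[int]_(1 + n)) : v *m (W *m block_mx (1%:M : 'M_1) 0 0 U) =
    row_mx (lsubmx (v *m W)) (rsubmx (v *m W) *m U).
  by rewrite mulmxA -[v *m W]hsubmxK mul_row_block !mulmx0 mulmx1 addr0 add0r row_mxKl row_mxKr.
apply/seteqP; split=> v.
  move=> [h0 H] i; rewrite E; case: (splitP i) => j ij.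
    have -> : i = lshift n j by apply: val_inj.
    by rewrite row_mxEl (ord1 j) lsubmx00.
  have -> : i = rshift 1 j by apply: val_inj.
  by rewrite row_mxEr; apply: H.
move=> H; split=> [|j].
  by have := H (lshift n 0); rewrite E row_mxEl lsubmx00.
by have := H (rshift 1 j); rewrite E row_mxEr.
Qed.

Lemma ext_unitmx (W : 'M[int]_(1 + n)) (U : 'M[int]_n) : W \in unitmx -> U \in unitmx ->
  W *m block_mx (1%:M : 'M_1) 0 0 U \in unitmx.
Proof.
by move=> Wu Uu; rewrite unitmx_mul Wu unitmxE det_ublock det1 mul1r -unitmxE.
Qed.

Lemma ext_lat_tlat W L s : W \in unitmx -> tlat p n s L ->
  tlat p (1 + n) (a :: s) (ext_lat W L).
Proof.
move=> Wu [U Uu ->]; exists (W *m block_mx (1%:M : 'M_1) 0 0 U); last exact: ext_lat_dlat.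
exact: ext_unitmx.
Qed.

Lemma ext_lat_inj W : W \in unitmx -> injective (ext_lat W).
Proof.
move=> Wu L L' e; apply/seteqP; split=> x Lx.
  have : ext_lat W L (row_mx 0 x *m invmx W).
    by split; rewrite mulmxKV // ?row_mxKr // row_mx00 mxE dvdz0.
  by rewrite e => -[_]; rewrite mulmxKV // row_mxKr.
have : ext_lat W L' (row_mx 0 x *m invmx W).
  by split; rewrite mulmxKV // ?row_mxKr // row_mx00 mxE dvdz0.
by rewrite -e => -[_]; rewrite mulmxKV // row_mxKr.
Qed.

(** Since [H] contains p^a Z^(1 + n) and its first coordinates are divisible by p^a, the first
    coordinate can be subtracted inside [H], which splits. *)
Lemma ext_lat_surj W H s : W \in unitmx -> size s = n -> all (fun k => (k <= a)%N) s ->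
  tlat p (1 + n) (a :: s) H ->
  (forall w, H w -> ((p ^ a)%N %| ((w *m W) 0%R 0%R)%R)%Z) ->
  exists s' L, [/\ size s' = n, sorted leq s', all (fun k => (k <= a)%N) s',
    tlat p n s' L & H = ext_lat W L].
Proof.
move=> Wu sn sa HT Hd.
have asn : size (a :: s) = (1 + n)%N by rewrite /= sn.
have [[HH [N hN]] _] := tlat_plattices p_pr asn HT.
have Ha : forall v : 'rV_(1 + n), H ((p ^ a)%:Z *: v).
  by apply/(tlat_exponent p_pr a asn HT); rewrite /= leqnn.
pose f (x : 'rV[int]_n) : 'rV[int]_(1 + n) := row_mx 0 x *m invmx W.
have fB x y : f (x - y) = f x - f y.
  by rewrite /f -mulmxBl opp_row_mx add_row_mx subrr.
have fZ z x : f (z *: x) = z *: f x.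
  by rewrite /f scalemxAl scale_row_mx scaler0.
pose L := [set x | H (f x)].
have LS : subgroup_of L.
  split=> [|x y Hx Hy]; last by rewrite /L /= fB; apply: HH.2.
  by rewrite /L /= /f row_mx0 mul0mx; apply: HH.1.
have Lidx : exists N, latidx L N.
  have [c cs cR] := hN; apply: (has_index_exists (c := fun x => c (f x))).
  - by move=> x; rewrite subrr; apply: LS.1.
  - by move=> x y /(subgroup_ofN LS); rewrite opprB.
  - by move=> x y z Lxy Lyz; have := subgroup_ofD LS Lyz Lxy; rewrite addrA subrK.
  - by move=> x y /cR; rewrite /L /= fB.
have La v : L ((p ^ a)%:Z *: v) by rewrite /L /= fZ; apply: Ha.
have [s' [s'n s's s'a LT]] := tlat_exists p_pr LS Lidx La.
have key w : ((p ^ a)%N %| ((w *m W) 0 0)%R)%Z -> (H w <-> L (rsubmx (w *m W))).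
  move=> hw; pose g := row_mx (lsubmx (w *m W)) 0 *m invmx W.
  have wE : w = g + f (rsubmx (w *m W)).
    by rewrite /g /f -mulmxDl add_row_mx addr0 add0r hsubmxK mulmxK.
  have Hg : H g.
    have /dvd_rowP[t tE] : forall i, ((p ^ a)%N %| ((lsubmx (w *m W)) 0%R i)%R)%Z.
      by move=> i; rewrite (ord1 i) lsubmx00.
    have -> : g = (p ^ a)%:Z *: (row_mx t 0 *m invmx W).
      by rewrite scalemxAl scale_row_mx -tE scaler0.
    exact: Ha.
  rewrite /L /mkset; split=> [Hw|Hf]; last by rewrite wE; apply: subgroup_ofD.
  have -> : f (rsubmx (w *m W)) = w - g by rewrite {2}wE addrAC subrr add0r.
  exact: HH.2.
exists s', L; split=> //; apply/seteqP; split=> w.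
  by move=> Hw; have dw := Hd w Hw; split=> //; apply/(key w dw).
by move=> [dw Lw]; apply/(key w dw).
Qed.

Variable s : seq nat.
Hypotheses (sn : size s = n) (sa : all (fun k => (k <= a)%N) s).
(** The complement found by [ext_lat_surj] has its type sorted upwards, while the types in use are
    sorted downwards; hence an equality of sets of lattices and not of lists. *)
Hypothesis s_uniq : forall s' H, size s' = n -> sorted leq s' ->
  all (fun k => (k <= a)%N) s' -> tlat p (1 + n) (a :: s) H -> tlat p (1 + n) (a :: s') H ->
  tlat p n s' = tlat p n s.

Let T := fset_set (tlat p (1 + n) (a :: s)).
Let T0 := fset_set (tlat p n s).

Lemma mem_fset_tlat k t H : size t = k -> (H \in fset_set (tlat p k t)) <-> tlat p k t H.
Proof.
move=> tk; rewrite in_fset_set; last exact: tlat_finite.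
by split=> [/set_mem|/mem_set].
Qed.

(** [ext_lat] identifies the lattices of type [a :: s] to which [l] is dual with the lattices of
    type [s] in one dimension less; the number does not depend on [l]. *)
Lemma card_containing (l : box p a (1 + n)) : bprim l ->
  \sum_(H <- T | l \in Rset p a H) 1%N = #|` T0|%fset.
Proof.
move=> prim; have [W [g [Wu pgg] dE]] := prim_column prim.
have asn : size (a :: s) = (1 + n)%N by rewrite /= sn.
have RE H : (l \in Rset p a H) <-> forall w, H w -> ((p ^ a)%N %| ((w *m W) 0%R 0%R)%R)%Z.
  rewrite inE prim /=; split=> [/asboolP Hd w /Hd|Hd].
    by rewrite dE dvdz_unitl.
  by apply/asboolP => w /Hd; rewrite dE dvdz_unitl.
have -> : \sum_(H <- T | l \in Rset p a H) 1%N = \sum_(H <- (ext_lat W @` T0)%fset) 1%N.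
  rewrite big_fset_condE; apply: eq_fbigl => H; rewrite !inE /=.
  apply/andP/imfsetP => [[/(mem_fset_tlat _ asn) HT lR]|[L /(mem_fset_tlat _ sn) LT ->]].
    have lR' : l \in Rset p a H by rewrite inE.
    have Hd := (RE H).1 lR'.
    have [s' [L [s'n s's s'a LT HE]]] := ext_lat_surj Wu sn sa HT Hd.
    exists L => //=; apply/mem_fset_tlat => //; rewrite -(s_uniq s'n s's s'a HT) //.
    by rewrite HE; apply: ext_lat_tlat.
  split; first by apply/(mem_fset_tlat _ asn); apply: ext_lat_tlat.
  have : l \in Rset p a (ext_lat W L) by apply: (RE _).2 => w [].
  by rewrite inE.
by rewrite big_imfset /=; [rewrite sum1_size | move=> x y _ _; apply: ext_lat_inj].
Qed.

Lemma double_count (C : numFieldType) (F : set 'rV[int]_(1 + n) -> C) (G : box p a (1 + n) -> C) (r : nat) :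
  (forall H, tlat p (1 + n) (a :: s) H -> #|Rset p a H| = r) ->
  (forall H l, tlat p (1 + n) (a :: s) H -> l \in Rset p a H -> F H = G l) ->
  (\sum_(H <- T) F H) * r%:R = (\sum_(l | bprim l) G l) * (#|` T0|%fset)%:R.
Proof.
move=> Rr FG; have asn : size (a :: s) = (1 + n)%N by rewrite /= sn.
have -> : (\sum_(H <- T) F H) * r%:R = \sum_(H <- T) \sum_(l | bprim l && (l \in Rset p a H)) G l.
  rewrite mulr_suml [LHS]big_seq [RHS]big_seq; apply: eq_bigr => H /(mem_fset_tlat _ asn) HT.
  rewrite -(Rr H HT) mulr_natr -sumr_const.
  have -> : \sum_(l in Rset p a H) F H = \sum_(l in Rset p a H) G l.
    by apply: eq_bigr => l lR; apply: FG.
  by apply: eq_bigl => l; rewrite inE andbA andbb.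
rewrite (exchange_big_dep (fun l => bprim l)) /=; last by move=> H l _ /andP[].
rewrite mulr_suml; apply: eq_bigr => l prim.
rewrite -(card_containing prim) natr_sum mulr_sumr; apply: eq_big => [H|H _].
  by rewrite prim.
by rewrite mulr1.
Qed.

End DoubleCounting.

(** * Zeros of the cubic modulo prime powers *)

Section Gradient.
Variable R : comNzRingType.
Variables A1 A2 A3 A4 A6 : R.
Local Notation P := (cubic A1 A2 A3 A4 A6).

Definition grad1 (x y z : R) : R := A1 * y * z - 3 * x ^+ 2 - 2 * A2 * x * z - A4 * z ^+ 2.
Definition grad2 (x y z : R) : R := 2 * y * z + A1 * x * z + A3 * z ^+ 2.
Definition grad3 (x y z : R) : R :=
  y ^+ 2 + A1 * x * y + 2 * A3 * y * z - A2 * x ^+ 2 - 2 * A4 * x * z - 3 * A6 * z ^+ 2.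

(** For a cubic form, the quadratic term at v in direction w is the linear term at w in direction
    v. *)
Lemma cubic_taylor c x y z X Y Z :
  P (x + c * X) (y + c * Y) (z + c * Z) =
  P x y z + c * (grad1 x y z * X + grad2 x y z * Y + grad3 x y z * Z)
  + c ^+ 2 * (grad1 X Y Z * x + grad2 X Y Z * y + grad3 X Y Z * z) + c ^+ 3 * P X Y Z.
Proof. by rewrite /cubic /grad1 /grad2 /grad3; ring. Qed.

Lemma cubicM t x y z : P (t * x) (t * y) (t * z) = t ^+ 3 * P x y z.
Proof. by rewrite /cubic; ring. Qed.

End Gradient.

(* Translating a singular point to the origin makes a3 = a4 = a6 = 0, and then
   the discriminant vanishes. *)
Lemma smooth_gradient (F : fieldType) (A1 A2 A3 A4 A6 x y z : F) :
  discriminant (Weierstrass A1 A2 A3 A4 A6) != 0 ->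
  cubic A1 A2 A3 A4 A6 x y z = 0 -> grad1 A1 A2 A4 x y z = 0 ->
  grad2 A1 A3 x y z = 0 -> grad3 A1 A2 A3 A4 A6 x y z = 0 ->
  [/\ x = 0, y = 0 & z = 0].
Proof.
move=> D P0 G1 G2 G3; have [z0|zn0] := eqVneq z 0.
  subst z; have x0 : x = 0.
    have /eqP : x ^+ 3 = 0 by rewrite -[RHS]oppr0 -[in RHS]P0 /cubic; ring.
    by rewrite expf_eq0 => /eqP.
  subst x; split=> //; have /eqP : y ^+ 2 = 0 by rewrite -[RHS]G3 /grad3; ring.
  by rewrite expf_eq0 => /eqP.
exfalso; pose x0 := x / z; pose y0 := y / z.
have xE : x = x0 * z by rewrite /x0 mulfVK.
have yE : y = y0 * z by rewrite /y0 mulfVK.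
pose B3 := A3 + A1 * x0 + 2 * y0.
pose B4 := A4 + 2 * A2 * x0 + 3 * x0 ^+ 2 - A1 * y0.
pose B6 := A6 + x0 * A4 + x0 ^+ 2 * A2 + x0 ^+ 3 - y0 * A3 - y0 ^+ 2 - A1 * x0 * y0.
have b3 : B3 = 0.
  apply: (mulfI (expf_neq0 2 zn0)); rewrite mulr0 -[RHS]G2 /grad2 /B3 xE yE; ring.
have b4 : B4 = 0.
  apply: (mulfI (expf_neq0 2 zn0)); rewrite mulr0 -[RHS]oppr0 -[in RHS]G1 /grad1 /B4 xE yE; ring.
have b6 : B6 = 0.
  apply: (mulfI (expf_neq0 3 zn0)); rewrite mulr0 -[RHS]oppr0 -[in RHS]P0 /cubic /B6 xE yE; ring.
move/eqP: D; apply.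
have -> : discriminant (Weierstrass A1 A2 A3 A4 A6) =
  discriminant (Weierstrass A1 (A2 + 3 * x0) B3 B4 B6).
  by rewrite /discriminant /B3 /B4 /B6; ring.
by rewrite b3 b4 b6 /discriminant; ring.
Qed.

(** * Hensel lifting and the points of the curve *)

Section Hensel.
Variable p : nat.
Hypothesis p_pr : prime p.
Let pg k : (0 < p ^ k)%N. Proof. by rewrite expn_gt0 prime_gt0. Qed.

Variables A1 A2 A3 A4 A6 : int.
Local Notation P := (cubic A1 A2 A3 A4 A6).

Definition P3 (v : 'rV[int]_3) : int := P (v 0 0) (v 0 1) (v 0 (inord 2)).
Definition grad (v : 'rV[int]_3) : 'rV[int]_3 :=
  row3 (grad1 A1 A2 A4 (v 0 0) (v 0 1) (v 0 (inord 2))) (grad2 A1 A3 (v 0 0) (v 0 1) (v 0 (inord 2)))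
    (grad3 A1 A2 A3 A4 A6 (v 0 0) (v 0 1) (v 0 (inord 2))).

Lemma dotr3 (u v : 'rV[int]_3) :
  dotr u v = u 0 0 * v 0 0 + u 0 1 * v 0 1 + u 0 (inord 2) * v 0 (inord 2).
Proof.
rewrite /dotr mxE !big_ord_recl big_ord0 addr0 addrA !mxE.
have -> : lift ord0 ord0 = 1 :> 'I_3 by apply: val_inj.
by have -> : lift ord0 (lift ord0 ord0) = inord 2 :> 'I_3 by apply: val_inj; rewrite /= inordK.
Qed.

Lemma P3_taylor c v w : exists t, P3 (v + c *: w) = P3 v + c * dotr w (grad v) + c ^+ 2 * t.
Proof.
exists ((grad1 A1 A2 A4 (w 0 0) (w 0 1) (w 0 (inord 2)) * v 0 0
  + grad2 A1 A3 (w 0 0) (w 0 1) (w 0 (inord 2)) * v 0 1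
  + grad3 A1 A2 A3 A4 A6 (w 0 0) (w 0 1) (w 0 (inord 2)) * v 0 (inord 2)) + c * P3 w).
rewrite /P3 dotr3 /grad !row3E !(mxD_entry, mxE).
rewrite cubic_taylor; ring.
Qed.

Lemma P3_cong (d : nat) v w : (d %| P3 (v + d%:Z *: w))%Z = (d %| P3 v)%Z.
Proof.
have [t ->] := P3_taylor d v w.
by rewrite -addrA rpredDr // rpredD // ?exprS -?mulrA dvdz_mulr.
Qed.

Definition lift_box a (l : box p a 3) (d : box p 1 3) : box p a.+1 3 :=
  bred p a.+1 (bvec l + (p ^ a)%:Z *: bvec d).
Definition reduce_box a (l : box p a.+1 3) : box p a 3 := bred p a (bvec l).

Lemma reduce_lift a l d : reduce_box (@lift_box a l d) = l.
Proof.
rewrite /reduce_box /lift_box -[RHS](bredK p_pr); apply/(bred_eq p_pr).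
have [w ->] := bvec_bred p_pr a.+1 (bvec l + (p ^ a)%:Z *: bvec d).
exists (- bvec d - p%:Z *: w).
rewrite scalerBr scalerN scalerA -PoszM -expnSr.
by apply/rowP => i; rewrite !mxE; ring.
Qed.

Lemma lift_inj a (l : box p a 3) : injective (lift_box l).
Proof.
move=> d d' /(bred_eq p_pr)[w e]; rewrite -(bredK p_pr d) -(bredK p_pr d'); apply/(bred_eq p_pr).
exists w; apply: (@scalez_inj _ (p ^ a)%:Z); first by rewrite -lt0n.
by rewrite scalerA expn1 -PoszM -expnSr -e; apply/rowP => i; rewrite !mxE; ring.
Qed.

Lemma lift_surj a (l' : box p a.+1 3) : exists d, l' = lift_box (reduce_box l') d.
Proof.
have [w e] := bvec_bred p_pr a (bvec l'); exists (bred p 1 (- w)).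
rewrite /lift_box -{1}(bredK p_pr l'); apply/(bred_eq p_pr).
have [w' ->] := bvec_bred p_pr 1 (- w); rewrite e expn1.
exists w'; rewrite expnSr PoszM -scalerA.
by apply/rowP => i; rewrite !mxE; ring.
Qed.

Lemma lift_prim a l d : (0 < a)%N -> bprim (@lift_box a l d) = bprim l.
Proof.
move=> a0; congr (~~ _); apply: eq_forallb => i.
have := dvd_bvec_bred p_pr (bvec l + (p ^ a)%:Z *: bvec d) i (isT : 1 <= a.+1)%N.
rewrite expn1 => ->; rewrite mxD_entry rpredDr // mxE dvdz_mulr //.
by rewrite dvdzE /= -[X in (X %| _)%N]expn1 dvdn_exp2l.
Qed.

Lemma lift_P3 a l d i : (i <= a.+1)%N -> ((p ^ i)%N %| P3 (bvec (@lift_box a l d)))%Z =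
  ((p ^ i)%N %| P3 (bvec l + (p ^ a)%:Z *: bvec d))%Z.
Proof.
move=> ia; have [w ->] := bvec_bred p_pr a.+1 (bvec l + (p ^ a)%:Z *: bvec d).
have -> : (p ^ a.+1)%:Z *: w = (p ^ i)%:Z *: ((p ^ (a.+1 - i))%:Z *: w).
  by rewrite scalerA -PoszM -expnD subnKC.
exact: P3_cong.
Qed.

Definition Acount a i : nat :=
  #|[set l : box p a 3 | bprim l && ((p ^ i)%N %| P3 (bvec l))%Z]%SET|.

Lemma card_lift a (Q : pred (box p a.+1 3)) :
  #|[set l' | Q l']%SET| = (\sum_(l : box p a 3) #|[set d : box p 1 3 | Q (lift_box l d)]%SET|)%N.
Proof.
rewrite -sum1_card (partition_big (@reduce_box a) predT) //=.
apply: eq_bigr => l _; rewrite -(card_imset _ (@lift_inj a l)) -sum1_card.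
apply: eq_bigl => l'; rewrite !inE; apply/andP/imsetP => [[Ql /eqP e]|[d]].
  by have [d l'E] := lift_surj l'; exists d; rewrite ?inE -e -l'E.
by rewrite inE => Qd ->; rewrite reduce_lift.
Qed.

Lemma card_box1 : #|{: box p 1 3}| = (p ^ 3)%N.
Proof. by rewrite card_ffun !card_ord expn1 prednK // prime_gt0. Qed.

(** For i <= a the condition only depends on the reduction modulo p^a, and all p^3 lifts inherit
    it. *)
Lemma Acount_lift a i : (0 < a)%N -> (i <= a)%N -> Acount a.+1 i = (p ^ 3 * Acount a i)%N.
Proof.
move=> a0 ia; rewrite /Acount card_lift.
rewrite mulnC -sum_nat_const [RHS]big_mkcond /=; apply: eq_bigr => l _.
rewrite inE; have Pi d : ((p ^ i)%N %| P3 (bvec (lift_box l d)))%Z = ((p ^ i)%N %| P3 (bvec l))%Z.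
  rewrite lift_P3; last exact: leqW.
  have -> : (p ^ a)%:Z *: bvec d = (p ^ i)%:Z *: ((p ^ (a - i))%:Z *: bvec d).
    by rewrite scalerA -PoszM -expnD subnKC.
  exact: P3_cong.
case: ifPn => H.
  by rewrite -card_box1 -cardsT; apply: eq_card => d; rewrite !inE lift_prim // Pi H.
by apply: eq_card0 => d; rewrite !inE lift_prim // Pi (negbTE H).
Qed.

(** Completing g to a basis modulo p turns the affine equation into a condition on a single
    coordinate. *)
Lemma card_affine (c : int) (g : 'rV[int]_3) : ~~ [forall i, (p %| (g 0%R i)%R)%Z] ->
  #|[set d : box p 1 3 | (p %| c + dotr (bvec d) g)%Z]%SET| = (p ^ 2)%N.
Proof.
move=> gprim; pose l : box p 1 3 := bred p 1 g.
have lprim : bprim l.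
  apply: contra gprim => /forallP H; apply/forallP => i.
  by have := H i; have := dvd_bvec_bred p_pr g i (leqnn 1); rewrite expn1 => ->.
have [W [g0 [Wu pg0] dE]] := prim_column (n := 2) lprim.
have [g0' gg] := unit_mod_pe p_pr 1 pg0; rewrite expn1 in gg.
(* The shift absorbs the constant [c] into the first coordinate, divided by the unit [g0] modulo
   p. *)
pose t := row3 (c * g0') 0 0; pose r (i : 'I_3) : nat := (i == 0).
have -> : (p ^ 2 = \prod_(i < 3) p ^ (1 - r i))%N.
  by rewrite !big_ord_recl big_ord0 /r /=; ring.
rewrite -(card_box_dvd p_pr t Wu (a := 1)); last by move=> i; rewrite leq_b1.
apply: eq_card => d; rewrite !inE.
have [w lw] := bvec_bred p_pr 1 g; rewrite expn1 in lw.
have gE : g = bvec l - p%:Z *: w by rewrite lw addrK.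
have -> : c + dotr (bvec d) g = g0 * ((bvec d *m W) 0 0 + c * g0')
    - p%:Z * dotr (bvec d) w - c * (g0 * g0' - 1).
  have -> : dotr (bvec d) g = dotr (bvec d) (bvec l) - p%:Z * dotr (bvec d) w.
    by rewrite gE !dotr3 !mxE; ring.
  by rewrite dE; ring.
rewrite rpredBr; last by rewrite dvdz_mull.
rewrite rpredBr; last by rewrite dvdz_mulr.
rewrite pdvdz_unitl //.
have tE : (bvec d *m W) 0 0 + c * g0' = (bvec d *m W + t) 0 0 by rewrite mxD_entry /t row3E.
rewrite tE; apply/idP/forallP => [H i|/(_ 0)]; last by rewrite /r eqxx expn1.
by rewrite /r; case: eqP => [->|_]; rewrite ?expn1 ?expn0 ?dvd1z.
Qed.

Hypothesis smooth : discriminant (Weierstrass (A1%:~R : 'F_p) A2%:~R A3%:~R A4%:~R A6%:~R) != 0.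

Lemma grad_prim a (l : box p a 3) : (0 < a)%N -> bprim l -> (p %| P3 (bvec l))%Z ->
  ~~ [forall i, (p %| ((grad (bvec l)) 0%R i)%R)%Z].
Proof.
move=> a0 prim pP; apply/negP => /forallP H; move/negP: prim; apply; apply/forallP => i.
pose f (z : int) : 'F_p := z%:~R; set v := bvec l.
have f0 z : (p %| z)%Z -> f z = 0.
  by rewrite (dvdz_pcharf (pchar_Fp p_pr)) => /eqP.
have e0 : cubic (f A1) (f A2) (f A3) (f A4) (f A6) (f (v 0 0)) (f (v 0 1)) (f (v 0 (inord 2))) = 0.
  by rewrite -(f0 _ pP) /f /P3 /cubic; ring.
have e1 : grad1 (f A1) (f A2) (f A4) (f (v 0 0)) (f (v 0 1)) (f (v 0 (inord 2))) = 0.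
  by rewrite -(f0 _ (H 0)) /f /grad row3E /grad1; ring.
have e2 : grad2 (f A1) (f A3) (f (v 0 0)) (f (v 0 1)) (f (v 0 (inord 2))) = 0.
  by rewrite -(f0 _ (H 1)) /f /grad row3E /grad2; ring.
have e3 : grad3 (f A1) (f A2) (f A3) (f A4) (f A6) (f (v 0 0)) (f (v 0 1)) (f (v 0 (inord 2))) = 0.
  by rewrite -(f0 _ (H (inord 2))) /f /grad row3E /grad3; ring.
have [x0 y0 z0] := smooth_gradient smooth e0 e1 e2 e3.
rewrite (dvdz_pcharf (pchar_Fp p_pr)); apply/eqP; rewrite -/(f _).
case: i => [[|[|[|i]]] lt] //.
- by rewrite (_ : Ordinal lt = 0) //; apply: val_inj.
- by rewrite (_ : Ordinal lt = 1) //; apply: val_inj.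
- by rewrite (_ : Ordinal lt = inord 2) //; apply: val_inj; rewrite /= inordK.
Qed.

(** Hensel step: if P(l) = c p^a, then p^(a + 1) divides P(l + p^a d) exactly when c + d . grad(l)
    vanishes modulo p, an affine equation with nonzero linear part by smoothness. *)
Lemma Acount_top a : (0 < a)%N -> Acount a.+1 a.+1 = (p ^ 2 * Acount a a)%N.
Proof.
move=> a0; rewrite /Acount card_lift.
rewrite mulnC -sum_nat_const [RHS]big_mkcond /=; apply: eq_bigr => l _.
rewrite inE; case: ifPn => [/andP[prim /dvdzP[c Pc]]|H]; last first.
  apply: eq_card0 => d; rewrite !inE lift_prim //; apply: contraNF H => /andP[-> H] /=.
  have : ((p ^ a)%N %| P3 (bvec (lift_box l d)))%Z.
    by apply: dvdz_trans H; rewrite dvdzE /= dvdn_exp2l.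
  by rewrite lift_P3 // P3_cong.
have pP : (p %| P3 (bvec l))%Z.
  by rewrite Pc dvdz_mull // dvdzE /= -[X in (X %| _)%N]expn1 dvdn_exp2l.
rewrite -(card_affine c (grad_prim a0 prim pP)); apply: eq_card => d; rewrite !inE.
rewrite lift_prim // prim /= lift_P3 //.
have [t ->] := P3_taylor (p ^ a)%:Z (bvec l) (bvec d); rewrite Pc.
have -> : c * (p ^ a)%N + (p ^ a)%:Z * dotr (bvec d) (grad (bvec l)) + (p ^ a)%:Z ^+ 2 * t
   = (p ^ a)%:Z * (c + dotr (bvec d) (grad (bvec l)) + (p ^ a)%:Z * t) by ring.
rewrite expnSr PoszM dvdz_mul2l -?lt0n // rpredDr // dvdz_mulr //.
by rewrite dvdzE /= -[X in (X %| _)%N]expn1 dvdn_exp2l.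
Qed.

Lemma Acount0 a : (0 < a)%N -> (Acount a 0 + p ^ (3 * a.-1) = p ^ (3 * a))%N.
Proof.
move=> a0; rewrite -(card_bprim p_pr 3 a0); congr (_ + _)%N.
by apply: eq_card => l; rewrite !inE expn0 dvd1z andbT.
Qed.

(** Climb from (1, 1) to (i, i) with a factor p^2 at each step, then from (i, i) to (a, i) with a
    factor p^3. *)
Lemma AcountE a i : (0 < i <= a)%N -> Acount a i = (p ^ (3 * (a - i) + 2 * i.-1) * Acount 1 1)%N.
Proof.
move=> /andP[i0 ia].
have top j : Acount j.+1 j.+1 = (p ^ (2 * j) * Acount 1 1)%N.
  elim: j => [|j IH]; first by rewrite muln0 mul1n.
  by rewrite Acount_top // IH mulnA -expnD; congr (_ ^ _ * _)%N; lia.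
have up j : Acount (i + j) i = (p ^ (3 * j) * Acount i i)%N.
  elim: j => [|j IH]; first by rewrite addn0 muln0 mul1n.
  rewrite addnS Acount_lift ?IH ?leq_addr ?addn_gt0 ?i0 //.
  by rewrite mulnA -expnD; congr (_ ^ _ * _)%N; lia.
rewrite -{1}(subnKC ia) up -{2 3}(prednK i0) top mulnA -expnD; congr (_ ^ _ * _)%N; lia.
Qed.

(** Abel summation: q^m is 1 plus the increments q^(i + 1) - q^i for i < m, and i < m says that p^(i
    + 1) divides the value. *)
Lemma sum_mval (C : numFieldType) (q : C) a e : (e <= a)%N ->
  \sum_(l : box p a 3 | bprim l) q ^+ mval p e (P3 (bvec l)) =
  (Acount a 0)%:R + \sum_(i < e) (Acount a i.+1)%:R * (q ^+ i.+1 - q ^+ i).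
Proof.
move=> ea.
have tele m : (m <= e)%N -> q ^+ m = 1 + \sum_(i < e | (i < m)%N) (q ^+ i.+1 - q ^+ i).
  move=> me; rewrite -(big_mkord (fun i => (i < m)%N) (fun i => q ^+ i.+1 - q ^+ i)).
  rewrite (big_cat_nat (leq0n m) me) /= [X in _ + (_ + X)]big1_seq ?addr0; last first.
    by move=> i /andP[im]; rewrite mem_index_iota leqNgt im.
  rewrite big_mkcond /= (eq_big_nat _ _ (F2 := fun i => q ^+ i.+1 - q ^+ i)); last first.
    by move=> i /andP[_ ->].
  by rewrite telescope_sumr // expr0 addrC subrK.
under eq_bigr => l _ do rewrite (tele _ (mval_le p_pr e _)).
rewrite big_split /=; congr (_ + _).
  rewrite sumr_const /Acount; congr (_ *+ _); apply: eq_card => l.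
  by rewrite !inE expn0 dvd1z andbT.
under eq_bigr do rewrite big_mkcond.
rewrite exchange_big /=; apply: eq_bigr => i _.
rewrite -big_mkcondr /= sumr_const [RHS]mulr_natl; congr (_ *+ _).
apply: eq_card => l; rewrite !inE; congr (_ && _).
by rewrite (mval_dvd p_pr _ (ltn_ord i)).
Qed.

Let f (z : int) : 'F_p := z%:~R.
Let toF (l : box p 1 3) : 'F_p * 'F_p * 'F_p :=
  (f (bvec l 0 0), f (bvec l 0 1), f (bvec l 0 (inord 2))).

Let f_dvd z : (p %| z)%Z = (f z == 0).
Proof. exact: (dvdz_pcharf (pchar_Fp p_pr)). Qed.

Let ord3_dvd (v : 'rV[int]_3) :
  [forall i, (p %| (v 0%R i)%R)%Z] = [&& f (v 0 0) == 0, f (v 0 1) == 0 & f (v 0 (inord 2)) == 0].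
Proof.
apply/forallP/and3P => [H|[h0 h1 h2] i]; first by rewrite -!f_dvd.
rewrite f_dvd; case: i => [[|[|[|i]]] lt] //.
- by rewrite (_ : Ordinal lt = 0) //; apply: val_inj.
- by rewrite (_ : Ordinal lt = 1) //; apply: val_inj.
- by rewrite (_ : Ordinal lt = inord 2) //; apply: val_inj; rewrite /= inordK.
Qed.

Let toF_inj : injective toF.
Proof.
move=> l l' [e0 e1 e2]; rewrite -(bredK p_pr l) -(bredK p_pr l'); apply/(bred_eq p_pr).
rewrite -dvd_rowP => i; rewrite expn1; move: i; apply/forallP.
by rewrite ord3_dvd !mxB_entry /f !rmorphB /= -!/(f _) e0 e1 e2 !subrr eqxx.
Qed.

Let toF_surj t : exists l, toF l = t.
Proof.
case: t => [[x y] z]; pose v := row3 (x : nat) (y : nat) (z : nat).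
exists (bred p 1 v); rewrite /toF; have [w ->] := bvec_bred p_pr 1 v.
have E k : f ((v + (p ^ 1)%:Z *: w) 0 k) = f (v 0 k).
  rewrite mxD_entry /f rmorphD /= [(_ *: w) _ _]mxE rmorphM /= expn1.
  by rewrite -[X in X * _]/(p%:R) pchar_Fp_0 // mul0r addr0.
by rewrite !E /v !row3E /f -!pmulrn !natr_Zp.
Qed.

(** The nonzero points of the cone over the curve are the multiples, by a unit u, of (n^2 x : n^3 y
    : 1) and of (0 : 1 : 0), where (x, y) lies on the original curve; the integral model is its
    rescaling by n. *)
Lemma Acount_points (a1 a2 a3 a4 a6 n : 'F_p) : n != 0 ->
  f A1 = n * a1 -> f A2 = n ^+ 2 * a2 -> f A3 = n ^+ 3 * a3 -> f A4 = n ^+ 4 * a4 ->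
  f A6 = n ^+ 6 * a6 ->
  Acount 1 1 = (p.-1 * #|[set Q : option ('F_p * 'F_p) | on_curve (Weierstrass a1 a2 a3 a4 a6) Q]%SET|)%N.
Proof.
move=> n0 h1 h2 h3 h4 h6.
set E := [set Q | _]%SET.
pose psi (u : 'F_p * option ('F_p * 'F_p)) : 'F_p * 'F_p * 'F_p :=
  if u.2 is Some (x, y) then (u.1 * n ^+ 2 * x, u.1 * n ^+ 3 * y, u.1) else (0, u.1, 0).
pose S := finset.setX [set~ (0 : 'F_p)]%SET E.
have cS : #|S| = (p.-1 * #|E|)%N by rewrite cardsX cardsC1 card_Fp.
have psi_inj : {in S &, injective psi}.
  move=> [u [[x y]|]] [v [[x' y']|]]; rewrite !inE /= => /andP[u0 _] /andP[v0 _] e;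
    move: (congr1 (fun t => t.1.1) e) (congr1 (fun t => t.1.2) e) (congr1 snd e) => /= {e}.
  - move=> e1 e2 e3; subst v; congr (_, Some (_, _)).
      exact: (mulfI (mulf_neq0 u0 (expf_neq0 2 n0))).
    exact: (mulfI (mulf_neq0 u0 (expf_neq0 3 n0))).
  - by move=> _ _ e; rewrite e eqxx in u0.
  - by move=> _ _ e; rewrite -e eqxx in v0.
  - by move=> _ -> _.
have cub u x y : cubic (f A1) (f A2) (f A3) (f A4) (f A6) (u * n ^+ 2 * x) (u * n ^+ 3 * y) u
    = u ^+ 3 * n ^+ 6 * (y ^+ 2 + a1 * x * y + a3 * y - (x ^+ 3 + a2 * x ^+ 2 + a4 * x + a6)).
  by rewrite h1 h2 h3 h4 h6 /cubic; ring.
rewrite -cS -(card_in_imset psi_inj) /Acount -(card_imset _ toF_inj).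
apply: eq_card => t; apply/imsetP/imsetP => [[l]|[[u Q]]].
  rewrite inE expn1 => /andP[prim].
  have -> : (p %| P3 (bvec l))%Z = (cubic (f A1) (f A2) (f A3) (f A4) (f A6)
     (f (bvec l 0 0)) (f (bvec l 0 1)) (f (bvec l 0 (inord 2))) == 0).
    by rewrite f_dvd; congr (_ == _); rewrite /f /P3 /cubic; ring.
  rewrite /bprim ord3_dvd in prim.
  rewrite /toF; move: prim; move: (f (bvec l 0 0)) (f (bvec l 0 1)) (f (bvec l 0 (inord 2))).
  move=> x y z prim P0 ->; have [z0|z0] := eqVneq z 0.
    subst z; have x0 : x = 0.
      have /eqP : x ^+ 3 = 0 by rewrite -[RHS]oppr0 -[in RHS](eqP P0) /cubic; ring.
      by rewrite expf_eq0 => /eqP.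
    subst x; exists (y, None); rewrite //= !inE /= andbT.
    by move: prim; rewrite !eqxx /= andbT.
  exists (z, Some (x / z / n ^+ 2, y / z / n ^+ 3)).
    rewrite !inE /= z0 /= -subr_eq0.
    have := cub z (x / z / n ^+ 2) (y / z / n ^+ 3).
    have -> : z * n ^+ 2 * (x / z / n ^+ 2) = x by field; rewrite z0 n0.
    have -> : z * n ^+ 3 * (y / z / n ^+ 3) = y by field; rewrite z0 n0.
    rewrite (eqP P0) => /esym/eqP; rewrite mulf_eq0 mulf_eq0 !expf_eq0 (negbTE z0) (negbTE n0) /=.
    by [].
  rewrite /psi /=; congr (_, _, _); field; by rewrite z0 n0.
rewrite !inE /= => /andP[u0 QE] ->; have [l lE] := toF_surj (psi (u, Q)).
exists l => //; rewrite inE expn1 /bprim ord3_dvd.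
have -> : (p %| P3 (bvec l))%Z = (cubic (f A1) (f A2) (f A3) (f A4) (f A6)
     (f (bvec l 0 0)) (f (bvec l 0 1)) (f (bvec l 0 (inord 2))) == 0).
  by rewrite f_dvd; congr (_ == _); rewrite /f /P3 /cubic; ring.
move: (congr1 (fun t => t.1.1) lE) (congr1 (fun t => t.1.2) lE) (congr1 snd lE) => {lE}.
rewrite /toF /psi; case: Q QE => [[x y]|] QE /= -> -> ->.
  rewrite negb_and negb_and u0 !orbT cub /=; move: QE; rewrite /on_curve /= -subr_eq0 => /eqP ->.
  by rewrite mulr0.
rewrite !negb_and u0 orbT /=; apply/eqP; rewrite /cubic; ring.
Qed.

End Hensel.

(** * The sum over the lattices in the centre *)

Section RationalForm.
Variable T : comNzRingType.
Implicit Types x y : T.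

(** The first summand comes from the types with e = 0, the second from e > 0. The factor 1 + x^13
    y^8 is 1 - x^14 y^8 + (x + 1) x^13 y^8. *)
Definition snum1 x y : T :=
  (1 - x ^+ 8 * y ^+ 7) * (1 - x ^+ 7 * y ^+ 5) *
    (1 - x ^+ 14 * y ^+ 8 + (1 + x + x ^+ 2) * x ^+ 12 * y ^+ 8) +
  (1 + x + x ^+ 2) * x ^+ 6 * y ^+ 7 * (1 - x ^+ 7 * y ^+ 5) * (1 + x ^+ 13 * y ^+ 8).

(** Only e > 0 contributes. The two progressions in e share the pole x y^2 = 1, which cancels and
    leaves x^6 y^5 (1 - y^2). *)
Definition snum2 x y : T :=
  x ^+ 6 * y ^+ 5 * (1 - y ^+ 2) * (1 + x ^+ 13 * y ^+ 8).

(** The factors belong to the geometric series in c, in f and, for the last two, in e. *)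
Definition sden x y : T :=
  (1 - x ^+ 18 * y ^+ 9) * (1 - x ^+ 14 * y ^+ 8) * (1 - x ^+ 8 * y ^+ 7) * (1 - x ^+ 7 * y ^+ 5).

End RationalForm.

Lemma mval_unitl p (p_pr : prime p) e a x : ~~ (p %| a)%Z -> mval p e (a * x) = mval p e x.
Proof.
move=> pa; have E i : (i <= e)%N -> (i <= mval p e (a * x))%N = (i <= mval p e x)%N.
  by move=> ie; rewrite -!(mval_dvd p_pr) // dvdz_unitl.
by apply/eqP; rewrite eqn_leq -E ?mval_le // leqnn E ?mval_le // leqnn.
Qed.

Section LatticeSum.
Variable R : realType.
Local Notation C := (R[i]).
Variable p : nat.
Hypothesis p_pr : prime p.
Let pg k : (0 < p ^ k)%N. Proof. by rewrite expn_gt0 prime_gt0. Qed.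
Local Notation pC := (p%:R : C).

Let pC0 : pC != 0. Proof. by rewrite pnatr_eq0 -lt0n prime_gt0. Qed.
Let pC1 : pC - 1 != 0.
Proof. by rewrite subr_eq0 pnatr_eq1 gtn_eqF // prime_gt1. Qed.

Let natC x u v : (x + p ^ u = p ^ v)%N -> x%:R = pC ^+ v - pC ^+ u.
Proof. by rewrite -!natrX => <-; rewrite natrD addrK. Qed.

Definition tset n s := fset_set (tlat p n s).

Lemma tset_nseq n k : tset n (nseq n k) = [fset tdlat p (1%:M : 'M[int]_n) (nseq n k)]%fset.
Proof.
rewrite /tset (_ : tlat p n _ = [set tdlat p 1%:M (nseq n k)]) ?fset_set1 //.
by apply/seteqP; split=> H /tlat_nseq.
Qed.

(** This is the number of points of the projective line over Z/p^(f + 1). It follows from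
    [double_count] with constant weight 1, since Z has a single lattice of type [[:: c]]. *)
Lemma tset2_card c f : (#|` tset 2 [:: (c + f.+1)%N; c]|%fset)%:R = (pC + 1) * pC ^+ f.
Proof.
set b := (c + f.+1)%N; have b0 : (0 < b)%N by rewrite /b addnS.
have cb : all (fun k => (k <= b)%N) [:: c] by rewrite /= leq_addr.
pose r := (p ^ (b + c) - p ^ (b.-1 + c))%N.
have rE : (r + p ^ (b.-1 + c) = p ^ (b + c))%N.
  by rewrite subnK // leq_exp2l ?prime_gt1 // leq_add2r leq_pred.
have cR H : tlat p 2 [:: b; c] H -> #|Rset p b H| = r.
  move=> HT; have := card_Rset (s := [:: b; c]) p_pr b0 erefl _ HT.
  rewrite /= leqnn leq_addr => /(_ isT); rewrite !big_ord_recl !big_ord0 /= !muln1 -!expnD.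
  have -> : minn b b.-1 = b.-1 by lia.
  have -> : minn c b.-1 = c by rewrite /b; lia.
  by rewrite -rE => /eqP; rewrite eqn_add2r => /eqP.
have uniq s' H : size s' = 1 -> sorted leq s' -> all (fun k => (k <= b)%N) s' ->
    tlat p 2 [:: b; c] H -> tlat p 2 (b :: s') H -> tlat p 1 s' = tlat p 1 [:: c].
  case: s' => [|c' []] // _ _ _ /(tlat_plattices (s := [:: b; c]) p_pr erefl) [_ e].
  move=> /(tlat_plattices (s := [:: b; c']) p_pr erefl) [_]; rewrite e /= {e} => e.
  by have -> : c' = c by lia.
have : (#|` tset 2 [:: b; c]|%fset)%:R * r%:R = (#|[set l : box p b 2 | bprim l]%SET|)%:R :> C.
  have := double_count (n := 1) (s := [:: c]) p_pr erefl cb uniq (C := C) (F := fun=> 1)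
    (G := fun=> 1) cR (fun _ _ _ _ => erefl).
  rewrite -/(tset 1 _) (tset_nseq 1 c) cardfs1 mulr1 sumr_const.
  by rewrite big_const_seq count_predT iter_addr_0 cardsE.
rewrite (natC (card_bprim p_pr 2 b0)) (natC rE) => e.
have rn0 : pC ^+ (b + c) - pC ^+ (b.-1 + c) != 0.
  have -> : pC ^+ (b + c) - pC ^+ (b.-1 + c) = pC ^+ (b.-1 + c) * (pC - 1).
    by rewrite mulrBr mulr1 -exprSr -addSn prednK.
  by rewrite mulf_neq0 // expf_neq0.
apply: (mulIf rn0); rewrite e /b addnS /=.
have -> : (2 * (c + f).+1 = c + f + (c + f) + 2)%N by lia.
have -> : ((c + f).+1 + c = c + f + c + 1)%N by lia.
have -> : (2 * (c + f) = c + f + (c + f))%N by lia.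
rewrite !exprD; ring.
Qed.

Variables A1 A2 A3 A4 A6 : int.
Hypothesis smooth : discriminant (Weierstrass (A1%:~R : 'F_p) A2%:~R A3%:~R A4%:~R A6%:~R) != 0.
Variable N : nat.
Hypothesis hN : Acount p A1 A2 A3 A4 A6 1 1 = (p.-1 * N)%N.
Local Notation ann := (annih A1 A2 A3 A4 A6).
Local Notation Pol := (P3 A1 A2 A3 A4 A6).

Lemma annih_latlog (U : 'M[int]_3) a b c : U \in unitmx -> (c <= b <= a)%N ->
  latlog p (ann (tdlat p U [:: a; b; c])) =
  (6 * b + (4 * (a - b) + 2 * (a - b - mval p (a - b) (cubic A1 A2 A3 A4 A6 (U 0%R 0%R) (U 1%R 0%R) (U (inord 2) 0%R)))))%N.
Proof.
by move=> Uu cba; rewrite /latlog (plogE p_pr (annih_idx p_pr A1 A2 A3 A4 A6 Uu cba)).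
Qed.

Lemma tlat3_uniq a b c s' H : (c <= b <= a)%N -> size s' = 2 -> sorted leq s' ->
  all (fun k => (k <= a)%N) s' -> tlat p 3 [:: a; b; c] H -> tlat p 3 (a :: s') H ->
  s' = [:: c; b].
Proof.
move=> /andP[cb ba]; case: s' => [|c' [|b' []]] //= _; rewrite andbT => cb' /and3P[_ ba' _] HT HT'.
have [_ e] := tlat_plattices (s := [:: a; b; c]) p_pr erefl HT.
have [_ e'] := tlat_plattices (s := [:: a; c'; b']) p_pr erefl HT'.
have ct j : all (fun k => (j <= k)%N) [:: a; b; c] <-> all (fun k => (j <= k)%N) [:: a; c'; b'].
  by rewrite -(tlat_content (s := [:: a; b; c]) p_pr j erefl HT)
    -(tlat_content (s := [:: a; c'; b']) p_pr j erefl HT').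
have cc' : c = c'.
  apply/eqP; rewrite eqn_leq; apply/andP; split.
    have /ct /and4P[] // : all (fun k => (c <= k)%N) [:: a; b; c].
    by rewrite /= leqnn cb (leq_trans cb ba).
  have /ct /and4P[] // : all (fun k => (c' <= k)%N) [:: a; c'; b'].
  by rewrite /= leqnn cb' (leq_trans cb' ba').
move: e'; rewrite e /= !addn0 cc' => e'; congr [:: _; _]; lia.
Qed.

(** The column of [U] in [annih_latlog] depends on a chosen basis; it is replaced here by any
    primitive dual vector [l]. Such an [l] is a unit g times the first column of a basis adapted to
    [H], and the cubic changes by g^3, which leaves valuations alone. *)
Lemma annih_value a b c H (l : box p a 3) : (c <= b <= a)%N ->
  tlat p 3 [:: a; b; c] H -> l \in Rset p a H ->
  latlog p (ann H) = (6 * b + (4 * (a - b) + 2 * (a - b - mval p (a - b) (Pol (bvec l)))))%N.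
Proof.
move=> cba HT; have /andP[cb ba] := cba; rewrite inE => /andP[prim /asboolP Hd].
have [W [g [Wu pgg] dE]] := prim_column (n := 2) prim.
have Hd' w : H w -> ((p ^ a)%N %| ((w *m W) 0%R 0%R)%R)%Z.
  by move=> /Hd; rewrite dE dvdz_unitl.
have sa : all (fun k => (k <= a)%N) [:: b; c] by rewrite /= ba (leq_trans cb ba).
have [s' [L [s'n s's s'a LT HE]]] := ext_lat_surj (n := 2) (s := [:: b; c]) p_pr Wu erefl sa HT Hd'.
have HT' : tlat p 3 (a :: s') H by rewrite HE; apply: ext_lat_tlat.
have s'E := tlat3_uniq cba s'n s's s'a HT HT'.
have {LT} [U Uu LE] : tlat p 2 [:: b; c] L.
  by rewrite (tlat_rev p_pr (s := [:: b; c]) (n := 2)) // -[rev _]/[:: c; b] -s'E.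
pose V : 'M[int]_(1 + 2) := W *m block_mx (1%:M : 'M_1) 0 0 U.
have Vu : V \in unitmx by exact: ext_unitmx.
have HV : H = tdlat p (V : 'M_3) [:: a; b; c] by rewrite HE LE; exact: ext_lat_dlat.
rewrite HV annih_latlog //; congr (_ + (_ + 2 * (_ - _)))%N.
(* Extending by the block matrix does not change the first column. *)
have V0 k : V k 0 = W k 0.
  have e0 : (0 : 'I_(1 + 2)) = lshift 2 0 by apply: val_inj.
  have bE : (block_mx (1%:M : 'M_1) 0 0 U : 'M_(1 + 2)) *m delta_mx 0 0 = delta_mx 0 (0 : 'I_1).
    rewrite -colE; apply/colP => i; rewrite mxE e0 [RHS]mxE eqxx andbT.
    case: (splitP i) => i' ii.
      have -> : i = lshift 2 i' by apply: val_inj.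
      by rewrite block_mxEul mxE ord1 !eqxx.
    have -> : i = rshift 1 i' by apply: val_inj.
    by rewrite block_mxEdl mxE.
  have : W *m (block_mx (1%:M : 'M_1) 0 0 U *m delta_mx 0 (0 : 'I_1)) = W *m delta_mx 0 0 by rewrite bE.
  by rewrite mulmxA -!colE => /matrixP /(_ k 0); rewrite !mxE.
have lE k : bvec l 0 k = g * W k 0.
  have := dE (delta_mx 0 k); rewrite -rowE mxE => <-.
  by rewrite /dotr -rowE !mxE.
rewrite !V0 /P3 !lE cubicM exprS expr2 -!mulrA.
by rewrite !(mval_unitl p_pr).
Qed.

Section TypeSums.
Variables (y : C).
Hypothesis y0 : y != 0.
Local Notation q := (y ^- 2).

(** The sum of q^m over the points of the projective plane over Z/p^(e + 1), m being the valuation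
    of the cubic truncated at e + 1; [N * p ^ (2 e - i)] of these points have m > i. *)
Definition Wsum e : C :=
  pC ^+ (2 * e) * (1 + pC + pC ^+ 2) +
  N%:R * \sum_(i < e.+1) pC ^+ (2 * e - i) * (q ^+ i.+1 - q ^+ i).

(* The sum of [y ^ (log |Z^6 : X(Lam)| - 6 a)] over the lattices [Lam] of type
   (a, b, c) = (c + f + e, c + f, c). *)
Definition kappa e f : C :=
  match e, f with
  | 0%N, 0%N => 1
  | 0%N, f.+1 => pC ^+ (2 * f) * (1 + pC + pC ^+ 2)
  | e.+1, 0%N => Wsum e
  | e.+1, f.+1 => Wsum e * ((pC + 1) * pC ^+ (2 * f).+1)
  end.

Let a0C a : (0 < a)%N -> (Acount p A1 A2 A3 A4 A6 a 0)%:R = pC ^+ (3 * a) - pC ^+ (3 * a.-1).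
Proof. by move=> a0; apply/natC/Acount0. Qed.

Let aiC a i : (i < a)%N ->
  (Acount p A1 A2 A3 A4 A6 a i.+1)%:R = pC ^+ (3 * (a - i.+1) + 2 * i) * ((pC - 1) * N%:R).
Proof.
move=> ia; rewrite (AcountE p_pr smooth) // hN !natrM natrX; congr (_ * (_ * _)).
by rewrite -subn1 natrB ?prime_gt0.
Qed.

Lemma sum_annih c f e : \sum_(H <- tset 3 [:: (c + f + e)%N; (c + f)%N; c]) y ^+ latlog p (ann H) =
  y ^+ (6 * (c + f + e)) * kappa e f.
Proof.
set a := (c + f + e)%N; set b := (c + f)%N.
have cba : (c <= b <= a)%N by rewrite /a /b !leq_addr.
have /andP[cb ba] := cba.
(* The type (c, c, c) has a single lattice. It is treated apart because c may be 0, and there are no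
   primitive vectors modulo p^0. *)
have [ef0|ef0] := posnP (e + f)%N.
  move: ef0; rewrite /a /b => /eqP; rewrite addn_eq0 => /andP[/eqP-> /eqP->].
  rewrite !addn0 mulr1 (tset_nseq 3 c) big_seq_fset1.
  rewrite (annih_latlog (a := c) (b := c) (c := c)) ?unitmx1 ?leqnn //.
  by rewrite subnn; congr (y ^+ _); lia.
have a0 : (0 < a)%N by rewrite /a; lia.
have sa : all (fun k => (k <= a)%N) [:: b; c] by rewrite /= ba (leq_trans cb ba).
have su s' H : size s' = 2 -> sorted leq s' -> all (fun k => (k <= a)%N) s' ->
    tlat p 3 [:: a; b; c] H -> tlat p 3 (a :: s') H -> tlat p 2 s' = tlat p 2 [:: b; c].
  by move=> s2 ss s'a HT HT'; rewrite (tlat3_uniq cba s2 ss s'a HT HT') [RHS](tlat_rev p_pr).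
(* [p ^ u] is the number of nonprimitive dual vectors in [card_Rset], and [r] that of the primitive
   ones. *)
pose u := (minn b a.-1 + minn c a.-1 + a.-1)%N.
pose r := (p ^ (a + b + c) - p ^ u)%N.
have rE : (r + p ^ u = p ^ (a + b + c))%N.
  by rewrite subnK // leq_exp2l ?prime_gt1 // /u; lia.
have cR H : tlat p 3 [:: a; b; c] H -> #|Rset p a H| = r.
  move=> HT; have := card_Rset (s := [:: a; b; c]) p_pr a0 erefl _ HT.
  rewrite /= leqnn ba (leq_trans cb ba) => /(_ isT).
  rewrite !big_ord_recl !big_ord0 /= !muln1 -!expnD.
  have -> : (minn a a.-1 + (minn b a.-1 + minn c a.-1) = u)%N by rewrite /u; lia.
  by rewrite addnA -rE => /eqP; rewrite eqn_add2r => /eqP.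
have FG H l : tlat p 3 [:: a; b; c] H -> l \in Rset p a H ->
    y ^+ latlog p (ann H) = y ^+ (6 * a) * q ^+ mval p e (Pol (bvec l)).
  move=> HT lR; rewrite (annih_value cba HT lR).
  have -> : (a - b)%N = e by rewrite /a /b addKn.
  have me := mval_le p_pr e (Pol (bvec l)); set m := mval _ _ _ in me *.
  have -> : (6 * a = 6 * b + (4 * e + 2 * (e - m)) + 2 * m)%N by rewrite /a /b; lia.
  by rewrite [in RHS]exprD -mulrA exprVn -exprM mulfV ?mulr1 // expf_neq0.
have := double_count (n := 2) (s := [:: b; c]) p_pr erefl sa su (C := C) cR FG.
rewrite -/(tset 3 _) -/(tset 2 _) -mulr_sumr sum_mval //; last by rewrite /a leq_addl.
rewrite a0C // (natC rE) => eqS.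
have aiS : \sum_(i < e) (Acount p A1 A2 A3 A4 A6 a i.+1)%:R * (q ^+ i.+1 - q ^+ i) =
  (pC - 1) * N%:R * \sum_(i < e) pC ^+ (3 * a - 3 - i) * (q ^+ i.+1 - q ^+ i).
  rewrite mulr_sumr; apply: eq_bigr => i _.
  have ia : (i < a)%N by apply: leq_trans (ltn_ord i) (leq_addl _ _).
  rewrite aiC //; have -> : (3 * (a - i.+1) + 2 * i = 3 * a - 3 - i)%N by lia.
  ring.
rewrite aiS {aiS} in eqS.
have rn0 : pC ^+ (a + b + c) - pC ^+ u != 0.
  have -> : (a + b + c = u + (a + b + c - u))%N by rewrite /u; lia.
  rewrite exprD -{2}[pC ^+ u]mulr1 -mulrBr mulf_neq0 ?expf_neq0 // subr_eq0.
  rewrite -natrX -[1]/(1%:R) eqr_nat; apply/eqP => pe.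
  have : (1 < p ^ (a + b + c - u))%N by rewrite -(expn0 p) ltn_exp2l ?prime_gt1 // /u; lia.
  by rewrite pe.
apply: (mulIf rn0); rewrite eqS -!mulrA; congr (_ * _).
clear cR FG su eqS rE rn0 sa r; subst u a b.
have Sig e' f' : \sum_(i < e'.+1) pC ^+ (3 * (c + f' + e'.+1) - 3 - i) * (q ^+ i.+1 - q ^+ i) =
    pC ^+ (3 * (c + f') + e') * \sum_(i < e'.+1) pC ^+ (2 * e' - i) * (q ^+ i.+1 - q ^+ i).
  rewrite mulr_sumr; apply: eq_bigr => i _; rewrite mulrA -exprD.
  by congr (_ ^+ _ * _); have := ltn_ord i; lia.
case: e f cba cb ba ef0 a0 => [|e] [|f] // _ _ _ _ a0.
(* In each case the exponents are rewritten as sums of the same few terms, so that after [exprD] the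
   identity is polynomial. *)
- rewrite !addn0 big_ord0 !mulr0 addr0 (tset2_card c f) addnS /=.
    have -> : (minn (c + f).+1 (c + f) + minn c (c + f) + (c + f) = c + f + f + c + c)%N by lia.
  have -> : (3 * (c + f).+1 = c + f + f + c + c + f + 3)%N by lia.
  have -> : (3 * (c + f) = c + f + f + c + c + f)%N by lia.
  have -> : ((c + f).+1 + (c + f).+1 + c = c + f + f + c + c + 2)%N by lia.
  have -> : (2 * f = f + f)%N by lia.
  rewrite !exprD; ring.
- rewrite Sig !addn0 -[[:: c; c]]/(nseq 2 c) (tset_nseq 2 c) cardfs1 mulr1 /= /Wsum.
  set S := \sum_(i < _) _; rewrite addnS /=.
  have -> : (minn c (c + e) + minn c (c + e) + (c + e) = c + c + c + e)%N by lia.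
  have -> : (3 * (c + e).+1 = c + c + c + e + e + e + 3)%N by lia.
  have -> : (3 * (c + e) = c + c + c + e + e + e)%N by lia.
  have -> : ((c + e).+1 + c + c = c + c + c + e + 1)%N by lia.
  have -> : (3 * c + e = c + c + c + e)%N by lia.
  have -> : (2 * e = e + e)%N by lia.
  rewrite !exprD; ring.
- rewrite Sig (tset2_card c f) /= /Wsum.
  set S := \sum_(i < _) _; set d := (c + f.+1)%N; rewrite addnS /=.
  have -> : (minn d (d + e) + minn c (d + e) + (d + e) = d + d + c + e)%N by rewrite /d; lia.
  have -> : (3 * (d + e).+1 = d + d + c + e + e + e + f + 4)%N by rewrite /d; lia.
  have -> : (3 * (d + e) = d + d + c + e + e + e + f + 1)%N by rewrite /d; lia.
  have -> : ((d + e).+1 + d + c = d + d + c + e + 1)%N by lia.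
  have -> : (3 * d + e = d + d + c + e + f + 1)%N by rewrite /d; lia.
  have -> : ((2 * f).+1 = f + f + 1)%N by lia.
  have -> : (2 * e = e + e)%N by lia.
  rewrite !exprD; ring.
Qed.

End TypeSums.

(** As the norm of the term at [Y] is the term at [|Y|], the absolute convergence that regrouping
    requires is the hypothesis itself at [|Y|]. *)
Lemma has_sum_fib_nat (I : choiceType) (Q : C -> Prop) (D : set I) (t : I -> nat)
    (h : C -> I -> C) (g : C -> nat -> C) (z : C -> C) :
  (forall Y i, `|h Y i| = h `|Y| i) ->
  (forall Y, Q `|Y| -> forall n, has_sum [set i | D i /\ t i = n] (h Y) (g Y n)) ->
  (forall Y, Q `|Y| -> has_sum [set: nat] (g Y) (z Y)) ->
  forall Y, Q `|Y| -> has_sum D (h Y) (z Y).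
Proof.
move=> hn hf hg Y QY.
apply: (has_sum_fib (p := t) (E := [set: nat]) (g := g Y) (g' := g `|Y|) (z' := z `|Y|)) => //.
- by move=> n _; apply: hf.
- move=> n _; apply: eq_has_sum (hf `|Y| _ n) => //; last by rewrite normr_id.
- exact: hg.
- by apply: hg; rewrite normr_id.
Qed.

Lemma tlat3_exists H : plattices p 3 H -> exists k : nat * nat * nat,
  tlat p 3 [:: (k.1.1 + k.1.2 + k.2)%N; (k.1.1 + k.1.2)%N; k.1.1] H.
Proof.
move=> [HS [k hk]].
have Hk v : H ((p ^ k)%:Z *: v).
  have [U [d Uu [_ _ Hd dk]]] := lattice_smith HS hk.
  apply/Hd => i; rewrite -scalemxAl mxE dvdz_mulr // dk (bigD1 i) //= PoszM dvdz_mulr //.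
have [s [s3 ss _ HT]] := tlat_exists p_pr HS (ex_intro _ _ hk) Hk.
case: s s3 ss HT => [|c [|b [|a []]]] //= _; rewrite andbT => /andP[cb ba] HT.
exists (c, b - c, a - b)%N => /=; rewrite subnKC // subnKC //.
by rewrite (tlat_rev p_pr).
Qed.

Lemma tlat3_type_uniq c f e c' f' e' H :
  tlat p 3 [:: (c + f + e)%N; (c + f)%N; c] H -> tlat p 3 [:: (c' + f' + e')%N; (c' + f')%N; c'] H ->
  (c, f, e) = (c', f', e').
Proof.
move=> HT HT'.
have ex j : all (fun k => (k <= j)%N) [:: (c + f + e)%N; (c + f)%N; c] <->
    all (fun k => (k <= j)%N) [:: (c' + f' + e')%N; (c' + f')%N; c'].
  by rewrite -(tlat_exponent p_pr j _ HT) // -(tlat_exponent p_pr j _ HT').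
have aa : (c + f + e = c' + f' + e')%N.
  apply/eqP; rewrite eqn_leq; apply/andP; split.
    by have /ex : all (fun k => (k <= c' + f' + e')%N) [:: (c' + f' + e')%N; (c' + f')%N; c'];
      rewrite /= ?leqnn; lia.
  by have /ex : all (fun k => (k <= c + f + e)%N) [:: (c + f + e)%N; (c + f)%N; c];
    rewrite /= ?leqnn; lia.
have ct j : all (fun k => (j <= k)%N) [:: (c + f + e)%N; (c + f)%N; c] <->
    all (fun k => (j <= k)%N) [:: (c' + f' + e')%N; (c' + f')%N; c'].
  by rewrite -(tlat_content p_pr j _ HT) // -(tlat_content p_pr j _ HT').
have cc : c = c'.
  apply/eqP; rewrite eqn_leq; apply/andP; split.
    by have /ct : all (fun k => (c <= k)%N) [:: (c + f + e)%N; (c + f)%N; c]; rewrite /= ?leqnn; lia.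
  by have /ct : all (fun k => (c' <= k)%N) [:: (c' + f' + e')%N; (c' + f')%N; c'];
    rewrite /= ?leqnn; lia.
have [_ e1] := tlat_plattices (s := [:: (c + f + e)%N; (c + f)%N; c]) p_pr erefl HT.
have [_] := tlat_plattices (s := [:: (c' + f' + e')%N; (c' + f')%N; c']) p_pr erefl HT'.
rewrite e1 /= => e2; congr (_, _, _); lia.
Qed.

(** The slope bound 10 covers all the ratios p^k y^m met here, so that one disc serves for every
    series. *)
Lemma norm_monomial_lt1 (y : C) k m : `|y| < (pC ^+ 10)^-1 ->
  (k <= 10 * m)%N -> (0 < m)%N -> `|pC ^+ k * y ^+ m| < 1.
Proof.
move=> y1 km m0; have p10 : 0 < pC ^+ 10 by rewrite exprn_gt0 // ltr0n prime_gt0.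
have ty1 : pC ^+ 10 * `|y| < 1 by rewrite mulrC -ltr_pdivlMr // mul1r.
rewrite normrM !normrX normr_nat.
apply: le_lt_trans (_ : (pC ^+ 10 * `|y|) ^+ m < 1).
  rewrite exprMn -exprM ler_wpM2r ?exprn_ge0 // ler_weXn2l // ler1n prime_gt0 //.
by rewrite exprn_ilt1 ?mulr_ge0 ?(ltW p10) // -lt0n.
Qed.

Lemma one_sub_neq0 (x : C) : `|x| < 1 -> 1 - x != 0.
Proof. by move=> x1; rewrite subr_eq0; apply: contraTneq x1 => <-; rewrite normr1 ltxx. Qed.

Lemma sden_neq0 (y : C) : `|y| < (pC ^+ 10)^-1 -> sden pC y != 0.
Proof.
move=> y1; have nz k m : (k <= 10 * m)%N -> (0 < m)%N -> 1 - pC ^+ k * y ^+ m != 0.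
  by move=> km m0; apply/one_sub_neq0/norm_monomial_lt1.
by rewrite /sden !mulf_neq0 // nz.
Qed.

Section Sum.
(** 0 is excluded because [y ^- 2] occurs. *)
Let Q (r : C) : Prop := 0 < r /\ r < (pC ^+ 10)^-1.
Let h (y : C) (H : set 'rV[int]_3) : C := ((p ^ 6)%:R * y) ^+ latlog p H * y ^+ latlog p (ann H).
(** Raising e, f or c by one multiplies the index of the lattice by p, p^2 or p^3 and raises a by
    one: this gives (p^6 y)^k y^6 for k = 1, 2, 3. *)
Local Notation T1 y := (pC ^+ 6 * y ^+ 7).
Local Notation T2 y := (pC ^+ 12 * y ^+ 8).
Local Notation T3 y := (pC ^+ 18 * y ^+ 9).

Let h_norm (y : C) H : `|h y H| = h `|y| H.
Proof. by rewrite /h normrM !normrX normrM normr_nat. Qed.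

Let Q0 (y : C) : Q `|y| -> y != 0. Proof. by case; rewrite normr_gt0. Qed.

Let small (y : C) k m : Q `|y| -> (k <= 10 * m)%N -> (0 < m)%N -> `|pC ^+ k * y ^+ m| < 1.
Proof. by case=> _; apply: norm_monomial_lt1. Qed.

Let T (k : nat * nat * nat) := [:: (k.1.1 + k.1.2 + k.2)%N; (k.1.1 + k.1.2)%N; k.1.1].
Let ty (H : set 'rV[int]_3) : nat * nat * nat := xget (0, 0, 0)%N [set k | tlat p 3 (T k) H].

Let tyE H k : plattices p 3 H -> (ty H = k <-> tlat p 3 (T k) H).
Proof.
move=> HP; rewrite /ty; case: xgetP => [[[c f] e] _ /= HT|no].
  split=> [<-|] //; case: k => [[c' f'] e']; exact: tlat3_type_uniq.
by have [k' /no] := tlat3_exists HP.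
Qed.

Let De e := [set H | plattices p 3 H /\ (ty H).2 = e].
Let Def e f := [set H | De e H /\ (ty H).1.2 = f].
Let Defc e f c := [set H | Def e f H /\ (ty H).1.1 = c].

Let sum_efc (y : C) e f c : Q `|y| ->
  has_sum (Defc e f c) (h y) (T1 y ^+ e * T2 y ^+ f * kappa y e f * T3 y ^+ c).
Proof.
move=> /Q0 y0; have T3E : size (T (c, f, e)) = 3%N by [].
have DE H : Defc e f c H <-> H \in tset 3 (T (c, f, e)).
  rewrite mem_fset_tlat //; split.
    case=> -[[HP te] tf] tc; apply/(tyE _ HP).
    by rewrite -te -tf -tc; case: (ty H) => -[].
  move=> HT; have [HP _] := tlat_plattices p_pr T3E HT.
  by have tH := (tyE _ HP).2 HT; rewrite /Defc /Def /De /= tH.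
have := has_sum_fin (h y) DE; congr has_sum.
rewrite (eq_big_seq (fun H => ((p ^ 6)%:R * y) ^+ (3 * c + 2 * f + e) * y ^+ latlog p (ann H))).
  rewrite -mulr_sumr sum_annih // mulrA natrX mulnDr mulnDr !exprD. rewrite /=.
  have -> : T1 y = (pC ^+ 6 * y) * y ^+ 6 by ring.
  have -> : T2 y = (pC ^+ 6 * y) ^+ 2 * y ^+ 6 by ring.
  have -> : T3 y = (pC ^+ 6 * y) ^+ 3 * y ^+ 6 by ring.
  rewrite !(exprMn _ _ (y ^+ 6)) (exprAC _ 2 f) (exprAC _ 3 c) !(exprAC y 6); ring.
move=> H /DE HT; have [HP te] : plattices p 3 H /\ ty H = (c, f, e).
  by case: HT => -[[HP <-] <-] <-; split=> //; case: (ty H) => -[].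
have /(tyE _ HP) /(tlat_plattices p_pr T3E) [_ lH] := te.
by rewrite /h /= lH /=; congr (_ ^+ _ * _); lia.
Qed.

Let ke e : C := if e is 0%N then 1 + pC + pC ^+ 2 else (pC + 1) * pC.
Let k0 (y : C) e : C := if e is e'.+1 then Wsum y e' else 1.

(** Apart from the term f = 0, [kappa] is a function of e times a geometric progression in f. *)
Let kappaE (y : C) e f : kappa y e f = k0 y e * (if f is f'.+1 then ke e * pC ^+ (2 * f') else 1).
Proof. by case: e f => [|e] [|f]; rewrite /= ?mulr1 ?mul1r ?exprSr ?exprS; ring. Qed.

Let sum_ef (y : C) e f : Q `|y| ->
  has_sum (Def e f) (h y) (T1 y ^+ e * T2 y ^+ f * kappa y e f / (1 - T3 y)).
Proof.
move: y; apply: (has_sum_fib_nat (t := fun H => (ty H).1.1) h_norm) => [y Qy c|y Qy].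
  exact: sum_efc.
by apply/has_sumZ/has_sum_geom/small.
Qed.

(** The sum over f, normalized to have the term 1 at f = 0. *)
Let Be (y : C) e : C := 1 + ke e * T2 y / (1 - pC ^+ 14 * y ^+ 8).

Let sum_e (y : C) e : Q `|y| -> has_sum (De e) (h y) (T1 y ^+ e * k0 y e * Be y e / (1 - T3 y)).
Proof.
move: y; apply: (has_sum_fib_nat (t := fun H => (ty H).1.2) h_norm) => [y Qy f|y Qy].
  exact: sum_ef.
have -> : T1 y ^+ e * k0 y e * Be y e / (1 - T3 y) =
    T1 y ^+ e * T2 y ^+ 0 * kappa y e 0 / (1 - T3 y) +
    T1 y ^+ e * k0 y e / (1 - T3 y) * (ke e * T2 y) * (1 - pC ^+ 14 * y ^+ 8)^-1.
  by rewrite kappaE /Be; ring.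
apply: has_sum_nat_recl.
have := has_sumZ (T1 y ^+ e * k0 y e / (1 - T3 y) * (ke e * T2 y))
  (has_sum_geom (small (k := 14) (m := 8) Qy erefl erefl)).
apply: eq_has_sum => // f _; rewrite kappaE (exprS (T2 y) f) (exprM pC 2 f).
have -> : (pC ^+ 14 * y ^+ 8) ^+ f = (pC ^+ 2) ^+ f * T2 y ^+ f.
  by rewrite -exprMn; congr (_ ^+ _); ring.
ring.
Qed.

(** The sum over i is the quotient of a difference of powers of p and y^-2 by p - y^-2, so [Wsum] is
    a combination of two geometric progressions in e. *)
Let WsumE (y : C) e : Q `|y| -> y ^- 2 != pC ->
  Wsum y e = pC ^+ (2 * e) * (1 + pC + pC ^+ 2) +
    N%:R * (y ^- 2 - 1) / (pC - y ^- 2) * (pC ^+ (2 * e).+1 - pC ^+ e * (y ^- 2) ^+ e.+1).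
Proof.
move=> Qy qp; congr (_ + _); rewrite -!mulrA; congr (_ * _).
have pq : pC - y ^- 2 != 0 by rewrite subr_eq0 eq_sym.
have -> : pC ^+ (2 * e).+1 - pC ^+ e * (y ^- 2) ^+ e.+1 =
    pC ^+ e * (pC ^+ e.+1 - (y ^- 2) ^+ e.+1).
  by rewrite mulrBr -exprD; congr (_ ^+ _ - _); lia.
rewrite subrXX [pC ^+ e * _]mulrCA mulKf // mulr_sumr mulr_sumr; apply: eq_bigr => i _.
have -> : (2 * e - i = e + (e.+1.-1 - i))%N by have := ltn_ord i; lia.
by rewrite exprD exprS; ring.
Qed.

Lemma has_sum_annih (y : C) : 0 < `|y| -> `|y| < (pC ^+ 10)^-1 ->
  has_sum (plattices p 3) (fun H => ((p ^ 6)%:R * y) ^+ latlog p H * y ^+ latlog p (ann H))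
    ((snum1 pC y + N%:R * snum2 pC y) / sden pC y).
Proof.
move=> y0 y1; have : Q `|y| by [].
move: y {y0 y1}; apply: (has_sum_fib_nat (t := fun H => (ty H).2) h_norm) => [y Qy e|y Qy].
  exact: sum_e.
have d9 := one_sub_neq0 (small (k := 18) (m := 9) Qy erefl erefl).
have d8 := one_sub_neq0 (small (k := 14) (m := 8) Qy erefl erefl).
have s7 := small (k := 8) (m := 7) Qy erefl erefl; have d7 := one_sub_neq0 s7.
have s5 := small (k := 7) (m := 5) Qy erefl erefl; have d5 := one_sub_neq0 s5.
have y0 := Q0 Qy.
have d2 : pC * y ^+ 2 - 1 != 0.
  by rewrite -[_ - _]opprB oppr_eq0 -{1}[pC]expr1 one_sub_neq0 // small.
(* The closed form of [Wsum] divides by p - y^-2; since [y] is small, p y^2 = 1 is impossible. *)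
have qp : y ^- 2 != pC.
  by apply: contraNneq d2 => <-; rewrite mulVf ?subrr // expf_neq0.
have pq : pC - y ^- 2 = (pC * y ^+ 2 - 1) / y ^+ 2 by field.
(* The term of index e + 1 is [B] times al (p^8 y^7)^e + be (p^7 y^5)^e, up to the two ratios being
   written through [T1]. *)
pose cN := N%:R * (y ^- 2 - 1) / (pC - y ^- 2).
pose al := T1 y * ((1 + pC + pC ^+ 2) + cN * pC); pose be := - (T1 y * cN * y ^- 2).
pose B := (1 + (pC + 1) * pC * T2 y / (1 - pC ^+ 14 * y ^+ 8)) / (1 - T3 y).
have -> : (snum1 pC y + N%:R * snum2 pC y) / sden pC y =
    T1 y ^+ 0 * k0 y 0 * Be y 0 / (1 - T3 y) +
    (al * B * (1 - pC ^+ 8 * y ^+ 7)^-1 + be * B * (1 - pC ^+ 7 * y ^+ 5)^-1).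
  rewrite /snum1 /snum2 /sden /al /be /B /cN pq /Be /k0 /ke; field.
  by rewrite y0 d2 d9 d8 d7 d5.
apply: has_sum_nat_recl.
have := has_sumD (has_sumZ (al * B) (has_sum_geom s7)) (has_sumZ (be * B) (has_sum_geom s5)).
apply: eq_has_sum => // e _; rewrite /k0 WsumE // -/cN /Be /ke.
have -> : pC ^+ 8 * y ^+ 7 = pC ^+ 2 * T1 y by ring.
have -> : pC ^+ 7 * y ^+ 5 = pC * y ^- 2 * T1 y by field.
rewrite (exprS (T1 y) e) (exprS (y ^- 2) e) (exprS pC (2 * e)) (exprM pC 2 e) !(exprMn e).
rewrite /al /be /B; ring.
Qed.

End Sum.
Lemma annih_plattices H : plattices p 3 H -> plattices p 6 (ann H).
Proof.
move=> HP; have [[[c f] e] /= [U Uu HE]] := tlat3_exists HP; split; last first.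
  eexists; rewrite HE; apply: (annih_idx p_pr A1 A2 A3 A4 A6 Uu).
  by rewrite !leq_addr.
have [[H0 HB] _] := HP; split=> [v|x y Hx Hy v].
  by rewrite brackE (beta0l (beta6Dl _ _ _ _ _)) (beta0r (beta6Dr _ _ _ _ _)) subr0.
have -> : brack A1 A2 A3 A4 A6 (x - y) v = brack A1 A2 A3 A4 A6 x v - brack A1 A2 A3 A4 A6 y v.
  rewrite !brackE beta6Dl beta6Dr (betaNl (beta6Dl _ _ _ _ _)) (betaNr (beta6Dr _ _ _ _ _)).
  by rewrite !opprD !opprK addrACA.
exact: HB.
Qed.

End LatticeSum.

(** * The group and the Lie ring *)

Section CentralExtension.
Variables (m n : nat) (beta : 'rV[int]_m -> 'rV[int]_m -> 'rV[int]_n).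
Hypothesis betaDl : forall u v w, beta (u + v) w = beta u w + beta v w.
Hypothesis betaDr : forall u v w, beta u (v + w) = beta u v + beta u w.
Local Notation V := ('rV[int]_m * 'rV[int]_n)%type.

Definition brk u v := beta u v - beta v u.

(** Bilinearity is a parameter of the type itself, so that the group structure can be inferred from
    it. *)
Definition central_ext (Dl : forall u v w, beta (u + v) w = beta u w + beta v w)
  (Dr : forall u v w, beta u (v + w) = beta u v + beta u w) : Type := V.

HB.instance Definition _ := Choice.on (central_ext betaDl betaDr).
HB.instance Definition _ := isGroup.Build (central_ext betaDl betaDr)
  (bmulA betaDl betaDr) (bmul1g betaDl) (bmulg1 betaDr)
  (bmulVg betaDl) (bmulgV betaDr).

Local Notation G := (central_ext betaDl betaDr).

Let betaE := (betaDl, betaDr, betaNl betaDl, betaNr betaDr, beta0l betaDl, beta0r betaDr).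

Lemma ext_conjE (g h : G) : (h ^ g)%g = (h.1, h.2 + brk h.1 g.1) :> V.
Proof.
rewrite [LHS](_ : _ = bmul beta (binv beta g) (bmul beta h g)) // /brk bmulVgE // /bmul /= !betaE.
congr pair; first by rewrite addrK.
by apply/rowP => i; rewrite !mxE; ring.
Qed.

Lemma ext_commE (g h : G) : [~ g, h]%g = (0, brk g.1 h.1) :> V.
Proof.
rewrite [LHS](_ : _ = bmul beta (binv beta g) (g ^ h)%g) // ext_conjE bmulVgE //= subrr.
by congr pair; apply/rowP => i; rewrite !mxE; ring.
Qed.

(** Conjugating (u, a) by an element over v adds the central element [u, v], which must lie in the
    kernel part. *)
Lemma ext_is_normal (H : set G) : is_normal H <->
  bsubgroup beta H /\ impart H `<=` [set u | forall v, kerpart H (brk u v)].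
Proof.
split=> [[HH HN]|[HH HX]].
  have HS : bsubgroup beta H by [].
  split=> // u [a Hua] v; have := HN (v, 0) (u, a) Hua; rewrite ext_conjE /=.
  by move/(kerpartP betaDl betaDr _ HS Hua); rewrite addrC addKr.
split=> // g [u a] Hua; rewrite ext_conjE /=; apply/(kerpartP betaDl betaDr _ HH Hua).
by rewrite addrC addKr; apply: HX; exists a.
Qed.

Lemma ext_index (H : set G) k : (0 < k)%N -> is_subgroup H ->
  (group_index H = k <-> bindex beta H k).
Proof.
move=> k0 HH; apply: card_classes => // x y.
have HV g : H g -> H g^-1%g by move=> Hg; rewrite -[_^-1%g]mul1g; apply: HH.2 => //; apply: HH.1.
have HM g h : H g -> H h -> H (g * h)%g.
  by move=> Hg Hh; rewrite -[h]invgK; apply: HH.2 => //; apply: HV.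
have e : bmul beta (binv beta x) y = (x^-1 * y)%g by [].
rewrite e; split=> [cl|Hxy].
  have : [set (x * h)%g | h in H] y by rewrite cl; exists 1%g; [exact: HH.1|rewrite mulg1].
  by case=> h Hh <-; rewrite mulKg.
apply/seteqP; split=> _ [h Hh <-].
  exists ((x^-1 * y)^-1 * h)%g; first by apply: HM => //; apply: HV.
  by rewrite invgM invgK -mulgA mulVKg.
exists ((x^-1 * y) * h)%g; first by apply: HM.
by rewrite -mulgA mulVKg.
Qed.

Lemma brkDl u v w : brk (u + v) w = brk u w + brk v w.
Proof. by rewrite /brk !betaE addrACA -opprD. Qed.
Lemma brkDr u v w : brk u (v + w) = brk u v + brk u w.
Proof. by rewrite /brk !betaE addrACA -opprD. Qed.
Lemma brkxx u : brk u u = 0. Proof. by rewrite /brk subrr. Qed.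
Lemma brkC u v : brk u v = - brk v u. Proof. by rewrite /brk opprB. Qed.
Lemma brk0l v : brk 0 v = 0. Proof. by rewrite /brk !betaE subrr. Qed.
Lemma brk0r v : brk v 0 = 0. Proof. by rewrite /brk !betaE subrr. Qed.

Definition ext_br (x y : V) : V := (0, brk x.1 y.1).

Fact ext_brDl x y z : ext_br (x + y) z = ext_br x z + ext_br y z.
Proof. by rewrite /ext_br /= brkDl; congr pair; rewrite addr0. Qed.
Fact ext_brDr x y z : ext_br x (y + z) = ext_br x y + ext_br x z.
Proof. by rewrite /ext_br /= brkDr; congr pair; rewrite addr0. Qed.
Fact ext_brxx x : ext_br x x = 0.
Proof. by rewrite /ext_br brkxx. Qed.
Fact ext_jacobi x y z :
  ext_br x (ext_br y z) + ext_br y (ext_br z x) + ext_br z (ext_br x y) = 0.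
Proof. by rewrite /ext_br /= !brk0r; congr pair; rewrite !addr0. Qed.

Definition ext_lie : lieRing := LieRing ext_brDl ext_brDr ext_brxx ext_jacobi.

(** An ideal is a subgroup for the zero cocycle subject to the same condition on the bracket of
    [beta]; both zeta functions are thus instances of one sum. *)
Lemma ext_is_ideal (I : set ext_lie) : is_ideal I <->
  bsubgroup (fun _ _ => 0 : 'rV[int]_n) I /\
  impart I `<=` [set u | forall v, kerpart I (brk u v)].
Proof.
have e (g h : V) : bmul (fun _ _ => 0 : 'rV[int]_n) g (binv (fun _ _ => 0 : 'rV[int]_n) h) = g - h.
  by rewrite /bmul /binv /= !addr0.
split=> [[I0 IB IL]|[[I0 IB] IX]].
  split; first by split=> // g h; rewrite e; apply: IB.
  move=> u [a Iua] v; have Iv := IL ((- v, 0) : V) ((u, a) : V) Iua.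
  have -> // : kerpart I (brk u v) = I (ext_br ((- v, 0) : V) ((u, a) : V)).
  by rewrite /kerpart /ext_br /= brkC /brk !betaE opprB opprK addrC.
split=> // [x y|x [u a] Iua]; first by rewrite -e; apply: IB.
have := IX u (ex_intro _ a Iua) (- x.1).
suff -> : brk u (- x.1) = brk x.1 u by [].
by rewrite brkC /brk !betaE opprB opprK addrC.
Qed.

Lemma ext_lie_index (I : set ext_lie) k : (0 < k)%N -> is_ideal I ->
  (lie_index I = k <-> bindex (fun _ _ => 0 : 'rV[int]_n) I k).
Proof.
move=> k0 [I0 IB _]; have IS : subgroup_of (I : set V) by [].
apply: card_classes => // x y.
have -> : bmul (fun _ _ => 0 : 'rV[int]_n) (binv (fun _ _ => 0 : 'rV[int]_n) x) y = (y : V) - x.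
  by rewrite /bmul /binv /= !addr0 ![- _ + _]addrC.
split=> [cl|Hxy].
  have : [set x + h | h in I] y by rewrite cl; exists 0; rewrite ?addr0.
  by case=> h Hh <-; rewrite addrC addKr.
apply/seteqP; split=> _ [h Hh <-].
  exists (h - (y - x)); first exact: IB.
  by rewrite opprB addrCA [y + _]addrC subrK addrC.
exists (y - x + h); first exact: (subgroup_ofD IS).
by rewrite addrA [x + _]addrC subrK.
Qed.

Lemma subgroup_full (k : nat) (H : set 'rV[int]_k) : subgroup_of H ->
  (forall i, H (delta_mx 0 i)) -> forall v, H v.
Proof.
move=> HH Hd v; rewrite (row_sum_delta v).
by apply: subgroup_of_sum => // i _; apply: subgroup_ofZ.
Qed.

Lemma ext_generated : generated_by_n G (m + n).
Proof.
exists (fun i => match fintype.split i with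
  inl j => (delta_mx 0 j, 0) : V | inr j => (0, delta_mx 0 j) : V end).
move=> H HH Hx; have HS : bsubgroup beta H by [].
have HK : forall a, kerpart H a.
  apply: subgroup_full => [|j]; first exact: (kerpart_subgroup betaDl betaDr HS).
  by have := Hx (rshift m j); rewrite (unsplitK (inr j)).
have HI : forall u, impart H u.
  apply: subgroup_full => [|j]; first by have := impart_subgroup HS.
  by exists 0; have := Hx (lshift n j); rewrite (unsplitK (inl j)).
apply/seteqP; split=> // -[u a] _; have [a' Ha'] := HI u.
exact/(kerpartP betaDl betaDr _ HS Ha').
Qed.

Lemma rV_torsion_free (k l : nat) (v : 'rV[int]_k) : (0 < l)%N -> v *+ l = 0 -> v = 0.
Proof.
move=> l0 vl; apply/rowP => i; have /rowP/(_ i) := vl.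
by rewrite mulmxnE !mxE => /eqP; rewrite mulrn_eq0 gtn_eqF //= => /eqP.
Qed.

Lemma ext_torsion_free : torsion_free G.
Proof.
move=> [u a] k k0 gk.
have e1 l : ((((u, a) : G) ^+ l)%g : V).1 = u *+ l.
  by elim: l => [|l IH]; rewrite ?expgS // [LHS]/= -/(_.1) IH mulrS.
have u0 : u = 0 by apply: (rV_torsion_free k0); rewrite -e1 gk.
(* The second coordinate of a power is additive only once u = 0 is known. *)
have e2 l : ((((u, a) : G) ^+ l)%g : V).2 = a *+ l.
  elim: l => [|l IH]; rewrite ?expgS //.
  by rewrite [LHS]/= -/(_.2) IH u0 (beta0l betaDl) addr0 mulrS.
have a0 : a = 0 by apply: (rV_torsion_free k0); rewrite -e2 gk.
by rewrite u0 a0.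
Qed.

Lemma ext_free : free_of_rank ext_lie (m + n).
Proof.
pose f (v : 'rV[int]_(m + n)) : V := (lsubmx v, rsubmx v).
have fB : {morph f : x y / x - y} by move=> x y; rewrite /f !linearB.
pose fA := HB.pack_for {additive 'rV[int]_(m + n) -> ext_lie} f
  (GRing.isZmodMorphism.Build _ _ f fB).
exists fA; exists (fun x : V => row_mx x.1 x.2) => [v|[u a]]; first by rewrite /= hsubmxK.
by rewrite /= /f row_mxKl row_mxKr.
Qed.

Hypothesis brk_nondeg : forall u, (forall v, brk u v = 0) -> u = 0.

(** Nondegeneracy of the bracket makes the centre exactly Z^n. *)
Lemma ext_center (g : G) : group_center g <-> (g : V).1 = 0.
Proof.
split=> [gZ|g0 h].
  apply: brk_nondeg => v; have /commgP/eqP := gZ ((v, 0) : V).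
  by rewrite ext_commE => /(congr1 snd).
by apply/commgP/eqP; rewrite ext_commE g0 brk0l.
Qed.

Lemma ext_nilpotent u v : brk u v <> 0 -> nilpotent_of_class_2 G.
Proof.
move=> uv; split=> [g h|]; first by apply/ext_center; rewrite ext_commE.
exists ((u, 0) : V), ((v, 0) : V); rewrite ext_commE => /(congr1 snd).
exact: uv.
Qed.

Lemma ext_associated : associated_lie_ring G ext_lie.
Proof.
exists (fun g : V => (g.1, 0)), (fun g : V => (0, g.2)); split.
- split=> [[u a] [v b]|g]; first by congr pair; rewrite /= addr0.
  by split=> [[g0]|/ext_center g0]; [apply/ext_center|rewrite g0].
- move=> [u a] [v b] /ext_center /= -> _; congr pair; rewrite ?addr0 //=.
  by rewrite (beta0l betaDl) addr0.
- move=> [u a]; exists ((u, 0) : V), ((0, a) : V); split; first exact/ext_center.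
  by congr pair; rewrite /= ?addr0 ?add0r.
- move=> [u a] [v b] /ext_center /= -> [/=]; rewrite addr0 add0r => -> ->.
  by [].
- move=> [u a] [v b] [u' a'] [v' b'] _ _; rewrite ext_commE.
  by rewrite /= /ext_br /= !addr0.
Qed.

End CentralExtension.

(** * Complex powers of integers *)

Section ComplexPower.
Variable R : realType.
Local Notation C := (R[i]).
Implicit Types s : C.

Lemma natcpowX n k s : (0 < n)%N -> natcpow (n ^ k) s = natcpow n s ^+ k.
Proof.
move=> n0; have lnX : ln ((n ^ k)%:R : R) = ln (n%:R : R) *+ k by rewrite natrX lnXn ?ltr0n.
rewrite /natcpow lnX; set t := ln _; elim: k {lnX} => [|k IH].
  by rewrite !mulr0n !mulr0 expR0 cos0 sin0 mul1r mulr0.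
rewrite exprS -IH !mulrS !mulrDr expRD cosD sinD; apply/eqP; rewrite eq_complex /=.
by apply/andP; split; apply/eqP; ring.
Qed.

Lemma norm_natcpow n s : `|natcpow n s| = ((expR (complex.Re s * ln (n%:R : R)))%:C)%C.
Proof.
rewrite /natcpow normc_def /=; congr (_%:C)%C.
by rewrite !exprMn -mulrDr cos2Dsin2 mulr1 sqrtr_sqr ger0_norm ?expR_ge0.
Qed.

End ComplexPower.

Section ExtensionZeta.
Variables (m n : nat) (beta : 'rV[int]_m -> 'rV[int]_m -> 'rV[int]_n).
Hypothesis betaDl : forall u v w, beta (u + v) w = beta u w + beta v w.
Hypothesis betaDr : forall u v w, beta u (v + w) = beta u v + beta u w.
Variable X : set 'rV[int]_n -> set 'rV[int]_m.
Hypothesis XE : forall Lam, X Lam = [set u | forall v, Lam (brk beta u v)].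
Variables (R : realType) (p : nat) (s z : R[i]).
Hypothesis p_pr : prime p.
Local Notation b0 := (fun _ _ => 0 : 'rV[int]_n).
Local Notation Y := (natcpow p (- s)).

Let pk k : (0 < p ^ k)%N. Proof. by rewrite expn_gt0 prime_gt0. Qed.

Lemma ext_group_zeta : has_sum (bideals p beta X) (fun H => Y ^+ blog p beta H) z ->
  group_zeta_value (central_ext betaDl betaDr) p s z.
Proof.
apply: eq_has_sum => H.
  split=> [[HH [k hk] HX]|[HN [k Hk]]].
    have HN : is_normal (H : set (central_ext betaDl betaDr)).
      by apply/ext_is_normal; split=> //; rewrite -XE.
    by split=> //; exists k; apply/(ext_index (pk k) HN.1).
  have [HH HX] := (ext_is_normal _).1 HN.
  by split=> //; [exists k; apply/(ext_index (pk k) HN.1)|rewrite XE].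
move=> [HH [k hk] HX]; rewrite /blog (plogE p_pr hk).
have -> : group_index (H : set (central_ext betaDl betaDr)) = (p ^ k)%N.
  by apply/ext_index.
by rewrite natcpowX ?prime_gt0.
Qed.

Lemma ext_lie_zeta : has_sum (bideals p b0 X) (fun H => Y ^+ blog p b0 H) z ->
  lie_zeta_value (ext_lie betaDl betaDr) p s z.
Proof.
apply: eq_has_sum => I.
  split=> [[HH [k hk] HX]|[HN [k Hk]]].
    have HN : is_ideal (I : set (ext_lie betaDl betaDr)).
      by apply/ext_is_ideal; split=> //; rewrite -XE.
    by split=> //; exists k; apply/(ext_lie_index (pk k) HN).
  have [HH HX] := (ext_is_ideal _).1 HN.
  by split=> //; [exists k; apply/(ext_lie_index (pk k) HN)|rewrite XE].
move=> [HH [k hk] HX]; rewrite /blog (plogE p_pr hk).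
have HN : is_ideal (I : set (ext_lie betaDl betaDr)).
  by apply/ext_is_ideal; split=> //; rewrite -XE.
have -> : lie_index (I : set (ext_lie betaDl betaDr)) = (p ^ k)%N.
  by apply/(ext_lie_index (pk k) HN).
by rewrite natcpowX ?prime_gt0.
Qed.

End ExtensionZeta.

(** * The local zeta functions *)

Section RationalFunctions.

Lemma snum1_morph (T T' : comNzRingType) (f : {rmorphism T -> T'}) x y :
  f (snum1 x y) = snum1 (f x) (f y).
Proof. by rewrite /snum1 !(rmorphD, rmorphN, rmorphM, rmorphXn, rmorph1). Qed.

Lemma snum2_morph (T T' : comNzRingType) (f : {rmorphism T -> T'}) x y :
  f (snum2 x y) = snum2 (f x) (f y).
Proof. by rewrite /snum2 !(rmorphD, rmorphN, rmorphM, rmorphXn, rmorph1). Qed.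

Lemma sden_morph (T T' : comNzRingType) (f : {rmorphism T -> T'}) x y :
  f (sden x y) = sden (f x) (f y).
Proof. by rewrite /sden !(rmorphD, rmorphN, rmorphM, rmorphXn, rmorph1). Qed.

Definition zden (T : comNzRingType) (x y : T) : T := \prod_(i < 6) (1 - x ^+ i * y).

Lemma zden_morph (T T' : comNzRingType) (f : {rmorphism T -> T'}) x y :
  f (zden x y) = zden (f x) (f y).
Proof.
by rewrite /zden rmorph_prod; apply: eq_bigr => i _; rewrite rmorphB rmorph1 rmorphM rmorphXn.
Qed.

(** [poly2_eval] as a ring morphism, so that the values of the numerators and denominators follow
    from their compatibility with morphisms. *)
Definition poly2_ev (C : numFieldType) (x y : C) : {rmorphism {poly {poly rat}} -> C} :=
  horner_eval y \o (horner_eval x%:P \o map_poly (map_poly ratr)).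

Lemma poly2_evE (C : numFieldType) (x y : C) P : poly2_eval P x y = poly2_ev x y P.
Proof. by []. Qed.

Lemma poly2_evX (C : numFieldType) (x y : C) : poly2_ev x y 'X = x.
Proof. by rewrite /poly2_ev /= map_polyX /horner_eval hornerX hornerC. Qed.

Lemma poly2_evY (C : numFieldType) (x y : C) : poly2_ev x y 'X%:P = y.
Proof. by rewrite /poly2_ev /= map_polyC /= map_polyX /horner_eval hornerC hornerX. Qed.

Local Notation PX := ('X : {poly {poly rat}}).
Local Notation PY := ('X%:P : {poly {poly rat}}).

Definition pden : {poly {poly rat}} := zden PX PY * sden PX PY.

Lemma pden_neq0 : pden != 0.
Proof.
apply/eqP => /(congr1 (poly2_ev (0 : rat) 0)); apply/eqP.
rewrite rmorphM zden_morph sden_morph poly2_evX poly2_evY rmorph0 /zden /sden.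
rewrite big1 => [|i _]; last by rewrite mulr0 subr0.
by rewrite !expr0n !mulr0 !subr0 !mulr1 oner_eq0.
Qed.

Lemma snum2_neq0 : snum2 PX PY != 0.
Proof.
apply/eqP => /(congr1 (poly2_ev (1 : rat) 2)).
rewrite snum2_morph poly2_evX poly2_evY rmorph0 /snum2 => h; lra.
Qed.

Lemma ratfun2_value0 (C : numFieldType) (x y : C) : ratfun2_value 0 x y 0.
Proof.
exists 0, 1; rewrite !poly2_evE; split; by rewrite ?rmorph0 ?rmorph1 ?mul0r ?oner_eq0.
Qed.

Lemma ratfun2_value_frac (C : numFieldType) (x y : C) P Q : poly2_ev x y Q != 0 ->
  ratfun2_value (tofrac P / tofrac Q) x y (poly2_ev x y P / poly2_ev x y Q).
Proof. by move=> Q0; exists P, Q. Qed.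

End RationalFunctions.

Section LocalZeta.
Variables (R : realType) (p : nat) (A1 A2 A3 A4 A6 : int) (N : nat) (s : R[i]).
Hypothesis p_pr : prime p.
Hypothesis s10 : 10 < complex.Re s.
Local Notation ann := (annih A1 A2 A3 A4 A6).
Local Notation bDl := (beta6Dl A1 A2 A3 A4 A6).
Local Notation bDr := (beta6Dr A1 A2 A3 A4 A6).
Local Notation C := (R[i]).
Local Notation X := (p%:R : C).
Local Notation Y := (natcpow p (- s)).

Definition local_factor (y : C) : C := zetaZ p 6 y * ((snum1 X y + N%:R * snum2 X y) / sden X y).

Let Q (r : C) : Prop := 0 < r /\ r < (X ^+ 10)^-1.

Let normY : Q `|Y|.
Proof.
have p0 : (0 : R) < p%:R by rewrite ltr0n prime_gt0.
rewrite /Q norm_natcpow; split; first by rewrite ltcR expR_gt0.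
have -> : (X ^+ 10)^-1 = ((expR (- 10 * ln (p%:R : R)))%:C)%C.
  rewrite mulNr expRN expRM_natl lnK ?posrE //.
  by rewrite fmorphV rmorphXn /= rmorph_nat.
rewrite ltcR ltr_expR ltr_pM2r ?ln_gt0 ?ltr1n ?prime_gt1 //.
by case: s s10 => a b /=; rewrite ltrN2.
Qed.

Lemma zden_neq0 : zden X Y != 0.
Proof.
apply/prodf_neq0 => i _; apply: one_sub_neq0.
rewrite -[Y in X in `|X|]expr1; apply: (norm_monomial_lt1 p_pr normY.2) => //.
by have := ltn_ord i; lia.
Qed.

Lemma local_factorE : local_factor Y =
  snum1 X Y / (zden X Y * sden X Y) + N%:R * (snum2 X Y / (zden X Y * sden X Y)).
Proof.
have zE : zetaZ p 6 Y = (zden X Y)^-1.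
  by rewrite /zetaZ /zden -prodfV; apply: eq_bigr => i _; rewrite natrX.
rewrite /local_factor zE; have d1 := zden_neq0; have d2 := sden_neq0 p_pr normY.2.
by field; rewrite d1 d2.
Qed.

Lemma pden_value_neq0 : poly2_ev X Y pden != 0.
Proof.
rewrite rmorphM zden_morph sden_morph poly2_evX poly2_evY mulf_neq0 ?zden_neq0 //.
exact: (sden_neq0 p_pr normY.2).
Qed.

Hypothesis smooth : discriminant (Weierstrass (A1%:~R : 'F_p) A2%:~R A3%:~R A4%:~R A6%:~R) != 0.
Hypothesis hN : Acount p A1 A2 A3 A4 A6 1 1 = (p.-1 * N)%N.

(** The cocycle is left free: [beta6] gives the group and 0 gives the Lie ring, with the same
    annihilators. *)
Let sumQ beta : (forall u v w, beta (u + v) w = beta u w + beta v w) ->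
  (forall u v w, beta u (v + w) = beta u v + beta u w) ->
  (forall Lam, plattices p 3 Lam -> forall u v, ann Lam u -> ann Lam v -> Lam (beta u v - beta v u)) ->
  has_sum (bideals p beta ann) (fun H => Y ^+ blog p beta H) (local_factor Y).
Proof.
move=> Dl Dr bsym.
have := has_sum_bideals p_pr Dl Dr (annih_plattices p_pr A1 A2 A3 A4 A6) bsym.
move=> /(_ _ Q (zetaZ p 6) (fun y => (snum1 X y + N%:R * snum2 X y) / sden X y)).
apply => // y [y0 y1].
  apply: zeta_Zn => //; apply: lt_le_trans y1 _.
  have p0 k : 0 < X ^+ k by rewrite exprn_gt0 // ltr0n prime_gt0.
  by rewrite natrX lef_pV2 ?posrE // ler_weXn2l // ler1n prime_gt0.
exact: has_sum_annih.
Qed.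

Let annE Lam : ann Lam = [set u | forall v, Lam (brk (beta6 A1 A2 A3 A4 A6) u v)].
Proof. by apply/seteqP; split=> u Hu v; have := Hu v; rewrite /brk brackE. Qed.

Lemma local_group_zeta : group_zeta_value (central_ext bDl bDr) p s (local_factor Y).
Proof.
apply: (ext_group_zeta bDl bDr annE p_pr); apply: sumQ.
- exact: bDl.
- exact: bDr.
- by move=> Lam _ u v Hu _; rewrite -brackE.
Qed.

Lemma local_lie_zeta : lie_zeta_value (ext_lie bDl bDr) p s (local_factor Y).
Proof.
apply: (ext_lie_zeta bDl bDr annE p_pr); apply: sumQ => [u v w|u v w|Lam [[L0 _] _] u v _ _].
- by rewrite addr0.
- by rewrite addr0.
- by rewrite subr0.
Qed.

End LocalZeta.

(** * Integral model and reduction modulo p *)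

Section IntegralModel.

Lemma integral_scaling (q : rat) (M : int) i : (denq q %| M)%Z -> (0 < i)%N ->
  exists A : int, A%:~R = M%:~R ^+ i * q :> rat.
Proof.
move=> /dvdzP[k ->] i0; exists ((k * denq q) ^+ i.-1 * k * numq q).
rewrite -[X in _ = _ * X](divq_num_den q) -{2}(prednK i0) exprSr !rmorphM rmorphXn rmorphM /=.
by field; rewrite intr_eq0 denq_neq0.
Qed.

Lemma Fp_intr_eq0 p (p_pr : prime p) (z : int) : (z%:~R == 0 :> 'F_p) = (p %| `|z|)%N.
Proof. by rewrite -(dvdz_pcharf (pchar_Fp p_pr)) dvdzE. Qed.

Lemma Fp_scaling p (p_pr : prime p) (q : rat) (M A : int) i : ~~ (p %| `|denq q|)%N ->
  A%:~R = M%:~R ^+ i * q :> rat -> A%:~R = M%:~R ^+ i * ratr q :> 'F_p.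
Proof.
move=> pq hA; have dn0 : (denq q)%:~R != 0 :> 'F_p by rewrite Fp_intr_eq0.
have e : A * denq q = M ^+ i * numq q.
  apply: (intr_inj (R := rat)); rewrite !rmorphM rmorphXn /= hA -[X in _ * X * _](divq_num_den q).
  by field; rewrite intr_eq0 denq_neq0.
have := congr1 (fun z : int => z%:~R : 'F_p) e; rewrite !rmorphM rmorphXn /= => e'.
by rewrite /ratr mulrA -e' mulfK.
Qed.

Lemma discriminant_morph (T T' : comNzRingType) (f : {rmorphism T -> T'}) a1 a2 a3 a4 a6 :
  f (discriminant (Weierstrass a1 a2 a3 a4 a6)) =
  discriminant (Weierstrass (f a1) (f a2) (f a3) (f a4) (f a6)).
Proof. by rewrite /discriminant /=; ring. Qed.

Lemma discriminant_scaling (T : comNzRingType) (u a1 a2 a3 a4 a6 : T) :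
  discriminant (Weierstrass (u * a1) (u ^+ 2 * a2) (u ^+ 3 * a3) (u ^+ 4 * a4) (u ^+ 6 * a6)) =
  u ^+ 12 * discriminant (Weierstrass a1 a2 a3 a4 a6).
Proof. by rewrite /discriminant /=; ring. Qed.

End IntegralModel.

(** The first coordinate of the bracket suffices: it is the form at (1, 0, 0), whose Pfaffian is
    -1. *)
Lemma brack_nondeg A1 A2 A3 A4 A6 (u : 'rV[int]_6) :
  (forall v, brk (beta6 A1 A2 A3 A4 A6) u v = 0) -> u = 0.
Proof.
move=> H; pose e k : 'rV[int]_6 := row6 [seq (i == k)%:R | i <- iota 0 6].
have Hx k := congr1 (fun w : 'rV_3 => w 0 0) (H (e k)).
have := (Hx 0%N, Hx 1%N, Hx 2%N, Hx 3%N, Hx 4%N, Hx 5%N).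
rewrite /brk -!brackE /brack /structure_form !row3E !mxE /e !cz_row6 //=.
move=> [[[[[h0 h1] h2] h3] h4] h5]; apply: row6P => k k6; rewrite cz0.
by case: k k6 => [|[|[|[|[|[|]]]]]] // _; lia.
Qed.

Definition coord_line_x : line := @Line 1 0 0 isT erefl.
Definition coord_line_y : line := @Line 0 1 0 isT erefl.

Theorem theorem1 (R : realType) (E : weierstrass rat)
    (E_smooth : discriminant E != 0)
    (E_point : exists P : ec_point rat, on_curve E P) :
  exists (G : groupType) (L : lieRing) (M1 M2 : line)
         (P1 P2 P3 P4 P5 : ratfun2),
  [/\ [/\ torsion_free G, nilpotent_of_class_2 G & generated_by_n G 9],
      free_of_rank L 9 /\ associated_lie_ring G L,
      (exists Q : ec_point rat, on_line M1 Q != on_line M2 Q),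
      P2 != 0 &
      exists2 B : seq nat, (forall p, p \in B -> bad_prime E p) &
      forall p : nat, prime p -> p \notin B ->
      exists sigma : R, forall s : R[i], sigma < complex.Re s ->
      exists z1 z2 z3 z4 z5 : R[i],
      let X := p%:R in
      let Y := natcpow p (- s) in
      let z := z1 + #|curve_points E p|%:R * z2
        + #|line_points M1 p :&: curve_points E p|%:R * z3
        + #|line_points M2 p :&: curve_points E p|%:R * z4
        + #|line_points M1 p :&: line_points M2 p :&: curve_points E p|%:R * z5 in
      [/\ [/\ ratfun2_value P1 X Y z1, ratfun2_value P2 X Y z2,
              ratfun2_value P3 X Y z3, ratfun2_value P4 X Y z4 &
              ratfun2_value P5 X Y z5],
          group_zeta_value G p s z & lie_zeta_value L p s z]].
Proof.
(* Scaling x by N^2 and y by N^3 multiplies the coefficient of index i by N^i, which clears all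
   denominators. *)
pose N : int := \prod_(q <- wcoefs E) denq q.
have dvN q : q \in wcoefs E -> (denq q %| N)%Z.
  by move=> qE; rewrite /N (big_rem q qE) dvdz_mulr.
case: E E_smooth {E_point} @N dvN => a1 a2 a3 a4 a6 E_smooth N dvN.
have scal q i : q \in [:: a1; a2; a3; a4; a6] -> (0 < i)%N -> exists A : int, A%:~R = N%:~R ^+ i * q :> rat.
  by move=> qE; apply/integral_scaling/dvN.
have [A1 h1] := scal a1 1%N ltac:(by rewrite !inE eqxx ?orbT) erefl.
have [A2 h2] := scal a2 2%N ltac:(by rewrite !inE eqxx ?orbT) erefl.
have [A3 h3] := scal a3 3%N ltac:(by rewrite !inE eqxx ?orbT) erefl.
have [A4 h4] := scal a4 4%N ltac:(by rewrite !inE eqxx ?orbT) erefl.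
have [A6 h6] := scal a6 6%N ltac:(by rewrite !inE eqxx ?orbT) erefl.
set E := Weierstrass _ _ _ _ _ in E_smooth *.
have nondeg := @brack_nondeg A1 A2 A3 A4 A6.
exists (central_ext (beta6Dl A1 A2 A3 A4 A6) (beta6Dr A1 A2 A3 A4 A6)),
  (ext_lie (beta6Dl A1 A2 A3 A4 A6) (beta6Dr A1 A2 A3 A4 A6)), coord_line_x, coord_line_y,
  (tofrac (snum1 'X 'X%:P) / tofrac pden), (tofrac (snum2 'X 'X%:P) / tofrac pden), 0, 0, 0.
split.
- split; [exact: ext_torsion_free | | exact: (@ext_generated 6 3)].
  pose u : 'rV[int]_6 := row6 [:: 1; 0; 0; 0; 0; 0].
  pose v : 'rV[int]_6 := row6 [:: 0; 1; 0; 0; 0; 0].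
  apply: (ext_nilpotent _ _ nondeg (u := u) (v := v)).
  rewrite /brk -brackE => /rowP /(_ 0); rewrite /brack /structure_form row3E mxE.
  by rewrite !cz_row6 //=; lia.
- split; first exact: (@ext_free 6 3).
  exact: ext_associated.
- by exists (Some (0, 1)).
- by rewrite mulf_neq0 ?invr_eq0 ?tofrac_eq0 ?snum2_neq0 ?pden_neq0.
(* The excluded primes are those where a coefficient is not integral or the numerator of the
   discriminant vanishes. *)
exists (primes (`|numq (discriminant E)| * \prod_(q <- wcoefs E) `|denq q|)%N) => [p|p p_pr pB].
  rewrite mem_primes => /and3P[p_pr _]; rewrite /bad_prime p_pr Euclid_dvdM // => /orP[pD|].
    by rewrite /= /prime_divides_rat E_smooth pD.
  rewrite Euclid_dvd_prod // big_has => /hasP [q qE pq].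
  have q0 : q != 0 by apply: contraTneq pq => ->; rewrite dvdn1 gtn_eqF ?prime_gt1.
  apply/hasP; exists q; first by rewrite in_cons qE orbT.
  by rewrite /prime_divides_rat q0 pq orbT.
have NN : `|N|%N = (\prod_(q <- wcoefs E) `|denq q|)%N by rewrite /N (big_morph absz abszM (erefl _)).
have d0 : (0 < \prod_(q <- wcoefs E) `|denq q|)%N.
  by rewrite prodn_gt0 // => q; rewrite absz_gt0 denq_neq0.
move: pB; rewrite mem_primes p_pr muln_gt0 d0 absz_gt0 numq_eq0 E_smooth /=.
rewrite Euclid_dvdM // Euclid_dvd_prod // big_has negb_or => /andP[pD /hasPn pd].
have pN : N%:~R != 0 :> 'F_p.
  rewrite Fp_intr_eq0 // NN Euclid_dvd_prod // big_has -all_predC; apply/allP => q; exact: pd.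
have f1 := Fp_scaling p_pr (pd a1 ltac:(by rewrite !inE eqxx ?orbT)) h1.
have f2 := Fp_scaling p_pr (pd a2 ltac:(by rewrite !inE eqxx ?orbT)) h2.
have f3 := Fp_scaling p_pr (pd a3 ltac:(by rewrite !inE eqxx ?orbT)) h3.
have f4 := Fp_scaling p_pr (pd a4 ltac:(by rewrite !inE eqxx ?orbT)) h4.
have f6 := Fp_scaling p_pr (pd a6 ltac:(by rewrite !inE eqxx ?orbT)) h6.
have hN : Acount p A1 A2 A3 A4 A6 1 1 = (p.-1 * #|curve_points E p|)%N.
  by have := Acount_points p_pr pN f1 f2 f3 f4 f6.
have smooth : discriminant (Weierstrass (A1%:~R : 'F_p) A2%:~R A3%:~R A4%:~R A6%:~R) != 0.
  set D := discriminant (Weierstrass A1 A2 A3 A4 A6).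
  (* The integral model has discriminant N^12 times that of [E]; as p divides neither N nor the
     numerator, the reduction is smooth. *)
  have eD : D * denq (discriminant E) = N ^+ 12 * numq (discriminant E).
    have DE : D%:~R = discriminant (Weierstrass (A1%:~R : rat) A2%:~R A3%:~R A4%:~R A6%:~R).
      exact: discriminant_morph.
    apply: (intr_inj (R := rat)); rewrite (rmorphM _ D) (rmorphM _ (N ^+ 12)) rmorphXn.
    rewrite [_ D]DE h1 h2 h3 h4 h6 expr1 discriminant_scaling -/E -mulrA; congr (_ * _).
    by rewrite -[X in X * _](divq_num_den (discriminant E)) divfK ?intr_eq0 ?denq_neq0.
  have <- : D%:~R = discriminant (Weierstrass (A1%:~R : 'F_p) A2%:~R A3%:~R A4%:~R A6%:~R).
    exact: discriminant_morph.
  apply: contraNneq pD => D0.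
  have : (D * denq (discriminant E))%:~R = (N ^+ 12 * numq (discriminant E))%:~R :> 'F_p.
    by rewrite eD.
  rewrite (rmorphM _ D) (rmorphM _ (N ^+ 12)) rmorphXn [_ D]D0 mul0r.
  move/esym/eqP; rewrite mulf_eq0 expf_eq0 [_ N == 0](negPf pN) andbF /=.
  by rewrite Fp_intr_eq0.
(* Re s > 10 is |Y| < p^-10, the disc on which every series above converges. *)
exists 10 => s s10; set Y := natcpow p (- s).
exists (poly2_ev p%:R Y (snum1 'X 'X%:P) / poly2_ev p%:R Y pden),
  (poly2_ev p%:R Y (snum2 'X 'X%:P) / poly2_ev p%:R Y pden), 0, 0, 0.
have Q0 := pden_value_neq0 p_pr s10.
have zE (u v w : R[i]) : poly2_ev p%:R Y (snum1 'X 'X%:P) / poly2_ev p%:R Y pden +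
    #|curve_points E p|%:R * (poly2_ev p%:R Y (snum2 'X 'X%:P) / poly2_ev p%:R Y pden) +
    u * 0 + v * 0 + w * 0 = local_factor p #|curve_points E p| Y.
  rewrite (local_factorE _ p_pr s10) !mulr0 !addr0 snum1_morph snum2_morph.
  by rewrite rmorphM zden_morph sden_morph poly2_evX poly2_evY.
split; first by split; [exact: ratfun2_value_frac|exact: ratfun2_value_frac|exact: ratfun2_value0..].
  by rewrite zE; exact: (local_group_zeta p_pr s10 smooth hN).
by rewrite zE; exact: (local_lie_zeta p_pr s10 smooth hN).
Qed.
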